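(* Let $H,U$ be real Hilbert spaces, let $A:D(A)\to H$ be densely defined, closed and selfadjoint, with $A-\alpha\,\mathrm{id}$ dissipative for some $\alpha\in\mathbb{R}$, let $(S(t))_{t\ge 0}$ be the $C_0$ semigroup on $H$ generated by $A$, and let $B\in L(U,H)$. Let $T>0$ and $y_0\in D(A)$. Assume the following. (i) $H=E_\ell\overset{\perp}{\oplus}F_\ell$ (orthogonal direct sum), where $E_\ell\subset D(A)$ has finite dimension $\ell$, $F_\ell$ is a closed subspace such that $F_\ell\cap D(A)$ is dense in $F_\ell$, and $AE_\ell\subset E_\ell$, $A(F_\ell\cap D(A))\subset F_\ell$. Let $P_\ell$ be the orthogonal projection of $H$ onto $E_\ell$. (ii) There exists $\gamma>0$ such that $\Vert(\mathrm{id}-P_\ell)S(t)(\mathrm{id}-P_\ell)z\Vert\le e^{-\gamma t}\Vert(\mathrm{id}-P_\ell)z\Vert$ for all $t\ge 0$ and $z\in H$. (iii) All eigenvalues of $P_\ell AP_\ell$ (regarded as a selfadjoint operator on $E_\ell$) are simple and positive. (iv) $\mathrm{rank}(P_\ell B,P_\ell AP_\ell B,\ldots,P_\ell A^{\ell-1}P_\ell B)=\ell$. (v) $\mathrm{rank}(P_\ell y_0,P_\ell AP_\ell y_0,\ldots,P_\ell A^{\ell-1}P_\ell y_0)=\ell$. Let $m\ge\ell$ be arbitrary. Then there exist $\varepsilon_0>0$ and $n_0\in\mathbb{N}$ such that, for every $\varepsilon\in[0,\varepsilon_0]$ and every $n\ge n_0$, the closed-loop system $$\dot y(t)=\left(A+BK_{n,m}(\varepsilon)\Pi_{\overline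 D_{n,m}}\right)y(t)$$ is exponentially stable, meaning that any of its solutions converges exponentially to $0$ in $H$ as $t\to+\infty$. Here $\overline D_{n,m}$ is the POD subspace and $K_{n,m}(\varepsilon)$ the POD Riccati feedback defined in the context.
   Context: POD subspace. For $n\in\mathbb{N}^*$ set $y_k=S(kT)y_0$ for $k=1,\dots,n$ (snapshots), $D_n=\mathrm{Span}(y_1,\dots,y_n)\subset D(A)$ and $d_n=\dim D_n$. For an integer $m\le d_n$, $\overline D_{n,m}$ denotes a chosen minimizer of $$J(D_{n,m})=\sum_{k=1}^n\Vert y_k-\Pi_{D_{n,m}}y_k\Vert^2$$ over all subspaces $D_{n,m}$ of $D_n$ of dimension $\le m$ (equivalently, equal to $m$), where $\Pi_{D}$ denotes the orthogonal projection onto the subspace $D$. A minimizer exists but may not be unique. Whenever $\overline D_{n,m}$ is used, it is understood that $m\le d_n$. Reduced-order system. On the $m$-dimensional space $\overline D_{n,m}$ set $A_{n,m}=\Pi_{\overline D_{n,m}}A\Pi_{\overline D_{n,m}}$ and $B_{n,m}=\Pi_{\overline D_{n,m}}B$; the reduced-order control system is $\dot Y=A_{n,m}Y+B_{n,m}v$. Riccati feedback. Under the assumptions, for $n$ large enough the pair $(A_{n,m},B_{n,m})$ is stabilizable. Then, for every $\varepsilon\ge 0$, $P_{n,m}(\varepsilon)$ denotes the (unique) maximal symmetric positive semidefinite solution of $$A_{n,m}^*P_{n,m}(\varepsilon)+P_{n,m}(\varepsilon)A_{n,m}-P_{n,m}(\varepsilon)B_{n,m}B_{n,m}^*P_{n,m}(\varepsilon)+\varepsilon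 I_m=0,$$ and $K_{n,m}(\varepsilon)=-B_{n,m}^*P_{n,m}(\varepsilon)$, an operator from $\overline D_{n,m}$ to $U$. *)

(* Defs.v *)
From HB Require Import structures.
From mathcomp Require Import all_boot all_order all_algebra.
From mathcomp Require Import all_classical all_reals all_analysis.

Set Implicit Arguments.
Unset Strict Implicit.
Unset Printing Implicit Defensive.

Import Order.TTheory GRing.Theory Num.Theory.
Import numFieldNormedType.Exports.

Local Open Scope classical_set_scope.
Local Open Scope ring_scope.

(* A real Hilbert space is a complete normed module [H] together with a form
   [dot : {dot H for idfun}] such that [hilbert_dot dot]. *)
Definition hilbert_dot (R : realType) (H : completeNormedModType R)
    (dot : {dot H for idfun}) : Prop :=
  forall x, `|x| ^+ 2 = dot x x.

Section FiniteDimension.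
Context (R : realType) (H : lmodType R).
Implicit Types (V X : set H) (d m : nat).

Definition vsubspace V : Prop := GRing.submod_closed [pred x | x \in V].

Definition lin_span X : set H :=
  [set x | exists d (e : 'I_d -> H) (c : 'I_d -> R),
     (forall i, X (e i)) /\ x = \sum_(i < d) c i *: e i].

Definition lin_indep d (e : 'I_d -> H) : Prop :=
  forall c : 'I_d -> R, \sum_(i < d) c i *: e i = 0 -> forall i, c i = 0.

Definition has_dim V d : Prop :=
  exists e : 'I_d -> H, lin_indep e /\ V = lin_span (range e).

Definition dim_le V m : Prop := exists2 d, has_dim V d & (d <= m)%N.

Definition dim_ge V m : Prop := exists2 d, has_dim V d & (m <= d)%N.

End FiniteDimension.

Section LinearOperators.
Context (R : realType) (H : completeNormedModType R) (dot : {dot H for idfun}).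
Implicit Types (D E F V : set H) (A f : H -> H) (S : R -> H -> H).

(* The orthogonal projection onto [V]; the value is the expected one as soon
   as [V] is complete, in particular as soon as [V] is finite-dimensional. *)
Definition orth_proj V (x : H) : H :=
  xget 0 [set p | V p /\ forall v, V v -> dot (x - p) v = 0].

(* An unbounded operator is a pair of a domain [D] and of a map [A] whose
   values outside of [D] are irrelevant. *)
Definition linear_on D A : Prop :=
  vsubspace D /\
  forall (a : R) x y, D x -> D y -> A (a *: x + y) = a *: A x + A y.

Definition closed_op D A : Prop :=
  closed [set p : H * H | D p.1 /\ p.2 = A p.1].

(* [(D, A)] coincides with its adjoint, domains included. *)
Definition selfadjoint_op D A : Prop :=
  forall y z, (D y /\ A y = z) <-> (forall x, D x -> dot (A x) y = dot x z).

Definition dissipative_op D A : Prop := forall x, D x -> dot (A x) x <= 0.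

Definition c0_semigroup S : Prop :=
  [/\ forall t, 0 <= t -> linear (S t) /\ continuous (S t),
      forall x, S 0 x = x,
      forall s t x, 0 <= s -> 0 <= t -> S (s + t) x = S s (S t x) &
      forall x, S t x @[t --> 0^'+] --> x].

Definition generated_by S D A : Prop :=
  forall x z, (D x /\ A x = z) <->
              (t^-1 *: (S t x - x) @[t --> 0^'+] --> z).

Definition orthogonal_decomposition E F : Prop :=
  (forall x, exists (e f : H), [/\ E e, F f & x = e + f]) /\
  (forall e f : H, E e -> F f -> dot e f = 0).

Definition eigenspace_on E f (lam : R) : set H :=
  [set v | E v /\ f v = lam *: v].

Definition eigenvalue_on E f (lam : R) : Prop :=
  exists2 v, eigenspace_on E f lam v & v <> 0.

(* [rank (P M, P A P M, ..., P A^(l-1) P M) = l], where [P] is the orthogonal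
   projection onto [E] and [W] is the range of [M]. *)
Definition kalman_rank E A (W : set H) (l : nat) : Prop :=
  has_dim
    (lin_span [set orth_proj E (iter j A (orth_proj E w)) | j in `I_l & w in W]) l.

(* Mild solutions of y' = G y, in integrated form
   y(t) = y(0) + G (\int_0^t y(s) ds), where the integral of the continuous
   function y is the primitive Y of y vanishing at 0. *)
Definition mild_solution D (G : H -> H) (y : R -> H) : Prop :=
  {within `[0, +oo[%classic, continuous y} /\
  exists Y : R -> H,
    [/\ {within `[0, +oo[%classic, continuous Y},
        Y 0 = 0,
        forall t : R, 0 < t -> is_derive t 1 Y (y t) &
        forall t : R, 0 <= t -> D (Y t) /\ y t = y 0 + G (Y t)].

Definition exponentially_stable D (G : H -> H) : Prop :=
  exists M beta : R, 0 < beta /\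
    forall y, mild_solution D G y ->
    forall t : R, 0 <= t -> `|y t| <= M * expR (- beta * t) * `|y 0|.

End LinearOperators.

(* The adjoint of [f], seen as an operator from the subspace [V] of [X]
   to a subspace of [Y] containing [y]. *)
Definition adjoint_on (R : realType) (X Y : completeNormedModType R)
    (dotX : {dot X for idfun}) (dotY : {dot Y for idfun})
    (V : set X) (f : X -> Y) (y : Y) : X :=
  xget 0 [set x | V x /\ forall w, V w -> dotY (f w) y = dotX w x].

Section POD.
Context (R : realType) (H : completeNormedModType R) (dot : {dot H for idfun}).
Implicit Types (D : set H) (y : nat -> H).

Definition snapshot (S : R -> H -> H) (T : R) (y0 : H) (k : nat) : H :=
  S (k%:R * T) y0.

Definition snapshot_span y (n : nat) : set H :=
  lin_span [set y k | k in [set k | (1 <= k <= n)%N]].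

Definition pod_cost y (n : nat) D : R :=
  \sum_(1 <= k < n.+1) `|y k - orth_proj dot D (y k)| ^+ 2.

Definition pod_admissible y (n m : nat) D : Prop :=
  [/\ vsubspace D, D `<=` snapshot_span y n & dim_le D m].

Definition pod_subspace y (n m : nat) D : Prop :=
  pod_admissible y n m D /\
  forall D', pod_admissible y n m D' -> pod_cost y n D <= pod_cost y n D'.

End POD.

Section ReducedRiccati.
Context (R : realType) (H U : completeNormedModType R).
Context (dotH : {dot H for idfun}) (dotU : {dot U for idfun}).
Implicit Types (D : set H) (A P : H -> H) (B : U -> H) (eps : R).

Definition reduced_A D A : H -> H :=
  fun x => orth_proj dotH D (A (orth_proj dotH D x)).

Definition reduced_B D B : U -> H := fun u => orth_proj dotH D (B u).

Definition reduced_A_adj D A : H -> H :=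
  adjoint_on dotH dotH D (reduced_A D A).

Definition reduced_B_adj D B : H -> U :=
  adjoint_on dotU dotH setT (reduced_B D B).

(* Only the restriction of [P] to [D] matters. *)
Definition sym_psd_on D P : Prop :=
  [/\ linear_on D P,
      forall x, D x -> D (P x),
      forall x y, D x -> D y -> dotH (P x) y = dotH x (P y) &
      forall x, D x -> 0 <= dotH (P x) x].

Definition riccati_solution D A B eps P : Prop :=
  sym_psd_on D P /\
  forall x, D x ->
    reduced_A_adj D A (P x) + P (reduced_A D A x)
    - P (reduced_B D B (reduced_B_adj D B (P x))) + eps *: x = 0.

Definition maximal_riccati_solution D A B eps P : Prop :=
  riccati_solution D A B eps P /\
  forall Q, riccati_solution D A B eps Q ->
  forall x, D x -> dotH (Q x) x <= dotH (P x) x.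

Definition riccati_feedback D B P : H -> U :=
  fun x => - reduced_B_adj D B (P x).

Definition closed_loop D A B (K : H -> U) : H -> H :=
  fun x => A x + B (K (orth_proj dotH D x)).

End ReducedRiccati.

(* Main.v *)
(** On the unstable space E the Riccati equation with [eps = 0] has an explicit
    solution: in an eigenbasis of A its inverse X solves [A X + X A = B B^*].

    The stable parts of the snapshots decay geometrically, while the coordinates of their
    unstable parts grow like [exp(k T lam_i)] with distinct [lam_i]. Comparing with the
    span of the last snapshots, the optimal POD cost stays bounded in n, so the POD
    subspace D is close to containing E. Closeness in the norm of H is not sufficient
    since A is unbounded; the first variation of the cost shows that D is invariant
    under the covariance operator of the snapshots, and this makes E close to D in the
    graph norm of A.

    Let W be the low-dimensional Riccati solution lifted to D through vectors close to
    the eigenbasis, and V = id + K W' where W' is the lift of its square. Then V is a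
    strict Lyapunov function, uniformly in n, for every feedback whose operator is close
    to W, both on D and on H. Hence W - s V and W + s V are a subsolution and a
    supersolution of the reduced Riccati equation for small eps. Newton's iteration gives
    a solution between them; it is the maximal one, and it is close enough to W for V to
    be a Lyapunov function of the full closed loop. *)

Require Import Defs.
From HB Require Import structures.
From mathcomp Require Import all_boot all_order all_algebra.
From mathcomp Require Import all_classical all_reals all_analysis.
From mathcomp Require Import ring lra zify.

Set Implicit Arguments.
Unset Strict Implicit.
Unset Printing Implicit Defensive.

Import Order.TTheory GRing.Theory Num.Theory.
Import numFieldNormedType.Exports.

Local Open Scope classical_set_scope.
Local Open Scope ring_scope.

(** * Row vectors and quadratic forms *)

(** For [eps = 0] the zero operator also solves the Riccati equation and the cost does not see the
    stable modes, so coercivity cannot single out the stabilizing solution. Moreover the reduced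
    space changes with [n], so there is no fixed matrix equation to perturb. Hence everything is an
    inequality between quadratic forms, with constants that do not depend on [n].

    One form serves twice, namely [<A Y, V Y> - <B^* T Y, B^* V Y>] with a feedback operator [T]
    close to [W]. When the vectors [phi] that define [V] lie in the POD subspace, [V] preserves it,
    and all projections in the reduced operators drop out of the pairing: the inequality is about
    the reduced loop. With the eigenvectors [v] in place of [phi] it is about the full loop on H.
    Neither stability is deduced from the other.

    In the terms that contain [W] or [W'], symmetry moves the unbounded [A] onto the finitely many
    vectors [phi]. This is where closeness of [A phi] to [A v] is used. *)

Lemma quadratic_discriminant (R : realFieldType) (a b c : R) :
  (forall t, 0 <= a + t * (2 * b) + t ^+ 2 * c) -> b ^+ 2 <= a * c.
Proof.
move=> h; have [c0|c0] := eqVneq c 0.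
  have [->|b0] := eqVneq b 0; first by rewrite expr0n c0 mulr0.
  have := h (- (a + 1) / (2 * b)); rewrite c0 mulr0 addr0 divfK ?mulf_neq0//.
  lra.
have cge0 : 0 < c.
  rewrite lt_neqAle eq_sym c0 /=.
  case: (leP 0 c) => // cn.
  have a0 : 0 <= a by have := h 0; rewrite mul0r expr0n mul0r !addr0.
  (* For [c < 0] this [t] makes the quadratic term outweigh the other two, so the polynomial would
     be negative there. *)
  pose t := 1 + (a + `|2 * b|) / (- c).
  have hc : t * (- c) = - c + (a + `|2 * b|) by rewrite mulrDl mul1r divfK ?oppr_eq0.
  have t1 : 1 <= t.
    by rewrite lerDl divr_ge0 ?addr_ge0 ?oppr_ge0 ?(ltW cn).
  have tb : t * (2 * b) <= t * `|2 * b| by rewrite ler_wpM2l ?ler_norm//; lra.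
  have := h t.
  have : t ^+ 2 * c = - (t * (- c + (a + `|2 * b|))) by rewrite -hc; ring.
  have : 0 <= (t - 1) * a by rewrite mulr_ge0//; lra.
  have : 0 < t * - c by rewrite mulr_gt0; lra.
  move=> *; nra.
have := h (- b / c).
have -> : a + - b / c * (2 * b) + (- b / c) ^+ 2 * c = (a * c - b ^+ 2) / c by field.
by rewrite pmulr_lge0 ?invr_gt0// subr_ge0.
Qed.

Lemma unitmx_ker0 (F : fieldType) d (N : 'M[F]_d) :
  (forall x : 'rV_d, x *m N = 0 -> x = 0) -> N \in unitmx.
Proof. by move=> h; rewrite -row_free_unit; apply: inj_row_free. Qed.

Section RowDot.
Variable R : realType.

Definition rowdot d (x y : 'rV[R]_d) : R := (x *m y^T) 0 0.

Section Fixed.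
Variable d : nat.
Implicit Types (x y z : 'rV[R]_d) (N Q : 'M[R]_d).

Lemma rowdotE x y : rowdot x y = \sum_i x 0 i * y 0 i.
Proof. by rewrite /rowdot mxE; apply: eq_bigr => i _; rewrite mxE. Qed.

Lemma rowdotC x y : rowdot x y = rowdot y x.
Proof. by rewrite !rowdotE; apply: eq_bigr => i _; rewrite mulrC. Qed.

Lemma rowdotDl x y z : rowdot (x + y) z = rowdot x z + rowdot y z.
Proof. by rewrite /rowdot mulmxDl mxE. Qed.

Lemma rowdotDr x y z : rowdot z (x + y) = rowdot z x + rowdot z y.
Proof. by rewrite !(rowdotC z) rowdotDl. Qed.

Lemma rowdotZl a x y : rowdot (a *: x) y = a * rowdot x y.
Proof. by rewrite /rowdot -scalemxAl mxE. Qed.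

Lemma rowdotZr a x y : rowdot y (a *: x) = a * rowdot y x.
Proof. by rewrite !(rowdotC y) rowdotZl. Qed.

Lemma rowdotNl x y : rowdot (- x) y = - rowdot x y.
Proof. by rewrite -scaleN1r rowdotZl mulN1r. Qed.

Lemma rowdotNr x y : rowdot x (- y) = - rowdot x y.
Proof. by rewrite -scaleN1r rowdotZr mulN1r. Qed.

Lemma rowdotBl x y z : rowdot (x - y) z = rowdot x z - rowdot y z.
Proof. by rewrite rowdotDl rowdotNl. Qed.

Lemma rowdotBr x y z : rowdot z (x - y) = rowdot z x - rowdot z y.
Proof. by rewrite rowdotDr rowdotNr. Qed.

Lemma rowdot0l x : rowdot 0 x = 0. Proof. by rewrite -(scale0r x) rowdotZl mul0r. Qed.

Lemma rowdotMl N x y : rowdot (x *m N) y = rowdot x (y *m N^T).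
Proof. by rewrite /rowdot trmx_mul trmxK mulmxA. Qed.

Lemma rowdotM_sym N x y : N^T = N -> rowdot (x *m N) y = rowdot x (y *m N).
Proof. by move=> h; rewrite rowdotMl h. Qed.

Lemma rowdot_ge0 x : 0 <= rowdot x x.
Proof. by rewrite rowdotE sumr_ge0// => i _; rewrite -expr2 sqr_ge0. Qed.

Lemma rowdot_eq0 x : rowdot x x = 0 -> x = 0.
Proof.
rewrite rowdotE => /eqP; rewrite psumr_eq0; last by move=> i _; rewrite -expr2 sqr_ge0.
move=> /allP h; apply/rowP => i; rewrite mxE.
by have := h i (mem_index_enum i); rewrite -expr2 sqrf_eq0 => /eqP.
Qed.

Lemma rowdot_gt0 x : x != 0 -> 0 < rowdot x x.
Proof.
move=> x0; rewrite lt_neqAle rowdot_ge0 andbT eq_sym.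
by apply: contra x0 => /eqP/rowdot_eq0 ->.
Qed.

Lemma psd_cauchy N x y : N^T = N -> (forall z, 0 <= rowdot (z *m N) z) ->
  rowdot (x *m N) y ^+ 2 <= rowdot (x *m N) x * rowdot (y *m N) y.
Proof.
move=> sN pN; apply: quadratic_discriminant => t.
have := pN (x + t *: y).
rewrite mulmxDl -scalemxAl !rowdotDl !rowdotDr !rowdotZl !rowdotZr.
rewrite (rowdotM_sym y x sN) (rowdotC y (x *m N)).
by congr (_ <= _); ring.
Qed.

Lemma rowdot_cauchy x y : rowdot x y ^+ 2 <= rowdot x x * rowdot y y.
Proof.
have h := @psd_cauchy 1%:M x y; rewrite !mulmx1 in h.
apply: h; first by rewrite trmx1.
by move=> z; rewrite mulmx1 rowdot_ge0.
Qed.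

Lemma rowdot_delta N i j :
  rowdot (delta_mx 0 i *m N) (delta_mx 0 j) = N i j.
Proof.
rewrite /rowdot -rowE mxE (bigD1 j)//= big1 ?addr0 => [|k kj].
  by rewrite !mxE !eqxx mulr1.
by rewrite !mxE eqxx (negPf kj) mulr0.
Qed.

Lemma rowdot_polar N x y : N^T = N ->
  rowdot (x *m N) y = 2^-1 * (rowdot ((x + y) *m N) (x + y) - rowdot (x *m N) x - rowdot (y
    *m N) y).
Proof.
move=> sN; rewrite mulmxDl !rowdotDl !rowdotDr (rowdotM_sym y x sN) (rowdotC y (x *m N)).
by field.
Qed.

Lemma sym_form_eq0 N : N^T = N -> (forall x, rowdot (x *m N) x = 0) -> N = 0.
Proof.
by move=> sN h; apply/matrixP => i j; rewrite -rowdot_delta rowdot_polar// !h mxE; ring.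
Qed.

Lemma mx_bound N : exists2 C, 0 <= C &
  forall x, rowdot (x *m N) (x *m N) <= C * rowdot x x.
Proof.
exists (\sum_i rowdot (row i N^T) (row i N^T)).
  by rewrite sumr_ge0// => i _; exact: rowdot_ge0.
move=> x; rewrite (rowdotE (x *m N)) mulr_suml ler_sum// => i _.
have -> : (x *m N) 0 i = rowdot x (row i N^T).
  by rewrite rowdotE mxE; apply: eq_bigr => j _; rewrite !mxE.
by rewrite -expr2 mulrC rowdot_cauchy.
Qed.

Lemma form_bound N : exists2 C, 0 <= C & forall x, `|rowdot (x *m N) x| <= C * rowdot x x.
Proof.
have [C C0 h] := mx_bound N; exists (1 + C); first by lra.
move=> x; have x0 := rowdot_ge0 x.
rewrite -(@ler_pXn2r _ 2)// ?nnegrE ?mulr_ge0//; last by lra.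
rewrite real_normK ?num_real//.
apply: (le_trans (rowdot_cauchy _ _)).
have := h x => hx.
apply: (@le_trans _ _ ((C * rowdot x x) * rowdot x x)); first by rewrite ler_wpM2r.
by rewrite exprMn -mulrA -expr2 ler_wpM2r ?sqr_ge0//; nra.
Qed.

(* Take the least [s >= 0] with [Z + s V >= 0]. If [s > 0], then [Z + s V] has almost null
   vectors, and the Cauchy-Schwarz inequality for this form contradicts the strict
   decay of [V]. *)
Lemma lyap_nonneg (Ac V Z : 'M[R]_d) (c : R) :
  V^T = V -> Z^T = Z -> 0 < c ->
  (forall x, rowdot x x <= rowdot (x *m V) x) ->
  (forall x, rowdot (x *m Ac) (x *m V) <= - c * rowdot x x) ->
  (forall x, rowdot (x *m Ac) (x *m Z) <= 0) ->
  forall x, 0 <= rowdot (x *m Z) x.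
Proof.
move=> sV sZ c0 V1 Vc Zc.
pose A := [set s : R | 0 <= s /\ forall x, 0 <= rowdot (x *m Z) x + s * rowdot (x *m V) x].
have [C C0 hC] := form_bound Z.
have A0 : A !=set0.
  exists C; split=> // x; have := hC x; rewrite ler_norml => /andP[h _].
  have : C * rowdot x x <= C * rowdot (x *m V) x by rewrite ler_wpM2l.
  lra.
have lA : has_lbound A by exists 0 => s [].
pose s := inf A.
have s_ge0 : 0 <= s by apply: lb_le_inf => // t [].
have psd x : 0 <= rowdot (x *m (Z + s *: V)) x.
  rewrite mulmxDr -scalemxAr rowdotDl rowdotZl.
  have [->|x0] := eqVneq x 0; first by rewrite !mul0mx !rowdot0l mulr0 addr0.
  have vx : 0 < rowdot (x *m V) x by apply: lt_le_trans (V1 x); exact: rowdot_gt0.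
  have : - rowdot (x *m Z) x / rowdot (x *m V) x <= s.
    apply: lb_le_inf => // t [t0 /(_ x) ht].
    by rewrite ler_pdivrMr//; lra.
  by rewrite ler_pdivrMr//; lra.
suff -> : Z = Z + s *: V by [].
suff -> : s = 0 by rewrite scale0r addr0.
apply/eqP; rewrite eq_le s_ge0 andbT leNgt; apply/negP => s0.
have [CV CV0 hV] := form_bound V.
have [CZ CZ0 hZ] := form_bound (Z + s *: V).
have [CA CA0 hA] := mx_bound Ac.
have sZV : (Z + s *: V)^T = Z + s *: V.
  by apply/matrixP => i j; rewrite !mxE -{1}sZ -{1}sV !mxE.
pose K := CV * (CZ * CA).
have K0 : 0 <= K by rewrite !mulr_ge0.
(* [th <= s / 2] keeps [s - th] nonnegative. By minimality of [s], [Z + (s - th) V] is negative at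
   some vector, and there [th * K < (s * c) ^+ 2] contradicts Cauchy-Schwarz. *)
pose th := Num.min (s / 2) ((s * c) ^+ 2 / (2 * (K + 1))).
have th0 : 0 < th.
  rewrite lt_min divr_gt0//= divr_gt0// ?exprn_gt0 ?mulr_gt0//; lra.
have thK : th * K < (s * c) ^+ 2.
  have sc0 : 0 < (s * c) ^+ 2 by rewrite exprn_gt0// mulr_gt0.
  have : th <= (s * c) ^+ 2 / (2 * (K + 1)) by rewrite ge_min lexx orbT.
  rewrite ler_pdivlMr; last by lra.
  nra.
have ths : th <= s / 2 by rewrite ge_min lexx.
have : ~ A (s - th).
  move=> /(ge_inf lA); rewrite -/s; lra.
move=> /not_andP[]; first by lra.
move=> /existsNP[x /negP]; rewrite -ltNge => hx.
have x0 : x != 0.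
  by apply/eqP => x0; move: hx; rewrite x0 !mul0mx !rowdot0l mulr0 addr0 ltxx.
have xx := rowdot_gt0 x0.
have := psd_cauchy x (x *m Ac) sZV psd.
rewrite {1}mulmxDr -scalemxAr rowdotDl rowdotZl (rowdotC _ (x *m Ac)) (rowdotC (x *m V)).
set l := _ + _.
have hl : l <= - (s * c * rowdot x x).
  have := Vc x; have := Zc x; rewrite /l => h1 h2.
  have : s * rowdot (x *m Ac) (x *m V) <= s * (- c * rowdot x x) by rewrite ler_wpM2l.
  lra.
have hl2 : (s * c * rowdot x x) ^+ 2 <= l ^+ 2.
  have sc : 0 <= s * c * rowdot x x by rewrite !mulr_ge0// ltW.
  by rewrite -(sqrrN l) ler_pXn2r ?nnegrE//; lra.
have q1 : rowdot (x *m (Z + s *: V)) x <= th * (CV * rowdot x x).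
  rewrite mulmxDr -scalemxAr rowdotDl rowdotZl.
  have := hV x; rewrite ler_norml => /andP[_ h].
  have : th * rowdot (x *m V) x <= th * (CV * rowdot x x) by rewrite ler_wpM2l// ltW.
  lra.
have q2 : rowdot (x *m Ac *m (Z + s *: V)) (x *m Ac) <= CZ * (CA * rowdot x x).
  have := hZ (x *m Ac); rewrite ler_norml => /andP[_ h]; apply: (le_trans h).
  by rewrite ler_wpM2l.
move=> h.
have : (s * c * rowdot x x) ^+ 2 <= th * (CV * rowdot x x) * (CZ * (CA * rowdot x x)).
  apply: (le_trans hl2); apply: (le_trans h).
  by apply: ler_pM => //; exact: psd.
have -> : th * (CV * rowdot x x) * (CZ * (CA * rowdot x x)) = th * K * rowdot x x ^+ 2.
  by rewrite /K; ring.
by rewrite exprMn ler_pM2r ?exprn_gt0// leNgt thK.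
Qed.

End Fixed.
End RowDot.

(** * Lyapunov and Riccati equations for symmetric matrices *)

Lemma cvg_bigsum (R : realType) (V : normedModType R) (T I : Type)
    (F : set_system T) {FF : Filter F} (r : seq I) (f : I -> T -> V) (l : I -> V) :
  (forall i, f i @ F --> l i) ->
  (fun x => \sum_(i <- r) f i x) @ F --> \sum_(i <- r) l i.
Proof.
move=> h; elim: r => [|i r IH].
  by rewrite big_nil; under eq_fun do rewrite big_nil; exact: cvg_cst.
by rewrite big_cons; under eq_fun do rewrite big_cons; exact: cvgD.
Qed.

Section Riccati.
Variables (R : realType) (d : nat).
Implicit Types (x y z : 'rV[R]_d) (N Q X Z : 'M[R]_d).

Definition psd N := forall x, 0 <= rowdot (x *m N) x.

Definition lyap_cert (V Ac : 'M[R]_d) (c : R) :=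
  forall x, rowdot (x *m Ac) (x *m V) <= - c * rowdot x x.

Lemma addmx_entry N Q i j : (N + Q) i j = N i j + Q i j. Proof. by rewrite mxE. Qed.
Lemma oppmx_entry N i j : (- N) i j = - N i j. Proof. by rewrite mxE. Qed.

Lemma trmxD_mx N Q : (N + Q)^T = N^T + Q^T. Proof. exact: linearD. Qed.
Lemma trmxN_mx N : (- N)^T = - N^T. Proof. exact: linearN. Qed.

Lemma lyap_form Ac Z x : Z^T = Z ->
  rowdot (x *m (Ac *m Z + Z *m Ac^T)) x = 2 * rowdot (x *m Ac) (x *m Z).
Proof.
move=> sZ; rewrite mulmxDr rowdotDl !mulmxA -(rowdotM_sym _ _ sZ).
by rewrite [rowdot (x *m Z *m _) x]rowdotMl trmxK (rowdotC (x *m Z)) -(rowdotM_sym _ _ sZ);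
  ring.
Qed.

(** Takes the place of the integral representation of [Z] along the flow of [Ac]: the certificate
    [V] replaces the matrix exponential. *)
Lemma lyap_psd (V Ac Z W : 'M[R]_d) (c : R) :
  V^T = V -> (forall x, rowdot x x <= rowdot (x *m V) x) -> 0 < c -> lyap_cert V Ac c ->
  Z^T = Z -> Ac *m Z + Z *m Ac^T = - W -> psd W -> psd Z.
Proof.
move=> sV V1 c0 hV sZ hZ hW; apply: (lyap_nonneg sV sZ c0 V1 hV) => x.
have := lyap_form Ac x sZ; rewrite hZ mulmxN rowdotNl => h.
by have := hW x; lra.
Qed.

Lemma psd0 : psd 0. Proof. by move=> x; rewrite mulmx0 rowdot0l. Qed.

Lemma lyap_unique (V Ac Z : 'M[R]_d) (c : R) :
  V^T = V -> (forall x, rowdot x x <= rowdot (x *m V) x) -> 0 < c -> lyap_cert V Ac c ->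
  Z^T = Z -> Ac *m Z + Z *m Ac^T = 0 -> Z = 0.
Proof.
move=> sV V1 c0 hV sZ hZ; apply: sym_form_eq0 => // x; apply/eqP.
have p1 : psd Z by apply: (lyap_psd sV V1 c0 hV sZ _ psd0); rewrite oppr0.
have p2 : psd (- Z).
  apply: (lyap_psd sV V1 c0 hV _ _ psd0); first by rewrite trmxN_mx sZ.
  by rewrite mulmxN mulNmx -opprD hZ.
have := p2 x; rewrite mulmxN rowdotNl oppr_ge0 => h.
by rewrite eq_le h p1.
Qed.

(* On all matrices the Lyapunov operator is only understood through the
   symmetric part; adding the antisymmetric part makes it injective. *)
Definition symmetrized_lyapunov (Ac X : 'M[R]_d) : 'M[R]_d :=
  Ac *m (X + X^T) + (X + X^T) *m Ac^T + (X - X^T).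

Lemma symmetrized_lyapunov_linear Ac : linear (symmetrized_lyapunov Ac).
Proof.
move=> a X Y; apply/matrixP => i j.
have e : (a *: X + Y)^T = a *: X^T + Y^T by rewrite linearP.
rewrite /symmetrized_lyapunov e !mulmxDr !mulmxDl.
by rewrite -!scalemxAr -!scalemxAl !mxE /=; ring.
Qed.

Lemma lyap_solve (V Ac W : 'M[R]_d) (c : R) :
  V^T = V -> (forall x, rowdot x x <= rowdot (x *m V) x) -> 0 < c -> lyap_cert V Ac c ->
  W^T = W -> exists2 X, X^T = X & Ac *m X + X *m Ac^T = W.
Proof.
move=> sV V1 c0 hV sW.
pose f := symmetrized_lyapunov Ac.
pose lf := GRing.isLinear.Build R 'M[R]_d 'M[R]_d _ f (symmetrized_lyapunov_linear Ac).
pose F : {linear 'M[R]_d -> 'M[R]_d} := HB.pack f lf.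
(* With a symmetric right-hand side, comparing the equation with its transpose forces the
   antisymmetric part of [X] to vanish. *)
have split X W' : W'^T = W' -> symmetrized_lyapunov Ac X = W' ->
    X = X^T /\ Ac *m (X + X^T) + (X + X^T) *m Ac^T = W'.
  move=> sW' hX; have : (symmetrized_lyapunov Ac X)^T = symmetrized_lyapunov Ac X by rewrite hX.
  rewrite /symmetrized_lyapunov !trmxD_mx trmxN_mx !trmx_mul !trmxD_mx !trmxK => hT.
  have e : X = X^T.
    apply/matrixP => i j; move/matrixP/(_ i j): hT; rewrite (addrC X^T X).
    by rewrite [in LHS]addmx_entry [in RHS]addmx_entry !addmx_entry !oppmx_entry; lra.
  by split=> //; move: hX; rewrite /symmetrized_lyapunov -e subrr addr0.
have inj X : symmetrized_lyapunov Ac X = 0 -> X = 0.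
  move=> /split[]; first by rewrite trmx0.
  move=> e h; have S0 : X + X^T = 0.
    by apply: (lyap_unique sV V1 c0 hV _ h); rewrite trmxD_mx trmxK addrC.
  apply/matrixP => i j; move/matrixP/(_ i j): S0.
  by rewrite -e !mxE; lra.
have u : lin_mx F \in unitmx.
  apply: unitmx_ker0 => x; rewrite -(vec_mxK x) mul_vec_lin => /eqP.
  rewrite mxvec_eq0 => /eqP /inj ->.
  by rewrite linear0.
pose X := vec_mx (mxvec W *m invmx (lin_mx F)).
have hX : symmetrized_lyapunov Ac X = W.
  apply: (can_inj mxvecK); rewrite -(mul_vec_lin F).
  by rewrite vec_mxK mulmxKV.
have [e h] := split _ _ sW hX.
by exists (X + X^T) => //; rewrite trmxD_mx trmxK addrC.
Qed.

(** * Newton's iteration for the matrix Riccati equation *)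

Variables (A M : 'M[R]_d) (eps : R).
Hypotheses (sA : A^T = A) (sM : M^T = M) (psdM : psd M).

Definition ric X := A *m X + X *m A - X *m M *m X + eps%:M.

Definition closed_loop_mx Q : 'M[R]_d := A - Q *m M.

Lemma closed_loop_mxT Q : Q^T = Q -> (closed_loop_mx Q)^T = A - M *m Q.
Proof. by move=> sQ; rewrite /closed_loop_mx trmxD_mx trmxN_mx trmx_mul sA sM sQ. Qed.

Lemma psd_conj N Q : Q^T = Q -> psd N -> psd (Q *m N *m Q).
Proof. by move=> sQ pN x; rewrite !mulmxA (rowdotM_sym _ _ sQ). Qed.

Ltac mxring := apply/matrixP => ? ?; rewrite ?(addmx_entry, oppmx_entry); ring.

(** Exact second-order Taylor formula for [ric] at [Q]: the linear part is the Lyapunov operator of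
    the loop closed by [Q], the remainder is quadratic. Newton's step, its monotonicity and the
    maximality are all read off from it. *)
Lemma ric_closed_loop Q X : Q^T = Q ->
  ric X = closed_loop_mx Q *m X + X *m (closed_loop_mx Q)^T + Q *m M *m Q + eps%:M
          - (Q - X) *m M *m (Q - X).
Proof.
move=> sQ; rewrite /ric closed_loop_mxT// /closed_loop_mx !(mulmxBl, mulmxBr) !mulmxA; mxring.
Qed.

Lemma newton_step Q X : Q^T = Q ->
  closed_loop_mx Q *m X + X *m (closed_loop_mx Q)^T = - (Q *m M *m Q + eps%:M) ->
  ric X = - ((Q - X) *m M *m (Q - X)).
Proof. by move=> sQ h; rewrite (ric_closed_loop X sQ) h; mxring. Qed.

(** Used with [Z = Q] for the monotonicity of the iteration and with the subsolution [Zm] for its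
    lower bound. *)
Lemma newton_diff Q X Z : Q^T = Q ->
  closed_loop_mx Q *m X + X *m (closed_loop_mx Q)^T = - (Q *m M *m Q + eps%:M) ->
  closed_loop_mx Q *m (X - Z) + (X - Z) *m (closed_loop_mx Q)^T =
    - (ric Z + (Q - Z) *m M *m (Q - Z)).
Proof.
move=> sQ h; rewrite (ric_closed_loop Z sQ) (mulmxBr (closed_loop_mx Q) X Z) (mulmxBl X Z).
set a := closed_loop_mx Q *m Z; set b := Z *m _.
have -> : closed_loop_mx Q *m X - a + (X *m (closed_loop_mx Q)^T - b) =
  (closed_loop_mx Q *m X + X *m (closed_loop_mx Q)^T) - a - b by mxring.
by rewrite h; mxring.
Qed.

Lemma sym_mxB N Q : N^T = N -> Q^T = Q -> (N - Q)^T = N - Q.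
Proof. by move=> sN sQ; rewrite trmxD_mx trmxN_mx sN sQ. Qed.

Variables (V Zm Zp : 'M[R]_d) (c : R).
Hypotheses (sV : V^T = V) (V1 : forall x, rowdot x x <= rowdot (x *m V) x) (c0 : 0 < c).
Hypotheses (sZm : Zm^T = Zm) (sZp : Zp^T = Zp) (leZ : psd (Zp - Zm)).
Hypotheses (ricZm : psd (ric Zm)) (ricZp : psd (- ric Zp)).

(** The order interval on which a single [V] certifies every closed loop; Newton's iteration never
    leaves it. *)
Definition between Q := [/\ Q^T = Q, psd (Q - Zm) & psd (Zp - Q)].

Hypothesis cert : forall Q, between Q -> lyap_cert V (closed_loop_mx Q) c.

Lemma psdD N Q : psd N -> psd Q -> psd (N + Q).
Proof. by move=> h1 h2 x; rewrite mulmxDr rowdotDl addr_ge0. Qed.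

Lemma newton_exists Q : between Q -> psd (- ric Q) ->
  exists X, [/\ between X, psd (- ric X), psd (Q - X) &
    closed_loop_mx Q *m X + X *m (closed_loop_mx Q)^T = - (Q *m M *m Q + eps%:M)].
Proof.
move=> bQ rQ; have [sQ Q1 Q2] := bQ.
have sW : (- (Q *m M *m Q + eps%:M))^T = - (Q *m M *m Q + eps%:M).
  by rewrite trmxN_mx trmxD_mx !trmx_mul sQ sM tr_scalar_mx mulmxA.
have [X sX hX] := lyap_solve sV V1 c0 (cert bQ) sW.
have XQ : psd (Q - X).
  have h := newton_diff Q sQ hX; rewrite subrr !mul0mx addr0 in h.
  apply: (lyap_psd sV V1 c0 (cert bQ) _ _ rQ); first exact: sym_mxB.
  rewrite -[Q - X]opprB mulmxN mulNmx -opprD h; mxring.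
have XZ : psd (X - Zm).
  apply: (lyap_psd sV V1 c0 (cert bQ) _ (newton_diff Zm sQ hX)); first exact: sym_mxB.
  by apply: psdD => //; apply: psd_conj => //; exact: sym_mxB.
exists X; split => //.
- split=> //; have -> : Zp - X = (Zp - Q) + (Q - X) by mxring.
  exact: psdD.
- rewrite (newton_step sQ hX) opprK; apply: psd_conj => //; exact: sym_mxB.
Qed.

Definition mx_cvg (X_ : nat -> 'M[R]_d) X :=
  forall i j, (fun k => X_ k i j) @ \oo --> X i j.

Lemma mx_cvgM (X_ Y_ : nat -> 'M[R]_d) X Y : mx_cvg X_ X -> mx_cvg Y_ Y ->
  mx_cvg (fun k => X_ k *m Y_ k) (X *m Y).
Proof.
move=> hX hY i j; rewrite mxE; under eq_fun do rewrite mxE.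
by apply: cvg_bigsum => k; apply: cvgM; [exact: hX | exact: hY].
Qed.

Lemma mx_cvgD (X_ Y_ : nat -> 'M[R]_d) X Y : mx_cvg X_ X -> mx_cvg Y_ Y ->
  mx_cvg (fun k => X_ k + Y_ k) (X + Y).
Proof.
move=> hX hY i j; rewrite mxE; under eq_fun do rewrite mxE.
by apply: cvgD; [exact: hX | exact: hY].
Qed.

Lemma mx_cvgN (X_ : nat -> 'M[R]_d) X : mx_cvg X_ X -> mx_cvg (fun k => - X_ k) (- X).
Proof.
move=> hX i j; rewrite mxE; under eq_fun do rewrite mxE.
by apply: cvgN; exact: hX.
Qed.

Lemma mx_cvg_cst X : mx_cvg (fun=> X) X.
Proof. by move=> i j; exact: cvg_cst. Qed.

Lemma mx_cvg_tr (X_ : nat -> 'M[R]_d) X : mx_cvg X_ X -> mx_cvg (fun k => (X_ k)^T) X^T.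
Proof. by move=> hX i j; rewrite mxE; under eq_fun do rewrite mxE; exact: hX. Qed.

Lemma mx_cvg_shift (X_ : nat -> 'M[R]_d) X : mx_cvg X_ X -> mx_cvg (fun k => X_ k.+1) X.
Proof. by move=> hX i j; rewrite (@cvg_shiftS _ (fun k => X_ k i j)); exact: hX. Qed.

Lemma mx_cvg_unique (X_ : nat -> 'M[R]_d) X Y : mx_cvg X_ X -> mx_cvg X_ Y -> X = Y.
Proof. by move=> hX hY; apply/matrixP => i j; exact: (cvg_unique _ (hX i j) (hY i j)). Qed.

Lemma mx_cvg_form (X_ : nat -> 'M[R]_d) X x y : mx_cvg X_ X ->
  (fun k => rowdot (x *m X_ k) y) @ \oo --> rowdot (x *m X) y.
Proof.
move=> hX; rewrite rowdotE; under eq_fun do rewrite rowdotE.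
apply: cvg_bigsum => j; apply: cvgMr_tmp; rewrite mxE; under eq_fun do rewrite mxE.
by apply: cvg_bigsum => i; apply: cvgMl_tmp; exact: hX.
Qed.

Lemma mx_cvg_psd (X_ : nat -> 'M[R]_d) X : (forall k, psd (X_ k)) -> mx_cvg X_ X -> psd X.
Proof.
move=> h hX x; apply: (ler_cvg_to (cvg_cst (0 : R)) (mx_cvg_form hX)).
by apply: nearW => k; exact: h.
Qed.

(** The values of each form are a monotone bounded real sequence, and polarization recovers the
    entries from them. *)
Lemma mx_cvg_monotone (X_ : nat -> 'M[R]_d) Z :
  (forall k, (X_ k)^T = X_ k) -> (forall k, psd (X_ k - X_ k.+1)) ->
  (forall k, psd (X_ k - Z)) -> exists X, mx_cvg X_ X.
Proof.
move=> sX dX lX.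
have cv x : cvgn (fun k => rowdot (x *m X_ k) x).
  apply: nonincreasing_is_cvgn.
    apply/nonincreasing_seqP => k; have := dX k x.
    by rewrite mulmxBr rowdotBl subr_ge0.
  exists (rowdot (x *m Z) x) => _ [k _ <-]; have := lX k x.
  by rewrite mulmxBr rowdotBl subr_ge0.
have cvij i j : cvgn (fun k => X_ k i j).
  have -> : (fun k => X_ k i j) = (fun k =>
    2^-1 * (rowdot ((delta_mx 0 i + delta_mx 0 j) *m X_ k) (delta_mx 0 i + delta_mx 0 j)
       - rowdot (delta_mx 0 i *m X_ k) (delta_mx 0 i)
       - rowdot (delta_mx 0 j *m X_ k) (delta_mx 0 j))).
    by apply/funext => k; rewrite -(rowdot_delta (X_ k)) rowdot_polar.
  by apply: is_cvgMr; apply: is_cvgB; [apply: is_cvgB|]; exact: cv.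
exists (\matrix_(i, j) limn (fun k => X_ k i j)) => i j.
by rewrite mxE; exact: cvij.
Qed.

Arguments mx_cvgM {X_ Y_ X Y} _ _.
Arguments mx_cvgD {X_ Y_ X Y} _ _.
Arguments mx_cvgN {X_ X} _.
Arguments mx_cvg_cst X : clear implicits.
Arguments mx_cvg_tr {X_ X} _.
Arguments mx_cvg_shift {X_ X} _.

(* Newton's iteration started at the supersolution [Zp] decreases and stays above
   the subsolution [Zm]. *)
Theorem riccati_exists : exists2 Q, between Q & ric Q = 0.
Proof.
pose T := {Q : 'M[R]_d | between Q /\ psd (- ric Q)}.
have bZp : between Zp by split=> //; rewrite subrr; exact: psd0.
have next (Q : T) : {X : T | psd (sval Q - sval X) /\
    closed_loop_mx (sval Q) *m sval X + sval X *m (closed_loop_mx (sval Q))^T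
      = - (sval Q *m M *m sval Q + eps%:M)}.
  apply/cid; case: Q => Q [bQ rQ] /=.
  by have [X [b1 b2 b3 b4]] := newton_exists bQ rQ; exists (exist _ X (conj b1 b2)).
pose Q_ k : T := iter k (fun Q : T => sval (next Q)) (exist _ Zp (conj bZp ricZp)).
have bQ k : between (sval (Q_ k)) by case: (Q_ k) => Q [].
have dQ k : psd (sval (Q_ k) - sval (Q_ k.+1)).
  by have := svalP (next (Q_ k)) => -[].
have eQ k : ric (sval (Q_ k.+1)) =
    - ((sval (Q_ k) - sval (Q_ k.+1)) *m M *m (sval (Q_ k) - sval (Q_ k.+1))).
  apply: newton_step; first by case: (bQ k).
  by have := svalP (next (Q_ k)) => -[].
have [] := @mx_cvg_monotone (fun k => sval (Q_ k)) Zm.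
- by move=> k; case: (bQ k).
- exact: dQ.
- by move=> k; case: (bQ k).
move=> Q hQ; exists Q.
  split.
  - apply: (mx_cvg_unique (mx_cvg_tr hQ)).
    by under eq_fun => k do case: (bQ k) => -> _ _.
  - apply: (mx_cvg_psd _ (mx_cvgD hQ (mx_cvg_cst (- Zm)))) => k; by case: (bQ k).
  - apply: (mx_cvg_psd _ (mx_cvgD (mx_cvg_cst Zp) (mx_cvgN hQ))) => k; by case: (bQ k).
have h1 : mx_cvg (fun k => ric (sval (Q_ k.+1))) (ric Q).
  have hQ' := mx_cvg_shift hQ.
  apply: mx_cvgD (mx_cvg_cst _); apply: mx_cvgD.
    by apply: mx_cvgD; apply: mx_cvgM => //; exact: mx_cvg_cst.
  by apply: mx_cvgN; apply: mx_cvgM => //; apply: mx_cvgM => //; exact: mx_cvg_cst.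
(* Consecutive iterates have the same limit, so the quadratic remainder of Newton's step vanishes
   there. *)
have h2 : mx_cvg (fun k => ric (sval (Q_ k.+1))) (- ((Q - Q) *m M *m (Q - Q))).
  under eq_fun do rewrite eQ.
  have hd := mx_cvgD hQ (mx_cvgN (mx_cvg_shift hQ)).
  by apply: mx_cvgN; apply: mx_cvgM => //; apply: mx_cvgM => //; exact: mx_cvg_cst.
by rewrite (mx_cvg_unique h1 h2) subrr !mul0mx oppr0.
Qed.

(** Expanding at the solution [Q], its difference with another solution solves a Lyapunov equation
    with negative right-hand side. Only the loop closed by [Q] has to be stable, so [X] ranges over
    all symmetric solutions. *)
Lemma riccati_maximal Q X : between Q -> ric Q = 0 -> X^T = X -> ric X = 0 ->
  psd (Q - X).
Proof.
move=> bQ rQ sX rX; have [sQ _ _] := bQ.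
apply: (lyap_psd sV V1 c0 (cert bQ) (W := (Q - X) *m M *m (Q - X))).
- exact: sym_mxB.
- have e1 := ric_closed_loop X sQ; have e2 := ric_closed_loop Q sQ.
  rewrite rX in e1; rewrite rQ subrr !mul0mx subr0 in e2.
  rewrite (mulmxBr (closed_loop_mx Q) Q X) (mulmxBl Q X).
  apply/matrixP => i j; move/matrixP/(_ i j): e1; move/matrixP/(_ i j): e2.
  by rewrite !(addmx_entry, oppmx_entry) mxE; lra.
- by apply: psd_conj => //; exact: sym_mxB.
Qed.

(** The lower bound [Zm] may be indefinite, so positivity comes from the equation itself, read as a
    Lyapunov equation for [Q]. *)
Lemma riccati_psd Q : 0 <= eps -> between Q -> ric Q = 0 -> psd Q.
Proof.
move=> e0 bQ rQ; have [sQ _ _] := bQ.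
apply: (lyap_psd sV V1 c0 (cert bQ) (W := Q *m M *m Q + eps%:M)) => //.
- have e2 := ric_closed_loop Q sQ; rewrite rQ subrr !mul0mx subr0 in e2.
  apply/matrixP => i j; move/matrixP/(_ i j): e2.
  by rewrite !(addmx_entry, oppmx_entry) mxE; lra.
- apply: psdD; first exact: psd_conj.
  by move=> x; rewrite mul_mx_scalar rowdotZl mulr_ge0// rowdot_ge0.
Qed.

End Riccati.

(** * Orthonormal families in a Hilbert space *)

Lemma cvg_dominated (R : realType) (V : normedModType R) (T : Type)
    (F : set_system T) {FF : Filter F} (f : T -> V) (g : T -> R) (l : V) :
  (forall t, `|f t - l| <= g t) -> g @ F --> (0 : R) -> f @ F --> l.
Proof.
move=> h hg; apply/subr_cvg0/norm_cvg0P.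
apply: (squeeze_cvgr _ (cvg_cst 0) hg).
by apply: nearW => t; rewrite normr_ge0 h.
Qed.

Lemma cvg_lipschitz (R : realType) (V W : normedModType R) (T : Type)
    (F : set_system T) {FF : Filter F} (f : T -> V) (g : T -> W) (x : V) (l : W) (C : R) :
  (forall t, `|g t - l| <= C * `|f t - x|) -> f @ F --> x -> g @ F --> l.
Proof.
move=> h hf; apply: (cvg_dominated h).
have : (fun t => C * `|f t - x|) @ F --> C * `|x - x|.
  by apply: cvgMl_tmp; apply: cvg_norm; apply: cvgB => //; exact: cvg_cst.
by rewrite subrr normr0 mulr0.
Qed.

Section InnerProduct.
Context (R : realType) (H : completeNormedModType R) (dot : {dot H for idfun}).
Hypothesis hH : hilbert_dot dot.
Implicit Types (x y z : H).

Lemma dotC x y : dot x y = dot y x.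
Proof. by rewrite hermC /= expr0 mul1r. Qed.

Lemma dotDl x y z : dot (x + y) z = dot x z + dot y z.
Proof. exact: linearDl. Qed.

Lemma dotDr x y z : dot z (x + y) = dot z x + dot z y.
Proof. exact: linearDr. Qed.

Lemma dotZl a x y : dot (a *: x) y = a * dot x y.
Proof. exact: linearZl_LR. Qed.

Lemma dotZr a x y : dot y (a *: x) = a * dot y x.
Proof. exact: linearZr_LR. Qed.

Lemma dotNl x y : dot (- x) y = - dot x y.
Proof. exact: linearNl. Qed.

Lemma dotNr x y : dot x (- y) = - dot x y.
Proof. exact: linearNr. Qed.

Lemma dotBl x y z : dot (x - y) z = dot x z - dot y z.
Proof. by rewrite dotDl dotNl. Qed.

Lemma dotBr x y z : dot z (x - y) = dot z x - dot z y.
Proof. by rewrite dotDr dotNr. Qed.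

Lemma dot0l x : dot 0 x = 0. Proof. exact: linear0l. Qed.

Lemma dot0r x : dot x 0 = 0. Proof. exact: linear0r. Qed.

Lemma dot_suml (I : Type) (r : seq I) (f : I -> H) y :
  dot (\sum_(i <- r) f i) y = \sum_(i <- r) dot (f i) y.
Proof. exact: linear_sumlz. Qed.

Lemma dot_sumr (I : Type) (r : seq I) (f : I -> H) y :
  dot y (\sum_(i <- r) f i) = \sum_(i <- r) dot y (f i).
Proof. exact: linear_sumr. Qed.

Lemma dot_normE x : dot x x = `|x| ^+ 2. Proof. by rewrite hH. Qed.

Lemma dot_ge0 x : 0 <= dot x x. Proof. by rewrite dot_normE sqr_ge0. Qed.

Lemma dot_eq0 x : dot x x = 0 -> x = 0.
Proof. by rewrite dot_normE => /eqP; rewrite sqrf_eq0 normr_eq0 => /eqP. Qed.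

Lemma dot_cauchy x y : `|dot x y| <= `|x| * `|y|.
Proof.
rewrite -(@ler_pXn2r _ 2)// ?nnegrE ?mulr_ge0// real_normK ?num_real//.
rewrite exprMn -!dot_normE; apply: quadratic_discriminant => t.
have := dot_ge0 (x + t *: y); rewrite !(dotDl, dotDr, dotZl, dotZr) (dotC y x).
by congr (_ <= _); ring.
Qed.

Lemma dot_le x y : dot x y <= `|x| * `|y|.
Proof. exact: le_trans (ler_norm _) (dot_cauchy x y). Qed.

Lemma cvg_dot (T : Type) (F : set_system T) {FF : Filter F} (f g : T -> H) x y :
  f @ F --> x -> g @ F --> y -> (fun t => dot (f t) (g t)) @ F --> dot x y.
Proof.
move=> hf hg.
apply: (cvg_dominated (g := fun t => `|f t| * `|g t - y| + `|f t - x| * `|y|)).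
  move=> t; have -> : dot (f t) (g t) - dot x y = dot (f t) (g t - y) + dot (f t - x) y.
    by rewrite dotBr dotBl; ring.
  by apply: (le_trans (ler_normD _ _)); rewrite lerD// dot_cauchy.
have -> : (0 : R) = `|x| * `|y - y| + `|x - x| * `|y|.
  by rewrite !subrr normr0 mulr0 mul0r addr0.
apply: cvgD; apply: cvgM.
- exact: cvg_norm.
- by apply: cvg_norm; apply: cvgB => //; exact: cvg_cst.
- by apply: cvg_norm; apply: cvgB => //; exact: cvg_cst.
- exact: cvg_cst.
Qed.

Section Families.
Variable d : nat.
Implicit Types (phi psi u : 'I_d -> H) (a b : 'rV[R]_d).

Definition lincomb phi a : H := \sum_i a 0 i *: phi i.
(** Pairings with [phi]; they are coordinates only when [phi] is orthonormal. *)
Definition coords phi x : 'rV[R]_d := \row_i dot x (phi i).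
Definition onb u := forall i j, dot (u i) (u j) = (i == j)%:R.

Lemma lincombD phi a b : lincomb phi (a + b) = lincomb phi a + lincomb phi b.
Proof. by rewrite -big_split; apply: eq_bigr => i _; rewrite mxE scalerDl. Qed.

Lemma lincombZ phi c a : lincomb phi (c *: a) = c *: lincomb phi a.
Proof. by rewrite scaler_sumr; apply: eq_bigr => i _; rewrite mxE scalerA. Qed.

Lemma coordsD phi x y : coords phi (x + y) = coords phi x + coords phi y.
Proof. by apply/rowP => i; rewrite !mxE dotDl. Qed.

Lemma coordsZ phi c x : coords phi (c *: x) = c *: coords phi x.
Proof. by apply/rowP => i; rewrite !mxE dotZl. Qed.

Lemma lincombB phi a b : lincomb phi (a - b) = lincomb phi a - lincomb phi b.
Proof. by rewrite lincombD -(scaleN1r b) lincombZ scaleN1r. Qed.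

Lemma coordsB phi x y : coords phi (x - y) = coords phi x - coords phi y.
Proof. by rewrite coordsD -(scaleN1r y) coordsZ scaleN1r. Qed.

Lemma lincomb0 phi : lincomb phi 0 = 0.
Proof. by rewrite -(subrr (0 : 'rV_d)) lincombB subrr. Qed.

Lemma lincomb_delta phi i : lincomb phi (delta_mx 0 i) = phi i.
Proof.
rewrite /lincomb (bigD1 i)//= big1 ?addr0 => [|j ji]; first by rewrite mxE !eqxx scale1r.
by rewrite mxE eqxx (negPf ji) scale0r.
Qed.

Lemma dot_lincomb phi a x : dot (lincomb phi a) x = rowdot a (coords phi x).
Proof. by rewrite rowdotE dot_suml; apply: eq_bigr => i _; rewrite dotZl mxE dotC. Qed.

Lemma coords_lincomb phi psi a : coords psi (lincomb phi a) = a *m \matrix_(i, j) dot (phi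
  i) (psi j).
Proof.
apply/rowP => j; rewrite !mxE dot_suml; apply: eq_bigr => i _.
by rewrite dotZl !mxE.
Qed.

Lemma onb_mx u : onb u -> \matrix_(i, j) dot (u i) (u j) = 1%:M :> 'M[R]_d.
Proof. by move=> hu; apply/matrixP => i j; rewrite !mxE hu. Qed.

Lemma onb_coords u a : onb u -> coords u (lincomb u a) = a.
Proof. by move=> hu; rewrite coords_lincomb onb_mx// mulmx1. Qed.

Lemma onb_dot u a b : onb u -> dot (lincomb u a) (lincomb u b) = rowdot a b.
Proof. by move=> hu; rewrite dot_lincomb onb_coords. Qed.

Lemma spanP phi x : lin_span (range phi) x <-> exists a, x = lincomb phi a.
Proof.
split=> [[k [e [c [he ->]]]]|[a ->]]; last first.
  by exists d, phi, (fun i => a 0 i); split => // i; exists i.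
elim/big_ind: _ => [|y z [a ->] [b ->]|i _].
- by exists 0; rewrite /lincomb big1 // => i _; rewrite mxE scale0r.
- by exists (a + b); rewrite lincombD.
- by have [j _ <-] := he i; exists (c i *: delta_mx 0 j); rewrite lincombZ lincomb_delta.
Qed.

Lemma span_lincomb phi a : lin_span (range phi) (lincomb phi a).
Proof. by apply/spanP; exists a. Qed.

Lemma span_mem phi i : lin_span (range phi) (phi i).
Proof. by rewrite -(lincomb_delta phi i); exact: span_lincomb. Qed.

Lemma onb_coordsK u x : onb u -> lin_span (range u) x -> lincomb u (coords u x) = x.
Proof. by move=> hu /spanP[a ->]; rewrite onb_coords. Qed.

Lemma orth_projE u x : onb u -> orth_proj dot (lin_span (range u)) x = lincomb u (coords u x).
Proof.
move=> hu; rewrite /orth_proj; case: xgetP => [p -> [+ hp]|/(_ (lincomb u (coords u x)))[]].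
- move=> /spanP[a e]; rewrite e; congr lincomb; apply/rowP => i.
  have := hp _ (span_mem u i); rewrite dotBl => /eqP; rewrite subr_eq0 => /eqP.
  by rewrite e mxE => ->; rewrite -{1}(onb_coords a hu) mxE.
- split; first exact: span_lincomb.
  by move=> v /spanP[a ->]; rewrite dotC dot_lincomb coordsD -scaleN1r coordsZ onb_coords//
    scaleN1r subrr rowdotC rowdot0l.
Qed.

Lemma onb_ind u : onb u -> lin_indep u.
Proof.
move=> hu c hc i; pose a : 'rV[R]_d := \row_i c i.
have h : lincomb u a = 0 by rewrite -[RHS]hc; apply: eq_bigr => j _; rewrite mxE.
by have := onb_coords a hu; rewrite h => /rowP/(_ i); rewrite !mxE dot0l.
Qed.

Lemma bessel u x : onb u -> rowdot (coords u x) (coords u x) <= `|x| ^+ 2.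
Proof.
move=> hu; have := dot_ge0 (x - lincomb u (coords u x)).
rewrite dotBl !dotBr onb_dot// (dotC x) dot_lincomb dot_normE; lra.
Qed.

Lemma span_subspace phi : vsubspace (lin_span (range phi)).
Proof.
split=> [|c x y]; rewrite !inE; first by apply/spanP; exists 0;
  rewrite /lincomb big1 // => i _; rewrite mxE scale0r.
move=> /spanP[a ->] /spanP[b ->]; apply/spanP; exists (c *: a + b).
by rewrite lincombD lincombZ.
Qed.

End Families.

Section Subspace.
Variable V : set H.
Hypothesis sV : vsubspace V.

Lemma vs0 : V 0.
Proof. by have [h _] := sV; rewrite inE in h. Qed.

Lemma vsP a x y : V x -> V y -> V (a *: x + y).
Proof.
move=> hx hy; have [_ h] := sV; have := h a x y; rewrite !inE; exact.
Qed.

Lemma vsZ a x : V x -> V (a *: x).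
Proof. by move=> hx; have := vsP a hx vs0; rewrite addr0. Qed.

Lemma vsD x y : V x -> V y -> V (x + y).
Proof. by move=> hx hy; have := vsP 1 hx hy; rewrite scale1r. Qed.

Lemma vsN x : V x -> V (- x).
Proof. by move=> hx; rewrite -scaleN1r; exact: vsZ. Qed.

Lemma vsB x y : V x -> V y -> V (x - y).
Proof. by move=> hx hy; apply: vsD => //; exact: vsN. Qed.

Lemma vs_sum (I : Type) (r : seq I) (f : I -> H) :
  (forall i, V (f i)) -> V (\sum_(i <- r) f i).
Proof. by move=> h; elim/big_ind: _ => //; [exact: vs0|exact: vsD]. Qed.

Lemma vs_lincomb d (phi : 'I_d -> H) a : (forall i, V (phi i)) -> V (lincomb phi a).
Proof. by move=> h; apply: vs_sum => i; exact: vsZ. Qed.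

Lemma vs_span X : X `<=` V -> lin_span X `<=` V.
Proof.
move=> h x [k [e [c [he ->]]]]; apply: vs_sum => i; apply: vsZ; exact: h.
Qed.

End Subspace.

Definition fcons (T : Type) d (w : T) (u : 'I_d -> T) (i : 'I_d.+1) : T :=
  oapp u w (unlift ord0 i).

Lemma fcons0 (T : Type) d (w : T) (u : 'I_d -> T) : fcons w u ord0 = w.
Proof. by rewrite /fcons unlift_none. Qed.

Lemma fconsS (T : Type) d (w : T) (u : 'I_d -> T) i : fcons w u (lift ord0 i) = u i.
Proof. by rewrite /fcons liftK. Qed.

Lemma span_fcons d w (u : 'I_d -> H) x : lin_span (range (fcons w u)) x <->
  exists a b, x = a *: w + lincomb u b.
Proof.
rewrite spanP; split=> [[a ->]|[a [b ->]]].
  exists (a 0 ord0), (\row_i a 0 (lift ord0 i)).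
  rewrite /lincomb big_ord_recl fcons0; congr (_ + _); apply: eq_bigr => i _.
  by rewrite fconsS mxE.
exists (\row_i fcons a (fun i => b 0 i) i).
rewrite /lincomb big_ord_recl mxE !fcons0; congr (_ + _); apply: eq_bigr => i _.
by rewrite mxE !fconsS.
Qed.

Lemma onb_fcons d w (u : 'I_d -> H) : onb u -> dot w w = 1 ->
  (forall i, dot w (u i) = 0) -> onb (fcons w u).
Proof.
move=> hu w1 wu i j.
case: (unliftP ord0 i) => [i'|] ->; case: (unliftP ord0 j) => [j'|] ->;
  rewrite ?fcons0 ?fconsS ?fconsS ?eqxx//.
by rewrite dotC wu.
Qed.

Lemma gram_schmidt d (e : 'I_d -> H) : lin_indep e ->
  exists2 u : 'I_d -> H, onb u & lin_span (range u) = lin_span (range e).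
Proof.
elim: d e => [e _|d IH e he].
  by exists e => // -[].
have [|u hu su] := IH (fun i => e (lift ord0 i)).
  move=> c hc i.
  have := he (fcons 0 c) _ (lift ord0 i); rewrite fconsS; apply.
  rewrite big_ord_recl fcons0 scale0r add0r -[RHS]hc.
  by apply: eq_bigr => j _; rewrite fconsS.
pose w := e ord0 - lincomb u (coords u (e ord0)).
have ue b : exists b', lincomb u b = lincomb (fun i => e (lift ord0 i)) b'.
  have : lin_span (range u) (lincomb u b) by exact: span_lincomb.
  by rewrite su => /spanP.
have eu b : exists b', lincomb (fun i => e (lift ord0 i)) b = lincomb u b'.
  have : lin_span (range (fun i => e (lift ord0 i))) (lincomb (fun i => e (lift ord0 i)) b).
    exact: span_lincomb.
  by rewrite -su => /spanP.
have w0 : `|w| != 0.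
  rewrite normr_eq0; apply/eqP => /eqP; rewrite subr_eq0 => /eqP h.
  have [b hb] := ue (coords u (e ord0)); rewrite hb in h.
  have := he (fcons 1 (fun i => - b 0 i)) _ ord0; rewrite fcons0 => H1.
  suff : (1 : R) = 0 by move/eqP; rewrite oner_eq0.
  apply: H1; rewrite big_ord_recl fcons0 scale1r h -big_split big1//= => i _.
  by rewrite fconsS scaleNr subrr.
have wu i : dot w (u i) = 0.
  rewrite /w dotBl dot_lincomb rowdotE (bigD1 i)//= big1 ?addr0 => [|j ji].
    by rewrite !mxE hu eqxx mulr1 subrr.
  by rewrite !mxE hu eq_sym (negPf ji) mulr0.
exists (fcons (`|w|^-1 *: w) u).
  apply: onb_fcons => //.
    by rewrite dotZl dotZr dot_normE; field.
  by move=> i; rewrite dotZl wu mulr0.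
have e_fcons : e = fcons (e ord0) (fun i => e (lift ord0 i)).
  apply/funext => i; case: (unliftP ord0 i) => [j|] ->; by rewrite ?fconsS ?fcons0.
rewrite e_fcons; apply/seteqP; split=> x /span_fcons[a [b ->]]; apply/span_fcons.
  exists (a * `|w|^-1).
  have [b1 h1] := ue (- (a * `|w|^-1) *: coords u (e ord0) + b); exists b1.
  by rewrite -h1 lincombD lincombZ scalerA scalerBr addrA scaleNr.
have [b1 ->] := eu b.
exists (a * `|w|), (a *: coords u (e ord0) + b1).
by rewrite scalerA mulfK// lincombD lincombZ addrA -scalerDr subrK.
Qed.

Lemma has_dim_onb (V : set H) d : has_dim V d ->
  exists2 u : 'I_d -> H, onb u & V = lin_span (range u).
Proof.
by move=> [e [he ->]]; have [u hu su] := gram_schmidt he; exists u.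
Qed.

(** The coordinates of one orthonormal basis in the other form a square matrix with [N *m N^T = 1],
    which is then invertible on both sides. *)
Lemma has_dim_subset (V W : set H) d : has_dim V d -> has_dim W d -> V `<=` W -> V = W.
Proof.
move=> /has_dim_onb[u hu ->] /has_dim_onb[w hw ->] h.
apply/seteqP; split=> // x /spanP[a ->].
pose N : 'M[R]_d := \matrix_(i, j) dot (u i) (w j).
have uN i : u i = lincomb w (row i N).
  rewrite -[LHS](onb_coordsK hw); last by apply: h; exact: span_mem.
  by congr lincomb; apply/rowP => j; rewrite !mxE.
have NN : N *m N^T = 1%:M.
  apply/matrixP => i j; have := hu i j; rewrite {1}uN {1}uN onb_dot// rowdotE => hij.
  by rewrite mxE [RHS]mxE -hij; apply: eq_bigr => k _; rewrite !mxE.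
have NT : N^T *m N = 1%:M by exact: mulmx1C.
apply/spanP; exists (a *m N^T).
rewrite -[lincomb u _](onb_coordsK hw); last by apply: h; exact: span_lincomb.
by rewrite coords_lincomb -/N -mulmxA NT mulmx1.
Qed.

End InnerProduct.

(** * Riesz representation and the spectral theorem *)

Section Riesz.
Context (R : realType) (U : completeNormedModType R) (dot : {dot U for idfun}).
Hypothesis hU : hilbert_dot dot.

(* Representer of [f]: the minimizer of [|x|^2 - 2 f x]. *)
Lemma riesz (f : U -> R) (C : R) : (forall a x y, f (a *: x + y) = a * f x + f y) ->
  (forall x, `|f x| <= C * `|x|) -> exists z, forall x, f x = dot x z.
Proof.
move=> lf bf.
have f0 : f 0 = 0 by have := lf 1 0 0; rewrite scale1r addr0 mul1r; lra.
have fZ a x : f (a *: x) = a * f x by have := lf a x 0; rewrite f0 !addr0.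
have fD x y : f (x + y) = f x + f y by have := lf 1 x y; rewrite scale1r mul1r.
pose J x := dot x x - 2 * f x.
have Jlb x : - C ^+ 2 <= J x.
  rewrite /J dot_normE//; have := bf x; rewrite ler_norml => /andP[_ h].
  have := sqr_ge0 (`|x| - C); nra.
pose m := inf (range J).
have hlb : has_lbound (range J) by exists (- C ^+ 2) => _ [x _ <-].
have Jm x : m <= J x by apply: (ge_inf hlb); exists x.
have approx n : {x | J x < m + n.+1%:R^-1}.
  have hinf : has_inf (range J) by split=> //; exists (J 0), 0.
  have e0 : 0 < n.+1%:R^-1 :> R by rewrite invr_gt0.
  by apply/cid; have [_ [x _ <-] h] := inf_adherent e0 hinf; exists x.
pose u n := sval (approx n).
have hu n : J (u n) < m + n.+1%:R^-1 by exact: svalP (approx n).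
(* Parallelogram identity at the midpoint: two almost minimizers are close to each other, so a
   minimizing sequence is Cauchy. *)
have par x y : `|x - y| ^+ 2 <= 2 * (J x - m) + 2 * (J y - m).
  have := Jm (2^-1 *: (x + y)); rewrite /J fZ fD -!(dot_normE hU).
  rewrite !(dotDl, dotDr, dotZl, dotZr, dotNl, dotNr) (dotC dot y x); lra.
have cu : cvgn u.
  apply/cauchy_cvgP/cauchy_exP => e e0.
  have e20 : 0 < e ^+ 2 / 8 by rewrite divr_gt0 ?exprn_gt0.
  have [N _ hN] := near_infty_natSinv_lt (PosNum e20).
  exists (u N); exists N => // n /= Nn; rewrite -ball_normE /=.
  rewrite -(@ltr_pXn2r _ 2)// ?nnegrE ?(ltW e0)//.
  apply: (le_lt_trans (par _ _)).
  have := hu N; have := hu n; have := hN N (leqnn N); have := hN n Nn => /=.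
  have : 0 < e ^+ 2 by rewrite exprn_gt0.
  by move: (n.+1%:R^-1) (N.+1%:R^-1) => p q; lra.
pose z := limn u; exists z => x.
have Jz : J z <= m.
  have h1 : (fun n => J (u n)) @ \oo --> J z.
    apply: cvgB; first exact: (cvg_dot hU).
    apply: cvgMl_tmp; apply: (cvg_lipschitz _ cu) => n.
    by rewrite -mulN1r -fZ -fD scaleN1r.
  have h2 : (fun n : nat => m + n.+1%:R^-1) @ \oo --> m + 0.
    by apply: cvgD; [exact: cvg_cst | exact: cvg_harmonic].
  rewrite -[leRHS]addr0.
  by apply: (ler_cvg_to h1 h2); apply: nearW => n; apply/ltW/hu.
have := @quadratic_discriminant _ 0 (dot z x - f x) (dot x x).
rewrite mul0r => H0.
have {H0} := H0 _ => H0.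
have h0 : (dot z x - f x) ^+ 2 <= 0.
  apply: H0 => t; have := Jm (z + t *: x).
  rewrite /J fD fZ !(dotDl, dotDr, dotZl, dotZr) (dotC dot x z).
  by move: Jz; rewrite /J; nra.
have : dot z x - f x = 0.
  by apply/eqP; rewrite -sqrf_eq0 eq_le h0 sqr_ge0.
by rewrite dotC; lra.
Qed.

Lemma adjoint_exists (H : completeNormedModType R) (dotH : {dot H for idfun})
    (hH : hilbert_dot dotH) (f : U -> H) (C : R) :
  (forall a x y, f (a *: x + y) = a *: f x + f y) ->
  (forall x, `|f x| <= C * `|x|) ->
  exists g : H -> U, forall x y, dotH (f x) y = dot x (g y).
Proof.
move=> lf bf.
have h y : {z | forall x, dotH (f x) y = dot x z}.
  apply/cid; apply: (@riesz (fun x => dotH (f x) y) (C * `|y|)).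
    by move=> a x z; rewrite lf dotDl dotZl.
  move=> x; apply: (le_trans (dot_cauchy hH _ _)).
  by rewrite mulrAC ler_wpM2r.
by exists (fun y => sval (h y)) => x y; exact: svalP (h y) x.
Qed.

End Riesz.

Section SymmetricMatrix.
Variable R : realType.

(* Let [s] be the supremum of the Rayleigh quotient. If [s - N] were invertible, its
   quadratic form would be bounded below, and [s] would not be the supremum. *)
Lemma sym_eigenvector d (N : 'M[R]_d.+1) : N^T = N ->
  exists (s : R) x, rowdot x x = 1 /\ x *m N = s *: x.
Proof.
move=> sN; have [C C0 hC] := form_bound N.
pose S := [set q | exists2 x, rowdot x x = 1 & q = rowdot (x *m N) x].
have hS : has_sup S.
  split.
    pose e : 'rV[R]_d.+1 := delta_mx 0 ord0.
    exists (rowdot (e *m N) e); exists e => //.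
    by have := rowdot_delta (1%:M : 'M[R]_d.+1) ord0 ord0; rewrite mulmx1 mxE eqxx.
  exists C => _ [x x1 ->]; have := hC x; rewrite x1 mulr1 ler_norml.
  by case/andP.
pose s := sup S.
have scale (x : 'rV[R]_d.+1) : x != 0 -> exists2 y, rowdot y y = 1 & x = Num.sqrt (rowdot x
  x) *: y.
  move=> x0; have xx := rowdot_gt0 x0.
  have s0 : Num.sqrt (rowdot x x) != 0 by rewrite gt_eqF// sqrtr_gt0.
  exists ((Num.sqrt (rowdot x x))^-1 *: x); last by rewrite scalerA divff ?scale1r.
  rewrite rowdotZl rowdotZr mulrA -invfM -expr2 sqr_sqrtr ?ltW// mulVf// gt_eqF//.
have ubs x : rowdot (x *m N) x <= s * rowdot x x.
  have [->|x0] := eqVneq x 0; first by rewrite mul0mx !rowdot0l mulr0.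
  have [y y1 e] := scale x x0; rewrite e -scalemxAl !rowdotZl !rowdotZr y1 mulr1.
  have h : rowdot (y *m N) y <= s by apply: (ub_le_sup hS.2); exists y.
  by have := sqr_ge0 (Num.sqrt (rowdot x x)); nra.
pose T : 'M[R]_d.+1 := s%:M - N.
have TE x : rowdot (x *m T) x = s * rowdot x x - rowdot (x *m N) x.
  by rewrite mulmxBr mul_mx_scalar rowdotBl rowdotZl.
have pT x : 0 <= rowdot (x *m T) x by rewrite TE subr_ge0.
have sT : T^T = T by rewrite linearB /= sN tr_scalar_mx.
apply: contrapT => hno.
have uT : T \in unitmx.
  apply: unitmx_ker0 => x xT; apply: contrapT => /eqP x0; apply: hno.
  have [y y1 e] := scale x x0; exists s, y; split => //.
  have s0 : Num.sqrt (rowdot x x) != 0 by rewrite gt_eqF// sqrtr_gt0 rowdot_gt0.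
  move/eqP: xT; rewrite e -scalemxAl scaler_eq0 (negPf s0) /=.
  by rewrite mulmxBr mul_mx_scalar subr_eq0 => /eqP ->.
have [C1 C10 h1] := mx_bound (invmx T).
have [C2 C20 h2] := form_bound T.
(* Cauchy-Schwarz for the semidefinite form of [T]: a small value of the form makes [x *m T] small,
   and then [x] by invertibility. *)
have TT x : rowdot (x *m T) (x *m T) <= C2 * rowdot (x *m T) x.
  have := psd_cauchy x (x *m T) sT pT => h.
  have hb := h2 (x *m T); rewrite ler_norml in hb; move/andP: hb => [_ hb].
  have px := pT x; have pq := rowdot_ge0 (x *m T).
  have [e|ne] := eqVneq (rowdot (x *m T) (x *m T)) 0; first by rewrite e mulr_ge0.
  have {}ne : 0 < rowdot (x *m T) (x *m T) by rewrite lt_neqAle eq_sym ne.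
  rewrite -(ler_pM2r ne) -expr2; apply: (le_trans h).
  by apply: (le_trans (ler_wpM2l px hb)); rewrite [leRHS]mulrAC [leRHS]mulrC.
pose K := C1 * C2 + 1.
have K0 : 0 < K by rewrite ltr_wpDl// mulr_ge0.
have hK x : rowdot x x <= K * rowdot (x *m T) x.
  have := h1 (x *m T); rewrite mulmxK// => h; apply: (le_trans h).
  have := ler_wpM2l C10 (TT x); have := pT x; rewrite /K; nra.
have [_ [x x1 ->] hx] := sup_adherent (divr_gt0 ltr01 K0) hS.
have := hK x; rewrite TE x1 mulr1 -ler_pdivrMl// mulr1 -/s.
by move: hx; rewrite -/s div1r; lra.
Qed.

End SymmetricMatrix.

Section Spectral.
Context (R : realType) (H : completeNormedModType R) (dot : {dot H for idfun}).
Hypothesis hH : hilbert_dot dot.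
Variable A : H -> H.

(** Deflation by induction on [d]. The orthogonal complement of an eigenvector is invariant by
    symmetry, but the induction needs an orthonormal basis of it; a reflection carrying the first
    basis vector to the eigenvector carries the others to such a basis. *)
Lemma spectral_onb d (u : 'I_d -> H) : onb dot u ->
  (forall a x y, lin_span (range u) x -> lin_span (range u) y ->
     A (a *: x + y) = a *: A x + A y) ->
  (forall x, lin_span (range u) x -> lin_span (range u) (A x)) ->
  (forall x y, lin_span (range u) x -> lin_span (range u) y ->
     dot (A x) y = dot x (A y)) ->
  exists (v : 'I_d -> H) (lam : 'I_d -> R), [/\ onb dot v,
    lin_span (range v) = lin_span (range u) & forall i, A (v i) = lam i *: v i].
Proof.
elim: d u => [|d IH] u hu lA AE sA.
  by exists u, (fun=> 0); split => // -[].
set E := lin_span (range u) in lA AE sA *.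
have sE : vsubspace E by exact: span_subspace.
have uE i : E (u i) by exact: span_mem.
pose N : 'M[R]_d.+1 := \matrix_(i, j) dot (A (u i)) (u j).
have A0 : A 0 = 0.
  have := lA 1 0 0 (vs0 sE) (vs0 sE); rewrite !scale1r addr0 => /eqP.
  by rewrite -subr_eq subrr eq_sym => /eqP.
have Aev a : A (lincomb u a) = lincomb (fun i => A (u i)) a.
  rewrite /lincomb.
  suff [_] : E (\sum_i a 0 i *: u i) /\
     A (\sum_i a 0 i *: u i) = \sum_i a 0 i *: A (u i) by [].
  apply: (big_ind2 (fun x y => E x /\ A x = y)) => [|x x' y y' [h1 <-] [h2 <-]|i _].
  - by split => //; exact: vs0.
  - split; first exact: vsD.
    by have := lA 1 x y h1 h2; rewrite !scale1r.
  - split; first exact: vsZ.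
    by have := lA (a 0 i) (u i) 0 (uE i) (vs0 sE); rewrite A0 !addr0.
have sN : N^T = N.
  by apply/matrixP => i j; rewrite !mxE sA// (dotC dot).
have [s [x [x1 xN]]] := sym_eigenvector sN.
pose v0 := lincomb u x.
have v0E : E v0 by exact: span_lincomb.
have v01 : dot v0 v0 = 1 by rewrite onb_dot.
have Av0 : A v0 = s *: v0.
  rewrite -[LHS](onb_coordsK hu); last exact: AE.
  rewrite /v0 -lincombZ; congr lincomb; rewrite -xN Aev coords_lincomb.
  by congr (_ *m _); apply/matrixP => i j; rewrite !mxE.
have [n hn] : {n | n = v0 - u ord0} by exists (v0 - u ord0).
have nn : dot n n = 2 - 2 * dot v0 (u ord0).
  rewrite hn !(dotBl, dotBr) v01 (dotC dot (u ord0) v0) hu eqxx /=; ring.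
(* [r] is the Householder reflection exchanging [u ord0] and [v0]; when they coincide
   [n = 0] and [k = 0^-1 = 0], so that [r] is the identity. *)
pose k := (dot n n)^-1.
have kk : k * k * dot n n = k.
  rewrite /k; have [->|n0] := eqVneq (dot n n) 0; first by rewrite invr0 !mul0r.
  by rewrite mulfVK.
pose r y := y - (2 * k * dot y n) *: n.
have refl_dot y z : dot (r y) (r z) = dot y z.
  rewrite /r !(dotBl, dotBr, dotZl, dotZr) (dotC dot n z).
  have -> : 2 * k * dot y n * (2 * k * dot z n * dot n n) =
    4 * (k * k * dot n n) * dot y n * dot z n by ring.
  by rewrite kk; ring.
have r0 : r (u ord0) = v0.
  have un : 2 * dot (u ord0) n = - dot n n.
    by rewrite nn hn dotBr (dotC dot (u ord0) v0) hu eqxx /=; ring.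
  rewrite /r mulrAC un mulNr scaleNr opprK.
  have [n0|n0] := eqVneq (dot n n) 0.
    rewrite n0 mul0r scale0r addr0; move/(dot_eq0 hH)/eqP: n0.
    by rewrite hn subr_eq0 => /eqP.
  by rewrite /k divff// scale1r hn addrC subrK.
have rE y : E y -> E (r y).
  by move=> hy; apply: vsB => //; apply: vsZ => //; rewrite hn; exact: vsB.
pose w i := r (u (lift ord0 i)).
have hw : onb dot w by move=> i j; rewrite /w refl_dot hu (inj_eq lift_inj).
have v0w i : dot v0 (w i) = 0 by rewrite /w -r0 refl_dot hu.
have hvw : onb dot (fcons v0 w) by exact: onb_fcons.
have spanE : lin_span (range (fcons v0 w)) = E.
  apply: (has_dim_subset hH (d := d.+1)).
  - by exists (fcons v0 w); split => //; exact: onb_ind hvw.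
  - by exists u; split => //; exact: onb_ind hu.
  - apply: vs_span => // _ [i _ <-]; case: (unliftP ord0 i) => [j|] ->.
      by rewrite fconsS; exact: rE.
    by rewrite fcons0.
have wE y : lin_span (range w) y -> E y.
  by apply: vs_span => // _ [i _ <-]; exact: rE.
have Wort y : lin_span (range w) y <-> E y /\ dot y v0 = 0.
  split=> [hy|[]].
    split; first exact: wE.
    move: hy => /spanP[a ->]; rewrite dot_lincomb rowdotE big1 // => i _.
    by rewrite mxE v0w mulr0.
  rewrite -spanE => /span_fcons[a [b ->]].
  rewrite dotDl dotZl v01 dot_lincomb rowdotE big1 => [|i _]; last by rewrite mxE v0w mulr0.
  by rewrite mulr1 addr0 => ->; rewrite scale0r add0r; exact: span_lincomb.
have [|||v [lam [hv sv Av]]] := IH w hw.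
- by move=> a y z /wE hy /wE hz; exact: lA.
- move=> y /Wort[yE yv]; apply/Wort; split; first exact: AE.
  by rewrite sA// Av0 dotZr yv mulr0.
- by move=> y z /wE hy /wE hz; exact: sA.
have vv0 i : dot v0 (v i) = 0.
  have : lin_span (range w) (v i) by rewrite -sv; exact: span_mem.
  by move=> /Wort[_]; rewrite (dotC dot).
exists (fcons v0 v), (fcons s lam); split.
- exact: onb_fcons.
- rewrite -spanE; apply/seteqP; split=> y /span_fcons[a [b ->]]; apply/span_fcons.
    have : lin_span (range w) (lincomb v b) by rewrite -sv; exact: span_lincomb.
    by move=> /spanP[b' ->]; exists a, b'.
  have : lin_span (range v) (lincomb w b) by rewrite sv; exact: span_lincomb.
  by move=> /spanP[b' ->]; exists a, b'.
- move=> i; case: (unliftP ord0 i) => [j|] ->; rewrite ?fconsS ?fcons0//.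
Qed.

End Spectral.

(** * Selfadjoint generators with finitely many unstable modes *)

(** [ln (m t) / t] is unchanged when [t] is divided by an integer, and [1 - 1/x <= ln x <= x - 1]
    squeezes it between two quotients that tend to [lam]. Only the right derivative at 0 enters. *)
Lemma multiplicative_expR (R : realType) (m : R -> R) (lam : R) :
  (forall s t, 0 <= s -> 0 <= t -> m (s + t) = m s * m t) -> m 0 = 1 ->
  (fun h => h^-1 * (m h - 1)) @ 0^'+ --> lam ->
  forall t, 0 <= t -> m t = expR (lam * t).
Proof.
move=> mD m0 hm t; rewrite le_eqVlt => /predU1P[<-|t0].
  by rewrite mulr0 expR0.
have mX s n : 0 <= s -> m (s *+ n) = m s ^+ n.
  move=> s0; elim: n => [|n IH]; first by rewrite mulr0n m0 expr0.
  by rewrite mulrS mD// ?mulrn_wge0// IH exprS.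
pose h n : R := t / n.+1%:R.
have h0 n : 0 < h n by rewrite divr_gt0.
have hN n : h n *+ n.+1 = t by rewrite -mulr_natr divfK.
have hcv : h @ \oo --> (0 : R).
  rewrite -(mulr0 t); apply: cvgMl_tmp; exact: cvg_harmonic.
have c1 : (fun n => (h n)^-1 * (m (h n) - 1)) @ \oo --> lam.
  by apply: (cvg_at_rightP _ _ _).1 hm _ _; split.
have c2 : (fun n => m (h n)) @ \oo --> 0 * lam + 1.
  have -> : (fun n => m (h n)) = (fun n => h n * ((h n)^-1 * (m (h n) - 1)) + 1).
    by apply/funext => n; rewrite mulVKf ?gt_eqF// subrK.
  by apply: cvgD; [exact: cvgM | exact: cvg_cst].
rewrite mul0r add0r in c2.
have mpos : \forall n \near \oo, 0 < m (h n) by apply: (cvgr_gt _ c2); exact: ltr01.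
have mt : 0 < m t.
  near \oo => n; rewrite -(hN n) mX ?(ltW (h0 n))// exprn_gt0//.
  by near: n.
suff -> : lam * t = ln (m t) by rewrite lnK.
have tn0 : t != 0 by rewrite gt_eqF.
apply/(mulIf (invr_neq0 tn0)); rewrite mulfK//.
have lnh n : 0 < m (h n) -> ln (m t) / t = ln (m (h n)) / h n.
  move=> mh; rewrite -(hN n) mX ?(ltW (h0 n))// lnXn// -mulr_natr -[h n *+ _]mulr_natr.
  by field; rewrite gt_eqF//= addrC natr1.
have lnb (x : R) : 0 < x -> ln x <= x - 1.
  move=> x0; have {1}-> : x = 1 + (x - 1) by rewrite addrC subrK.
  by apply: le_ln1Dx; lra.
have hlim : (fun=> ln (m t) / t) @ \oo --> lam.
  have c3 : (fun n => (h n)^-1 * (m (h n) - 1) / m (h n)) @ \oo --> lam * 1^-1.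
    by apply: cvgM => //; apply: cvgV => //; exact: oner_neq0.
  rewrite invr1 mulr1 in c3.
  apply: (squeeze_cvgr _ c3 c1); near=> n.
  have mh : 0 < m (h n) by near: n.
  have hi : 0 < (h n)^-1 by rewrite invr_gt0.
  have mi : 0 < (m (h n))^-1 by rewrite invr_gt0.
  rewrite (lnh n mh) [ln _ / _]mulrC -[X in X <= _]mulrA !(ler_pM2l hi).
  apply/andP; split; last first.
    exact: lnb.
  have := lnb _ mi; rewrite lnV ?posrE// mulrBl divff ?gt_eqF// mul1r; lra.
exact: (cvg_unique _ hlim (cvg_cst _)).
Unshelve. all: by end_near. Qed.

Section UnboundedOperator.
Context (R : realType) (H : completeNormedModType R) (dot : {dot H for idfun}).
Hypothesis hH : hilbert_dot dot.
Variables (DA : set H) (A : H -> H).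
Hypothesis lA : linear_on DA A.

Lemma DA_subspace : vsubspace DA. Proof. by case: lA. Qed.

Lemma A_lin a x y : DA x -> DA y -> A (a *: x + y) = a *: A x + A y.
Proof. by case: lA => _ h; exact: h. Qed.

Lemma A_0 : A 0 = 0.
Proof.
have h0 := vs0 DA_subspace; have := A_lin 1 h0 h0.
by rewrite !scale1r addr0 => /eqP; rewrite -subr_eq subrr eq_sym => /eqP.
Qed.

Lemma A_D x y : DA x -> DA y -> A (x + y) = A x + A y.
Proof. by move=> hx hy; have := A_lin 1 hx hy; rewrite !scale1r. Qed.

Lemma A_Z a x : DA x -> A (a *: x) = a *: A x.
Proof. by move=> hx; have := A_lin a hx (vs0 DA_subspace); rewrite A_0 !addr0. Qed.

Lemma A_B x y : DA x -> DA y -> A (x - y) = A x - A y.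
Proof.
move=> hx hy; have := A_lin (-1) hy hx.
by rewrite !scaleN1r addrC => ->; rewrite addrC.
Qed.

Lemma A_sum (I : Type) (r : seq I) (f : I -> H) : (forall i, DA (f i)) ->
  A (\sum_(i <- r) f i) = \sum_(i <- r) A (f i).
Proof.
move=> h; suff [] : DA (\sum_(i <- r) f i) /\
  A (\sum_(i <- r) f i) = \sum_(i <- r) A (f i) by [].
apply: (big_ind2 (fun x y => DA x /\ A x = y)) => //.
- by split; [exact: vs0 DA_subspace | exact: A_0].
- move=> x x' y y' [h1 <-] [h2 <-]; split; [exact: vsD DA_subspace _ _ h1 h2|exact: A_D].
Qed.

Lemma A_lincomb d (phi : 'I_d -> H) a : (forall i, DA (phi i)) ->
  A (lincomb phi a) = lincomb (fun i => A (phi i)) a.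
Proof.
move=> h; rewrite /lincomb A_sum => [|i]; last exact: vsZ DA_subspace _ _ (h i).
by apply: eq_bigr => i _; rewrite A_Z.
Qed.

Hypothesis sA : selfadjoint_op dot DA A.

Lemma A_sym x y : DA x -> DA y -> dot (A x) y = dot x (A y).
Proof. by move=> hx hy; have [h _] := sA y (A y); apply: h. Qed.

Variable S : R -> H -> H.
Hypotheses (hS : c0_semigroup S) (gS : generated_by S DA A).

Lemma S_lin t : 0 <= t -> forall a x y, S t (a *: x + y) = a *: S t x + S t y.
Proof. by case: hS => h _ _ _ /h[hl _] a x y; exact: hl. Qed.

Lemma S_0 t : 0 <= t -> S t 0 = 0.
Proof.
move=> t0; have := S_lin t0 1 0 0.
by rewrite !scale1r addr0 => /eqP; rewrite -subr_eq subrr eq_sym => /eqP.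
Qed.

Lemma S_Z t a x : 0 <= t -> S t (a *: x) = a *: S t x.
Proof. by move=> t0; have := S_lin t0 a x 0; rewrite S_0// !addr0. Qed.

Lemma S_B t x y : 0 <= t -> S t (x - y) = S t x - S t y.
Proof.
by move=> t0; have := S_lin t0 (-1) y x; rewrite !scaleN1r addrC => ->; rewrite addrC.
Qed.

Lemma S_bounded t : 0 <= t -> exists C, forall x, `|S t x| <= C * `|x|.
Proof.
move=> t0; have [h _ _ _] := hS; have [hl hc] := h t t0.
pose f := GRing.isLinear.Build R H H _ (S t) hl.
pose F : {linear H -> H} := HB.pack (S t) f.
have : bounded_near F (nbhs 0) by apply: continuous_linear_bounded; exact: hc.
move=> /linear_boundedP [C [_ hC]].
by exists (C + 1); apply: hC; rewrite ltrDl.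
Qed.

Lemma S_DA t x : 0 <= t -> DA x -> DA (S t x) /\ A (S t x) = S t (A x).
Proof.
move=> t0 hx; apply/gS.
have [h _ hD _] := hS; have [_ hc] := h t t0.
have hx' : (fun h => h^-1 *: (S h x - x)) @ 0^'+ --> A x by apply/gS.
have : (fun h => S t (h^-1 *: (S h x - x))) @ 0^'+ --> S t (A x).
  by apply: continuous_cvg => //; exact: hc.
apply: cvg_trans; apply: near_eq_cvg.
apply: filterS (nbhs_right_gt (0 : R)) => s /ltW s0.
by rewrite S_Z// S_B// -!hD// (addrC t).
Qed.

Variables (l : nat) (v : 'I_l -> H) (lam : 'I_l -> R) (gamma : R).
Hypotheses (hv : onb dot v) (vDA : forall i, DA (v i))
  (Av : forall i, A (v i) = lam i *: v i) (lam0 : forall i, 0 < lam i)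
  (lam_inj : injective lam) (gamma0 : 0 < gamma).

Definition low_proj x : H := lincomb v (coords dot v x).

Hypothesis decay : forall t z, 0 <= t ->
  let z' := z - low_proj z in
  `|S t z' - low_proj (S t z')| <= expR (- gamma * t) * `|z'|.

Lemma low_proj_orth x i : dot (x - low_proj x) (v i) = 0.
Proof.
rewrite dotBl dot_lincomb rowdotE (bigD1 i)//= big1 ?addr0 => [|j ji].
  by rewrite !mxE hv eqxx mulr1 subrr.
by rewrite !mxE hv eq_sym (negPf ji) mulr0.
Qed.

Lemma orth_lincomb x a : (forall i, dot x (v i) = 0) -> dot x (lincomb v a) = 0.
Proof.
move=> h; rewrite (dotC dot) dot_lincomb rowdotE big1 // => i _.
by rewrite mxE h mulr0.
Qed.

Lemma low_proj_DA x : DA (low_proj x).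
Proof. exact: vs_lincomb DA_subspace _ _ _ vDA. Qed.

Lemma A_low x : A (low_proj x) = lincomb v (coords dot v x *m diag_mx (\row_i lam i)).
Proof.
rewrite A_lincomb//; apply: eq_bigr => i _.
by rewrite Av scalerA mul_mx_diag !mxE.
Qed.

Lemma A_coord x i : DA x -> dot (A x) (v i) = lam i * dot x (v i).
Proof. by move=> hx; rewrite A_sym// Av dotZr. Qed.

(** Infinitesimal form of [decay]. The quotient is multiplied by [1 + gamma * h], which tends to 1
    and is at most [expR (gamma * h)]; this absorbs the exponential without differentiating it. *)
Lemma A_high x : DA x -> (forall i, dot x (v i) = 0) ->
  dot (A x) x <= - gamma * `|x| ^+ 2.
Proof.
move=> hx xv.
have px : low_proj x = 0.
  have c0 : coords dot v x = 0 by apply/rowP => i; rewrite !mxE xv.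
  by rewrite /low_proj c0 /lincomb big1 // => i _; rewrite mxE scale0r.
have hx' : (fun h => h^-1 *: (S h x - x)) @ 0^'+ --> A x by apply/gS.
have c1 : (fun h => dot (h^-1 *: (S h x - x)) x * (1 + gamma * h)) @ 0^'+
    --> dot (A x) x * (1 + gamma * 0).
  apply: cvgM; first by apply: (cvg_dot hH) => //; exact: cvg_cst.
  apply: cvgD; first exact: cvg_cst.
  by apply: cvgMl_tmp; apply: cvg_at_right_filter; exact: cvg_id.
rewrite mulr0 addr0 mulr1 in c1.
apply: (ler_cvg_to c1 (cvg_cst (- gamma * `|x| ^+ 2))); near=> h.
have h0 : 0 < h by near: h; exact: nbhs_right_gt.
have := decay x (ltW h0); rewrite /= px subr0 => hd.
have e1 : dot (S h x) x = dot (S h x - low_proj (S h x)) x.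
  by rewrite dotBl (dotC dot (low_proj _)) /low_proj orth_lincomb// subr0.
have e2 : dot (S h x) x <= expR (- gamma * h) * `|x| ^+ 2.
  rewrite e1; apply: (le_trans (dot_le hH _ _)).
  by rewrite expr2 mulrA ler_wpM2r.
have g0 : 0 < 1 + gamma * h by rewrite addr_gt0// mulr_gt0.
have e3 : expR (- gamma * h) * (1 + gamma * h) <= 1.
  have := @expR_ge1Dx _ (gamma * h) => e4.
  rewrite mulNr expRN mulrC ler_pdivrMr ?expR_gt0// mul1r//.
have x2 := sqr_ge0 `|x|.
rewrite dotZl dotBl (dot_normE hH) -mulrA mulrC ler_pdivrMr//.
have : (dot (S h x) x) * (1 + gamma * h) <= `|x| ^+ 2.
  apply: (@le_trans _ _ (expR (- gamma * h) * `|x| ^+ 2 * (1 + gamma * h))).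
    by rewrite ler_wpM2r// ltW.
  by rewrite mulrAC ler_piMl.
nra.
Unshelve. all: by end_near. Qed.

(** The stable part [f] of [w] would satisfy [s |f|^2 <= - gamma |f|^2]. This locates the images of
    the [v i] under the semigroup and under its adjoints. *)
Lemma eigenvector_low w s : DA w -> A w = s *: w -> 0 < s -> w = low_proj w.
Proof.
move=> hw Aw s0; pose f := w - low_proj w.
have fD : DA f by apply: vsB DA_subspace _ _ hw (low_proj_DA w).
have fv : forall i, dot f (v i) = 0 by exact: low_proj_orth.
have := A_high fD fv.
rewrite {1}/f A_B//; last exact: low_proj_DA.
rewrite Aw dotBl dotZl A_low (dotC dot (lincomb _ _)) orth_lincomb// subr0.
have -> : dot w f = `|f| ^+ 2.
  rewrite -(dot_normE hH) {2}/f dotBl (dotC dot (low_proj w)) /low_proj orth_lincomb// subr0//.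
move=> h; have : (s + gamma) * `|f| ^+ 2 <= 0 by rewrite mulrDl; lra.
rewrite pmulr_rle0 ?addr_gt0// => h2.
have : `|f| ^+ 2 == 0 by rewrite eq_le h2 sqr_ge0.
by rewrite sqrf_eq0 normr_eq0 subr_eq0 => /eqP.
Qed.

(* The adjoint of [S t] maps [v i] to a vector [w] with [<A x, w> = lam i <x, w>]; by
   selfadjointness [w] is an eigenvector of [A], hence a multiple of [v i], and the
   factor is multiplicative in [t] with derivative [lam i] at [0]. *)
Lemma S_coord t x i : 0 <= t -> dot (S t x) (v i) = expR (lam i * t) * dot x (v i).
Proof.
have mult s y : 0 <= s -> dot (S s y) (v i) = dot (S s (v i)) (v i) * dot y (v i).
  move=> s0; have [C hC] := S_bounded s0.
  have [g hg] := adjoint_exists hH hH (S_lin s0) hC.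
  have [wD Aw] : DA (g (v i)) /\ A (g (v i)) = lam i *: g (v i).
    apply/sA => z hz; have [h1 h2] := S_DA s0 hz.
    by rewrite dotZr -!hg -h2 A_coord.
  have e := eigenvector_low wD Aw (lam0 i).
  have e2 j : j != i -> dot (g (v i)) (v j) = 0.
    move=> ji; have := A_coord j wD; rewrite Aw dotZl => /eqP.
    rewrite -subr_eq0 -mulrBl mulf_eq0 subr_eq0 => /orP[|/eqP//].
    by move/eqP/lam_inj => ij; rewrite ij eqxx in ji.
  have -> : dot (S s y) (v i) = dot (g (v i)) (v i) * dot y (v i).
    rewrite hg e /low_proj (dotC dot y) dot_lincomb rowdotE (bigD1 i)//= big1 ?addr0 ?mxE.
      by rewrite -[lincomb _ _]/(low_proj _) -e.
    by move=> j ji; rewrite !mxE e2// mul0r.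
  by congr (_ * _); rewrite (dotC dot) hg.
move=> t0; rewrite mult//; congr (_ * _).
apply: (multiplicative_expR (m := fun t => dot (S t (v i)) (v i))) => //.
- by move=> s r s0 r0; have [_ _ hD _] := hS; rewrite hD// mult.
- by have [_ h0 _ _] := hS; rewrite h0 hv eqxx.
- have hx' : (fun h => h^-1 *: (S h (v i) - v i)) @ 0^'+ --> lam i *: v i.
    by apply/gS; split.
  have : (fun h => dot (h^-1 *: (S h (v i) - v i)) (v i)) @ 0^'+
      --> dot (lam i *: v i) (v i).
    by apply: (cvg_dot hH) => //; exact: cvg_cst.
  under eq_fun do rewrite dotZl dotBl hv eqxx.
  by rewrite dotZl hv eqxx mulr1.
Qed.

Lemma low_proj_lincomb a : low_proj (lincomb v a) = lincomb v a.
Proof. by rewrite /low_proj onb_coords. Qed.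

Lemma low_projB x y : low_proj (x - y) = low_proj x - low_proj y.
Proof. by rewrite /low_proj coordsB lincombB. Qed.

Lemma low_projZ a x : low_proj (a *: x) = a *: low_proj x.
Proof. by rewrite /low_proj coordsZ lincombZ. Qed.

Lemma low_proj_sum (I : Type) (r : seq I) (f : I -> H) :
  low_proj (\sum_(i <- r) f i) = \sum_(i <- r) low_proj (f i).
Proof.
rewrite /low_proj; apply: (big_morph (fun x => lincomb v (coords dot v x))) => [x y|].
  by rewrite coordsD lincombD.
by rewrite -(subrr (0 : H)) coordsB lincombB !subrr.
Qed.

(** [decay] starts from the stable part of a vector. For arbitrary [x] the unstable space must be
    invariant under [S t]: as [S t] commutes with [A], [eigenvector_low] applies to each
    [S t (v i)]. *)
Lemma S_high t x : 0 <= t ->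
  `|S t x - low_proj (S t x)| <= expR (- gamma * t) * `|x - low_proj x|.
Proof.
move=> t0; have := decay x t0 => /=.
suff -> : S t (x - low_proj x) - low_proj (S t (x - low_proj x)) = S t x - low_proj (S t x)
  by [].
rewrite S_B// low_projB.
suff <- : S t (low_proj x) = low_proj (S t (low_proj x)).
  by rewrite opprB addrA subrK.
have h i : S t (v i) = low_proj (S t (v i)).
  have [h1 h2] := S_DA t0 (vDA i).
  by apply: eigenvector_low h1 _ (lam0 i); rewrite h2 Av S_Z.
have E_vs := span_subspace v.
have : lin_span (range v) (S t (low_proj x)).
  rewrite /low_proj /lincomb.
  elim/big_ind: _ => [|y z hy hz|i _]; first by rewrite S_0//; exact: vs0 E_vs.
  - have := S_lin t0 1 y z; rewrite !scale1r => ->; exact: vsD E_vs _ _ hy hz.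
  - by rewrite S_Z// h; apply: vsZ E_vs _ _ _; exact: span_lincomb.
by move=> /spanP[a ->]; rewrite low_proj_lincomb.
Qed.

Lemma A_high_proj x : DA x -> A (x - low_proj x) = A x - low_proj (A x).
Proof.
move=> hx; rewrite A_B//; last exact: low_proj_DA.
rewrite A_low; congr (_ - lincomb v _); apply/rowP => i.
by rewrite mul_mx_diag !mxE A_coord// mulrC.
Qed.

Lemma A_S_high t x : 0 <= t -> DA x ->
  `|A (S t x - low_proj (S t x))| <= expR (- gamma * t) * `|A x - low_proj (A x)|.
Proof.
move=> t0 hx; have [h1 h2] := S_DA t0 hx.
by rewrite A_high_proj// h2; exact: S_high.
Qed.

End UnboundedOperator.

(** * Approximation of the unstable modes by the POD subspace *)

Lemma geometric_sum_le (R : realType) (p : R) n : 0 <= p < 1 ->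
  \sum_(1 <= k < n.+1) p ^+ k <= (1 - p)^-1.
Proof.
move=> /andP[p0 p1]; have q0 : 0 < 1 - p by lra.
rewrite -[leRHS]mul1r ler_pdivlMr//.
have -> : (\sum_(1 <= k < n.+1) p ^+ k) * (1 - p) = p - p ^+ n.+1.
  elim: n => [|n IH]; first by rewrite big_geq// mul0r expr1 subrr.
  by rewrite big_nat_recr//= mulrDl IH (exprS p n.+1); ring.
by have := exprn_ge0 n.+1 p0; lra.
Qed.

Lemma subn_ord_range l n (j : 'I_l) : (l <= n)%N -> (1 <= n - j <= n)%N.
Proof. by have := ltn_ord j; lia. Qed.

Section Projection.
Context (R : realType) (H : completeNormedModType R) (dot : {dot H for idfun}).
Hypothesis hH : hilbert_dot dot.

Lemma proj_dist d (u : 'I_d -> H) y : onb dot u ->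
  `|y - lincomb u (coords dot u y)| ^+ 2 = `|y| ^+ 2 - rowdot (coords dot u y) (coords dot u y).
Proof.
move=> hu; rewrite -!(dot_normE hH) dotBl !dotBr (onb_dot _ _ hu) (dotC dot y)
  !dot_lincomb//; ring.
Qed.

Lemma proj_orth d (u : 'I_d -> H) x b : onb dot u ->
  dot (x - lincomb u (coords dot u x)) (lincomb u b) = 0.
Proof.
by move=> hu; rewrite dotBl (dotC dot x) (onb_dot _ _ hu) dot_lincomb// rowdotC subrr.
Qed.

Lemma proj_min d (u : 'I_d -> H) y z : onb dot u -> lin_span (range u) z ->
  `|y - lincomb u (coords dot u y)| ^+ 2 <= `|y - z| ^+ 2.
Proof.
move=> hu /spanP[a ->].
have -> : y - lincomb u a = (y - lincomb u (coords dot u y)) + lincomb u (coords dot u y - a).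
  by rewrite lincombB addrA subrK.
have := proj_orth y (coords dot u y - a) hu.
move: (y - _) (lincomb u (_ - a)) => r w rw.
rewrite -!(dot_normE hH) dotDl !dotDr (dotC dot w) rw addr0 add0r lerDl; exact: dot_ge0.
Qed.

End Projection.

(** * Covariance of the snapshots and stationarity of the POD cost *)

Section POD.
Context (R : realType) (H : completeNormedModType R) (dot : {dot H for idfun}).
Hypothesis hH : hilbert_dot dot.
Variable y : nat -> H.

Definition cov n x : H := \sum_(1 <= k < n.+1) dot x (y k) *: y k.

Lemma cov_dot n x z : dot (cov n x) z = \sum_(1 <= k < n.+1) dot x (y k) * dot z (y k).
Proof. by rewrite dot_suml; apply: eq_bigr => k _; rewrite dotZl (dotC dot (y k)). Qed.

Lemma snapshot_vs n : vsubspace (snapshot_span y n).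
Proof.
split=> [|c x z]; rewrite !inE.
  exists 0, (fun=> 0), (fun=> 0); split; first by case.
  by rewrite big_ord0.
move=> [d1 [e1 [c1 [h1 ->]]]] [d2 [e2 [c2 [h2 ->]]]].
exists (d1 + d2)%N, (fun i => match fintype.split i with inl a => e1 a | inr b => e2 b end),
  (fun i => match fintype.split i with inl a => c * c1 a | inr b => c2 b end).
split; first by move=> i; case: (fintype.split i).
rewrite big_split_ord /=; congr (_ + _).
  rewrite scaler_sumr; apply: eq_bigr => i _.
  by rewrite (unsplitK (inl i)) scalerA.
by apply: eq_bigr => i _; rewrite (unsplitK (inr i)).
Qed.

Lemma snapshot_mem n k : (1 <= k <= n)%N -> snapshot_span y n (y k).
Proof.
move=> hk; exists 1%N, (fun=> y k), (fun=> 1); split.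
  by move=> _; exists k.
by rewrite big_ord1 scale1r.
Qed.

Lemma cov_mem n x : snapshot_span y n (cov n x).
Proof.
rewrite /cov big_nat; have V := snapshot_vs n.
elim/big_ind: _ => [|a b ha hb|k hk]; [exact: (vs0 V)|exact: (vsD V)|].
by apply: (vsZ V); exact: snapshot_mem.
Qed.

Lemma pod_costE n d (u : 'I_d -> H) : onb dot u ->
  pod_cost dot y n (lin_span (range u)) =
  \sum_(1 <= k < n.+1) `|y k| ^+ 2
  - \sum_i \sum_(1 <= k < n.+1) dot (y k) (u i) ^+ 2.
Proof.
move=> hu; rewrite exchange_big /= -sumrB; apply: eq_bigr => k _.
rewrite orth_projE// proj_dist// rowdotE; congr (_ - _).
by apply: eq_bigr => i _; rewrite !mxE expr2.
Qed.

(* First variation of the cost when the basis vector [u i] is rotated towards [w]. *)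
Lemma pod_variation n m d (u : 'I_d -> H) i w : onb dot u -> (d <= m)%N ->
  pod_subspace dot y n m (lin_span (range u)) ->
  snapshot_span y n w -> (forall j, dot w (u j) = 0) -> dot (cov n (u i)) w = 0.
Proof.
move=> hu dm [[_ hsub _] hmin] hw wu.
pose a := \sum_(1 <= k < n.+1) dot (y k) (u i) ^+ 2.
pose e := \sum_(1 <= k < n.+1) dot (y k) w ^+ 2.
pose b := dot (cov n (u i)) w.
have bE : b = \sum_(1 <= k < n.+1) dot (y k) (u i) * dot (y k) w.
  by rewrite /b cov_dot; apply: eq_bigr => k _; rewrite !(dotC dot (y k)).
pose W := dot w w.
(* Minimality, multiplied by the squared norm [1 + s ^+ 2 * W] of the rotated vector, is a
   polynomial inequality in [s] without constant term, so the linear coefficient vanishes. *)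
suff key s : 0 <= 0 + s * (2 * - b) + s ^+ 2 * (a * W - e).
  have := quadratic_discriminant key; rewrite mul0r sqrrN => h.
  by apply/eqP; rewrite -sqrf_eq0 eq_le h sqr_ge0.
have W0 : 0 <= W by exact: dot_ge0.
pose N2 := 1 + s ^+ 2 * W.
have N20 : 0 < N2 by rewrite ltr_pwDl// mulr_ge0// sqr_ge0.
pose N := Num.sqrt N2.
have N0 : 0 < N by rewrite sqrtr_gt0.
have NN : N * N = N2 by rewrite -expr2 sqr_sqrtr// ltW.
pose u' j := if j == i then N^-1 *: (u i + s *: w) else u j.
have hu' : onb dot u'.
  have h1 : dot (N^-1 *: (u i + s *: w)) (N^-1 *: (u i + s *: w)) = 1.
    rewrite dotZl dotZr !(dotDl, dotDr, dotZl, dotZr) hu eqxx (dotC dot (u i)) wu -/W.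
    rewrite [LHS](_ : _ = N2 / (N * N)); first by rewrite NN divff ?gt_eqF.
    by rewrite /N2 /=; field; rewrite gt_eqF.
  have h2 j : j != i -> dot (N^-1 *: (u i + s *: w)) (u j) = 0.
    by move=> ji; rewrite dotZl dotDl dotZl wu hu eq_sym (negPf ji) !(mulr0, addr0).
  move=> j k; rewrite /u'.
  case: (eqVneq j i) => [ji|ji]; case: (eqVneq k i) => [ki|ki].
  - by rewrite h1 ji ki eqxx.
  - by rewrite h2// ji eq_sym (negPf ki).
  - by rewrite (dotC dot) h2// ki (negPf ji).
  - by rewrite hu.
have adm : pod_admissible y n m (lin_span (range u')).
  split; first exact: span_subspace.
  - apply: (vs_span (snapshot_vs n)) => _ [j _ <-]; rewrite /u'.
    have V := snapshot_vs n.
    have uj k : snapshot_span y n (u k) by apply: hsub; exact: span_mem.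
    case: ifP => _ //; apply: (vsZ V); apply: (vsD V) => //.
    exact: (vsZ V).
  - by exists d => //; exists u'; split => //; exact: onb_ind hu'.
have := hmin _ adm; rewrite !pod_costE// lerD2l lerN2.
rewrite (bigD1 i)//= [leRHS](bigD1 i)//=.
rewrite [X in _ + X <= _](eq_bigr (fun j => \sum_(1 <= k < n.+1) dot (y k) (u j) ^+ 2));
  last by move=> j ji; rewrite /u' (negPf ji).
rewrite lerD2r -/a {1}/u' eqxx.
have -> : \sum_(1 <= k < n.+1) dot (y k) (N^-1 *: (u i + s *: w)) ^+ 2
  = (a + s * (2 * b) + s ^+ 2 * e) / N2.
  rewrite bE /a /e !mulr_sumr -!big_split /= mulr_suml.
  apply: eq_bigr => k _; rewrite dotZr dotDr dotZr -NN.
  by field; rewrite gt_eqF.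
by rewrite ler_pdivrMr// /N2; nra.
Qed.

(** The component of [cov n (u i)] orthogonal to the POD subspace is itself an admissible direction
    of variation, and stationarity in this direction says that its norm is zero. *)
Lemma cov_invariant n m d (u : 'I_d -> H) i : onb dot u -> (d <= m)%N ->
  pod_subspace dot y n m (lin_span (range u)) ->
  lin_span (range u) (cov n (u i)).
Proof.
move=> hu dm hD; have [[_ hsub _] _] := hD.
pose w := cov n (u i) - lincomb u (coords dot u (cov n (u i))).
have wu b : dot w (lincomb u b) = 0 by exact: proj_orth.
have hw : snapshot_span y n w.
  apply: (vsB (snapshot_vs n)); first exact: cov_mem.
  by apply: hsub; exact: span_lincomb.
have := pod_variation i hu dm hD hw.
have wuj j : dot w (u j) = 0 by rewrite -(lincomb_delta u j) wu.
move=> /(_ wuj) h.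
have w0 : w = 0.
  apply: (dot_eq0 hH); rewrite {1}/w dotBl h (dotC dot (lincomb _ _)) wu subrr//.
by rewrite -[cov _ _](subrK (lincomb u (coords dot u (cov n (u i))))) -/w w0 add0r; exact:
  span_lincomb.
Qed.

End POD.

(** * Bounded cost and closeness in the graph norm *)

Section PODApprox.
Context (R : realType) (H : completeNormedModType R) (dot : {dot H for idfun}).
Hypothesis hH : hilbert_dot dot.
Variables (DA : set H) (A : H -> H).
Hypothesis lA : linear_on DA A.
Variables (l : nat) (v : 'I_l -> H) (lam mu c : 'I_l -> R).
Hypotheses (hv : onb dot v) (vDA : forall i, DA (v i))
  (Av : forall i, A (v i) = lam i *: v i).
Hypotheses (mu1 : forall i, 1 < mu i) (mu_inj : injective mu)
  (c0 : forall i, c i != 0).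
Variables (y : nat -> H) (q C0 : R).
Hypotheses (q01 : 0 < q < 1) (C00 : 0 <= C0).
Hypotheses (yDA : forall k, DA (y k))
  (ylow : forall k i, dot (y k) (v i) = mu i ^+ k * c i)
  (yhigh : forall k, `|y k - low_proj dot v (y k)| <= C0 * q ^+ k)
  (Ayhigh : forall k, `|A (y k - low_proj dot v (y k))| <= C0 * q ^+ k).

Let low := low_proj dot v.
Let z n (j : 'I_l) := y (n - j).

Lemma mu_gt0 i : 0 < mu i. Proof. exact: lt_trans ltr01 (mu1 i). Qed.

(** Up to the factor [mu b ^+ n * c b], these are the unstable coordinates of the last [l]
    snapshots: a Vandermonde matrix that does not depend on [n], with distinct nodes because [mu] is
    injective. *)
Let vander : 'M[R]_l := \matrix_(j, b) (mu b)^-1 ^+ j.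

Lemma vander_unit : vander \in unitmx.
Proof.
have -> : vander = Vandermonde l (\row_b (mu b)^-1).
  by apply/matrixP => i j; rewrite !mxE.
rewrite unitmxE det_Vandermonde unitfE; apply/prodf_neq0 => i _.
apply/prodf_neq0 => j ij; rewrite !mxE subr_eq0.
apply/eqP => /invr_inj/mu_inj e; by rewrite e ltnn in ij.
Qed.

Let G := invmx vander.

Lemma last_snapshot_low n j b : (l <= n)%N -> dot (z n j) (v b) = mu b ^+ n * c b * vander j b.
Proof.
move=> ln; rewrite /z ylow mxE exprVn mulrAC; congr (_ * _).
have jn : (j <= n)%N by rewrite (leq_trans _ ln)// ltnW.
by rewrite expfB_cond// gt_eqF ?mu_gt0.
Qed.

Lemma lincomb_last_snapshot_low n a b : (l <= n)%N ->
  dot (lincomb (z n) a) (v b) = mu b ^+ n * c b * (a *m vander) 0 b.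
Proof.
move=> ln; rewrite dot_suml mxE mulr_sumr; apply: eq_bigr => j _.
by rewrite dotZl last_snapshot_low//; ring.
Qed.

Lemma mu_exp_neq0 n b : mu b ^+ n * c b != 0.
Proof. by rewrite mulf_neq0// expf_neq0// gt_eqF ?mu_gt0. Qed.

Lemma last_snapshot_indep n : (l <= n)%N -> lin_indep (z n).
Proof.
move=> ln a ha i; pose a' : 'rV[R]_l := \row_i a i.
have h : lincomb (z n) a' = 0.
  by rewrite -[RHS]ha; apply: eq_bigr => j _; rewrite mxE.
suff : a' = 0 by move/rowP/(_ i); rewrite !mxE.
rewrite -[a'](mulmxK vander_unit).
suff -> : a' *m vander = 0 by rewrite mul0mx.
apply/rowP => b; rewrite [RHS]mxE; have := lincomb_last_snapshot_low a' b ln; rewrite h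
  dot0l => /esym/eqP.
by rewrite mulf_eq0 (negPf (mu_exp_neq0 n b)) /= => /eqP.
Qed.

Let g := \sum_b \sum_j `|G b j|.

(** The last [l] snapshots have stable parts no larger than that of any snapshot [k], up to the
    fixed factor [q ^- l]; the error of the competitor at [k] is then of order [q ^+ k], which is
    summable uniformly in [n]. *)
Lemma decay_window_le n k j : (k <= n)%N -> (j < l)%N -> q ^+ (n - j) <= (q ^+ l)^-1 * q ^+ k.
Proof.
have /andP[q0 q1] := q01 => kn jl.
have e : (k <= l + (n - j))%N by lia.
by rewrite ler_pdivlMl ?exprn_gt0// -exprD; apply: ler_wiXn2l => //; exact: ltW.
Qed.


Lemma inverse_vander_sum_ge0 : 0 <= g. Proof. by apply: sumr_ge0 => b _; exact: sumr_ge0. Qed.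

Lemma inverse_vander_row_le b : \sum_j `|G b j| <= g.
Proof.
rewrite /g [leRHS](bigD1 b)//= lerDl; apply: sumr_ge0 => i _; exact: sumr_ge0.
Qed.

Let high x := x - low x.

Lemma highZ a x : high (a *: x) = a *: high x.
Proof. by rewrite /high /low low_projZ scalerBr. Qed.

Lemma high_sum (I : Type) (r : seq I) (f : I -> H) :
  high (\sum_(i <- r) f i) = \sum_(i <- r) high (f i).
Proof. by rewrite /high /low low_proj_sum sumrB. Qed.

Lemma high_lincomb (phi : 'I_l -> H) a : high (lincomb phi a) = lincomb (fun j => high (phi
  j)) a.
Proof. by rewrite /lincomb high_sum; apply: eq_bigr => j _; rewrite highZ. Qed.

Lemma high0 x : (forall i, dot x (v i) = 0) -> high x = x.
Proof.
move=> h; rewrite /high /low /low_proj.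
have -> : coords dot v x = 0 by apply/rowP => i; rewrite !mxE h.
by rewrite lincomb0 subr0.
Qed.

Lemma highB x x' : high (x - x') = high x - high x'.
Proof. by rewrite /high /low low_projB !opprB addrACA [RHS]addrACA (addrC (- x')). Qed.

Lemma last_snapshot_span n j : (l <= n)%N -> snapshot_span y n (z n j).
Proof.
by move=> ln; apply: snapshot_mem; exact: subn_ord_range.
Qed.

(* Competitor: the span of the last [l] snapshots. It contains the unstable component of
   every snapshot up to an error of the size of the stable components. *)
Lemma pod_cost_bounded m : (l <= m)%N ->
  exists2 C1, 0 <= C1 & forall n D, (l <= n)%N -> pod_subspace dot y n m D ->
    pod_cost dot y n D <= C1.
Proof.
have /andP[q0 q1] := q01.
move=> lm; pose K := C0 * (1 + g * (q ^+ l)^-1).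
have K0 : 0 <= K.
  by rewrite mulr_ge0// addr_ge0// mulr_ge0 ?inverse_vander_sum_ge0// invr_ge0 exprn_ge0// ltW.
have q20 : 0 <= q ^+ 2 < 1 by rewrite sqr_ge0 /= expr_lt1// ltW.
exists (K ^+ 2 / (1 - q ^+ 2)).
  by rewrite divr_ge0 ?sqr_ge0//; case/andP: q20 => _ h; lra.
move=> n D ln [_ hmin].
have [u hu su] := gram_schmidt hH (last_snapshot_indep ln).
have adm : pod_admissible y n m (lin_span (range (z n))).
  split; first exact: span_subspace.
  - by apply: (vs_span (snapshot_vs y n)) => _ [j _ <-]; exact: last_snapshot_span.
  - by exists l => //; exists (z n); split => //; exact: last_snapshot_indep.
apply: (le_trans (hmin _ adm)); rewrite /pod_cost.
apply: (@le_trans _ _ (\sum_(1 <= k < n.+1) K ^+ 2 * (q ^+ 2) ^+ k)); last first.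
  by rewrite -mulr_sumr ler_wpM2l ?sqr_ge0//; exact: geometric_sum_le.
rewrite !big_nat ler_sum// => k /andP[k1 kn].
rewrite -su orth_projE//.
(* These coefficients reproduce the unstable part of [y k]. They are bounded by entries of [G]
   because [mu b ^+ k <= mu b ^+ n] for [k <= n]. *)
pose a : 'rV[R]_l := \row_j \sum_b mu b ^+ k / mu b ^+ n * G b j.
apply: (le_trans (proj_min hH (y k) hu (z := lincomb (z n) a) _)).
  by rewrite su; exact: span_lincomb.
have Kq : 0 <= K * q ^+ k by rewrite mulr_ge0// exprn_ge0// ltW.
rewrite exprAC -exprMn ler_pXn2r ?nnegrE//.
have aG : a *m vander = \row_b (mu b ^+ k / mu b ^+ n).
  have -> : a = (\row_b (mu b ^+ k / mu b ^+ n)) *m G.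
    by apply/rowP => j; rewrite !mxE; apply: eq_bigr => b _; rewrite !mxE.
  by rewrite /G mulmxKV// vander_unit.
have -> : y k - lincomb (z n) a = high (y k) - lincomb (fun j => high (z n j)) a.
  rewrite -high_lincomb -highB high0// => b.
  rewrite dotBl lincomb_last_snapshot_low// aG mxE ylow.
  have : mu b ^+ n != 0 by rewrite expf_neq0// gt_eqF ?mu_gt0.
  by move=> mn; field.
apply: (le_trans (ler_normB _ _)).
have -> : K * q ^+ k = C0 * q ^+ k + g * (C0 * ((q ^+ l)^-1 * q ^+ k)).
  by rewrite /K; ring.
apply: lerD; first exact: yhigh.
apply: (le_trans (ler_norm_sum _ _ _)).
apply: (@le_trans _ _ (\sum_j `|a 0 j| * (C0 * ((q ^+ l)^-1 * q ^+ k)))).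
  apply: ler_sum => j _; rewrite normrZ ler_wpM2l//.
  apply: (le_trans (yhigh _)); rewrite ler_wpM2l//.
  by apply: decay_window_le => //; rewrite -ltnS.
rewrite -mulr_suml ler_wpM2r//.
  by rewrite !mulr_ge0 ?invr_ge0 ?exprn_ge0// ltW.
rewrite /g exchange_big /= ler_sum// => j _; rewrite mxE.
apply: (le_trans (ler_norm_sum _ _ _)); apply: ler_sum => b _.
rewrite normrM ler_piMl//.
have m0 := mu_gt0 b.
rewrite ger0_norm ?divr_ge0 ?exprn_ge0 ?(ltW m0)// ler_pdivrMr ?exprn_gt0// mul1r.
by apply: ler_weXn2l => //; exact: ltW.
Qed.

Lemma mu_small e : 0 < e -> exists n0, forall n i, (n0 <= n)%N -> (mu i ^+ n)^-1 <= e.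
Proof.
move=> e0.
have h i : {N | forall n, (N <= n)%N -> (mu i ^+ n)^-1 <= e}.
  apply/cid.
  have c1 : (fun n => (mu i)^-1 ^+ n) @ \oo --> (0 : R).
    apply: cvg_expr; rewrite ger0_norm ?invr_ge0 ?(ltW (mu_gt0 i))//.
    by rewrite invf_lt1 ?mu_gt0.
  have [N _ hN] := cvgr_lt _ c1 e e0.
  by exists N => n Nn; have := hN n Nn; rewrite /= exprVn => /ltW.
exists (\max_i sval (h i)) => n i hn.
by apply: (svalP (h i)); apply: leq_trans hn; exact: (leq_bigmax i).
Qed.

(* Write [v i] as the unstable part of a combination [w] of the last snapshots with
   small coefficients, and let [phi] be its projection. The covariance maps the POD
   subspace onto itself, so [phi = cov x] with [x] in it, and the coefficients
   [<x, y k>] of [phi] along the snapshots are again small. *)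
Theorem pod_approximation m eta : (l <= m)%N -> 0 < eta ->
  exists n0, forall n D, (n0 <= n)%N -> pod_subspace dot y n m D ->
  exists phi : 'I_l -> H, forall i,
    [/\ D (phi i), `|phi i - v i| <= eta & `|A (phi i) - A (v i)| <= eta].
Proof.
have /andP[q0 q1] := q01.
move=> lm eta0; have [C1 C10 hC1] := pod_cost_bounded lm.
pose La := \sum_i `|lam i|.
have La0 : 0 <= La by exact: sumr_ge0.
(* With [b] the sum of the absolute coefficients of [w], [b * K1] will bound [phi - v i]: [C0] for
   the stable part of [w], [Num.sqrt C1] for the distance of a snapshot to the POD subspace. In
   [K2], the term [La * K1] is for the unstable part under [A] and [C0 / (1 - q)] for the stable
   part. As [b] is at most [g * cm * mu ^- n], [K] converts [eta] into a threshold for [n]. *)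
pose K1 := C0 + Num.sqrt C1.
have K10 : 0 <= K1 by rewrite addr_ge0// sqrtr_ge0.
pose K2 := K1 + (La * K1 + C0 * (1 - q)^-1).
have q1i : 0 <= (1 - q)^-1 by rewrite invr_ge0; lra.
have K2K1 : K1 <= K2 by rewrite lerDl addr_ge0 ?mulr_ge0.
pose cm := \sum_i `|c i|^-1.
have cm0 : 0 <= cm by apply: sumr_ge0 => i _; rewrite invr_ge0.
pose K := g * cm * K2 + 1.
have K20 : 0 <= K2 by exact: le_trans K2K1.
have K0 : 0 < K by rewrite ltr_wpDl// !mulr_ge0// inverse_vander_sum_ge0.
have [n1 hn1] := mu_small (divr_gt0 eta0 K0).
exists (maxn l n1) => n D; rewrite geq_max => /andP[ln n1n] hD.
have cost := hC1 n D ln hD.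
have [[_ hsub [d dD dm]] _] := hD.
have [u hu su] := has_dim_onb hH dD.
rewrite su in hD hsub cost *; clear dD su D.
have inv_cov i : lin_span (range u) (cov dot y n (u i)).
  exact: cov_invariant hu dm hD.
have range_subspace := span_subspace u.
have cov_lin x : cov dot y n (lincomb u x) = lincomb (fun i => cov dot y n (u i)) x.
  rewrite /cov /lincomb; under [RHS]eq_bigr do rewrite scaler_sumr.
  rewrite exchange_big /=; apply: eq_bigr => k _.
  by rewrite dot_suml scaler_suml; apply: eq_bigr => i _; rewrite dotZl scalerA.
have covD x : lin_span (range u) (cov dot y n (lincomb u x)).
  by rewrite cov_lin; exact: (vs_lincomb range_subspace).
pose N : 'M[R]_d := \matrix_(i, j) dot (cov dot y n (u i)) (u j).
have coN x : coords dot u (cov dot y n (lincomb u x)) = x *m N by rewrite cov_lin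
  coords_lincomb.
have covxx x : dot (cov dot y n x) x = \sum_(1 <= k < n.+1) dot x (y k) ^+ 2.
  by rewrite cov_dot; apply: eq_bigr => k _; rewrite expr2.
have single x k : (1 <= k <= n)%N -> dot x (y k) ^+ 2 <= dot (cov dot y n x) x.
  move=> /andP[k1 kn]; rewrite covxx (big_cat_nat _ (n := k)) ?(leqW kn)//=.
  rewrite (big_ltn (m := k)) ?ltnS//.
  have h1 : 0 <= \sum_(1 <= i < k) dot x (y i) ^+ 2.
    by apply: sumr_ge0 => i _; exact: sqr_ge0.
  have h2 : 0 <= \sum_(k.+1 <= i < n.+1) dot x (y i) ^+ 2.
    by apply: sumr_ge0 => i _; exact: sqr_ge0.
  by lra.
(* If [cov x = 0], then [x] is orthogonal to all snapshots; lying in their span, it is zero. *)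
have uN : N \in unitmx.
  apply: unitmx_ker0 => x xN.
  have hx : dot (cov dot y n (lincomb u x)) (lincomb u x) = 0.
    by rewrite (dotC dot) dot_lincomb coN xN rowdotC rowdot0l.
  suff : lincomb u x = 0 by move=> h; rewrite -(onb_coords x hu) h; apply/rowP => i;
    rewrite !mxE dot0l.
  apply: (dot_eq0 hH).
  have : snapshot_span y n (lincomb u x) by apply: hsub; exact: span_lincomb.
  move=> [k [e [b [he ebE]]]]; rewrite {2}ebE dot_sumr big1 // => j _.
  have [r hr <-] := he j; rewrite dotZr.
  have := single (lincomb u x) r hr; rewrite hx => h.
  suff -> : dot (lincomb u x) (y r) = 0 by rewrite mulr0.
  by apply/eqP; rewrite -sqrf_eq0 eq_le h sqr_ge0.
suff phi_exists i : exists phi, [/\ lin_span (range u) phi, `|phi - v i| <= eta &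
    `|A phi - A (v i)| <= eta].
  have [phi hphi] := choice phi_exists; by exists phi.
pose be : 'rV[R]_l := \row_j (G i j / (mu i ^+ n * c i)).
pose b := \sum_j `|be 0 j|.
have b0 : 0 <= b by exact: sumr_ge0.
have bK : b * K2 <= eta.
  have b1 : b <= g * (cm * (mu i ^+ n)^-1).
    have -> : b = (\sum_j `|G i j|) * (`|c i|^-1 * (mu i ^+ n)^-1).
      rewrite /b mulr_suml; apply: eq_bigr => j _.
      rewrite mxE normrM normfV normrM (ger0_norm (exprn_ge0 n (ltW (mu_gt0 i)))).
      by rewrite invfM [_^-1 * _^-1]mulrC.
    apply: ler_pM => //; [exact: sumr_ge0| |exact: inverse_vander_row_le|].
      by rewrite mulr_ge0 ?invr_ge0 ?exprn_ge0// ltW// mu_gt0.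
    rewrite ler_wpM2r ?invr_ge0 ?exprn_ge0 ?(ltW (mu_gt0 i))//.
    by rewrite /cm (bigD1 i)//= lerDl sumr_ge0// => j _; rewrite invr_ge0.
  have b2 : (mu i ^+ n)^-1 <= eta / K by exact: hn1.
  apply: (@le_trans _ _ (g * (cm * (eta / K)) * K2)).
    rewrite ler_wpM2r//; apply: (le_trans b1); rewrite ler_wpM2l ?inverse_vander_sum_ge0//.
    by rewrite ler_wpM2l.
  have -> : g * (cm * (eta / K)) * K2 = (g * cm * K2) / K * eta by ring.
  by rewrite ler_piMl ?(ltW eta0)// ler_pdivrMr// mul1r lerDl.
pose w := lincomb (z n) be.
have wlow j : dot w (v j) = (i == j)%:R.
  rewrite lincomb_last_snapshot_low//.
  have -> : be = (mu i ^+ n * c i)^-1 *: row i G.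
    by apply/rowP => j'; rewrite !mxE mulrC.
  rewrite -scalemxAl -row_mul mulVmx ?vander_unit// !mxE.
  have := mu_exp_neq0 n j; have [->|ij] := eqVneq i j; last by rewrite !mulr0.
  by move=> h; rewrite mulr1 divff.
have lowpw : low w = v i.
  rewrite /low /low_proj -[RHS](lincomb_delta v i); congr lincomb; apply/rowP => j.
  by rewrite !mxE wlow eqxx /= eq_sym.
pose phi := lincomb u (coords dot u w).
have whigh : `|w - v i| <= b * C0.
  rewrite -lowpw -/(high w) high_lincomb /lincomb; apply: (le_trans (ler_norm_sum _ _ _)).
  rewrite /b mulr_suml ler_sum// => j _; rewrite normrZ ler_wpM2l//.
  by apply: (le_trans (yhigh _)); rewrite ler_piMr// exprn_ile1// ltW.
have phiw : `|phi - w| <= b * Num.sqrt C1.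
  have -> : phi - w = \sum_j be 0 j *: (lincomb u (coords dot u (z n j)) - z n j).
    under eq_bigr do rewrite scalerBr; rewrite sumrB; congr (_ - _).
    rewrite /phi; have -> : coords dot u w = \sum_j be 0 j *: coords dot u (z n j).
      apply/rowP => j; rewrite !mxE dot_suml summxE; apply: eq_bigr => k _.
      by rewrite !mxE dotZl.
    by elim/big_ind2: _ => [|x x' e e' <- <-|j _]; [exact: lincomb0|exact: lincombD|exact:
      lincombZ].
  apply: (le_trans (ler_norm_sum _ _ _)).
  rewrite /b mulr_suml ler_sum// => j _; rewrite normrZ ler_wpM2l//.
  rewrite distrC -(@ler_pXn2r _ 2)// ?nnegrE ?sqrtr_ge0// sqr_sqrtr//.
  apply: le_trans cost; rewrite /pod_cost.
  have hk := subn_ord_range j ln.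
  case/andP: hk => k1 kn; set k := (n - j)%N in k1 kn.
  rewrite (big_cat_nat _ (n := k)) ?(leqW kn)//= (big_ltn (m := k)) ?ltnS//.
  rewrite -(orth_projE _ hu).
  set s1 := \sum_(1 <= _ < _) _; set s2 := \sum_(_ <= _ < _) _.
  have h1 : 0 <= s1 by apply: sumr_ge0 => r _; exact: sqr_ge0.
  have h2 : 0 <= s2 by apply: sumr_ge0 => r _; exact: sqr_ge0.
  by rewrite addrCA lerDl addr_ge0.
have phiv : `|phi - v i| <= b * K1.
  have -> : phi - v i = (phi - w) + (w - v i) by rewrite addrA subrK.
  by apply: (le_trans (ler_normD _ _)); rewrite /K1 mulrDr addrC lerD.
exists phi; split.
- exact: span_lincomb.
- by apply: (le_trans phiv); apply: le_trans bK; rewrite ler_wpM2l.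
pose x := lincomb u (coords dot u w *m invmx N).
have covx : cov dot y n x = phi.
  rewrite -[LHS](onb_coordsK hu); last exact: covD.
  by rewrite coN mulmxKV.
have xy k : (1 <= k <= n)%N -> `|dot x (y k)| <= b.
  pose s := dot (cov dot y n x) x.
  have s0 : 0 <= s by rewrite /s covxx; apply: sumr_ge0 => r _; exact: sqr_ge0.
  have single' r : (1 <= r <= n)%N -> `|dot x (y r)| <= Num.sqrt s.
    by move=> hr; rewrite -sqrtr_sqr ler_wsqrtr// single.
  (* [s] is the sum of the squares of the pairings [<x, y k>], but also
     [<cov x, x> = <phi, x> = <w, x>], which is linear in them. Hence [Num.sqrt s <= b], whatever
     the number of snapshots. *)
  have sb : s <= b * Num.sqrt s.
    have es : s = dot w x.
      by rewrite /s covx /phi /x dot_lincomb onb_coords// [RHS](dotC dot) dot_lincomb rowdotC.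
    apply: (@le_trans _ _ `|dot w x|); first by rewrite -es ler_norm.
    rewrite dot_suml /b mulr_suml; apply: (le_trans (ler_norm_sum _ _ _)).
    apply: ler_sum => j _; rewrite dotZl normrM ler_wpM2l// (dotC dot).
    exact: (single' _ (subn_ord_range j ln)).
  have sqs : Num.sqrt s <= b.
    have [->|sn] := eqVneq s 0; first by rewrite sqrtr0.
    have ss : 0 < Num.sqrt s by rewrite sqrtr_gt0 lt_neqAle eq_sym sn.
    by rewrite -(ler_pM2r ss) -expr2 sqr_sqrtr.
  by move=> hk; apply: le_trans sqs; exact: single'.
have DAv := DA_subspace lA.
have DAphi : DA phi.
  by rewrite -covx /cov; apply: (vs_sum DAv) => k; exact: (vsZ DAv).
have lowDA e : DA (low e) by exact: (vs_lincomb DAv).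
(* Closeness in norm says nothing about [A] on the stable part. It is estimated on the expansion of
   [phi = cov x] along the snapshots: the coefficients are at most [b], and the geometric decay sums
   the growing number of terms. *)
have Ahigh : `|A (high phi)| <= b * (C0 * (1 - q)^-1).
  have -> : high phi = \sum_(1 <= k < n.+1) dot x (y k) *: high (y k).
    by rewrite -covx /cov high_sum; apply: eq_bigr => k _; rewrite highZ.
  have hDA k : DA (high (y k)) by apply: (vsB DAv).
  rewrite (A_sum lA) => [|k]; last exact: (vsZ DAv).
  apply: (le_trans (ler_norm_sum _ _ _)).
  apply: (@le_trans _ _ (\sum_(1 <= k < n.+1) b * (C0 * q ^+ k))).
    rewrite !big_nat ler_sum// => k hk; rewrite (A_Z lA)// normrZ.
    by apply: ler_pM => //; [exact: xy | exact: Ayhigh].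
  rewrite -mulr_sumr ler_wpM2l// -mulr_sumr ler_wpM2l//.
  by apply: geometric_sum_le; rewrite q1 ltW.
have Alow e : `|A (low e)| <= La * `|e|.
  rewrite (A_low dot lA vDA Av); apply: (le_trans (ler_norm_sum _ _ _)).
  rewrite /La mulr_suml ler_sum// => j _.
  rewrite mul_mx_diag !mxE normrZ normrM.
  have := dot_cauchy hH e (v j).
  have -> : `|v j| = 1.
    by apply/eqP; rewrite -(@eqrXn2 _ 2)// -(dot_normE hH) hv eqxx expr1n.
  by rewrite !mulr1 mulrC => h; rewrite ler_wpM2l.
have -> : A phi - A (v i) = A (high phi) + A (low (phi - v i)).
  rewrite /low low_projB -/low -(A_D lA)//; last 2 first.
  - exact: (vsB DAv).
  - by apply: (vsB DAv) => //; exact: lowDA.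
  have -> : low (v i) = v i by rewrite /low -{1}(lincomb_delta v i) low_proj_lincomb//
    lincomb_delta.
  by rewrite /high addrA subrK (A_B lA).
have eK : b * K2 = b * K1 + (La * (b * K1) + b * (C0 * (1 - q)^-1)).
  by rewrite /K2; ring.
apply: le_trans bK; rewrite eK; apply: (le_trans (ler_normD _ _)).
have h1 := Alow (phi - v i).
have h2 : La * `|phi - v i| <= La * (b * K1) by rewrite ler_wpM2l.
have h3 : 0 <= b * K1 by rewrite mulr_ge0.
by rewrite addrC -[leLHS]add0r lerD// lerD// (le_trans h1).
Qed.

End PODApprox.

(** * Eigenbasis, Kalman condition and the low-dimensional Riccati equation *)

Section Kalman.
Context (R : realType) (H : completeNormedModType R) (dot : {dot H for idfun}).
Hypothesis hH : hilbert_dot dot.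
Variables (DA : set H) (A : H -> H).
Hypotheses (lA : linear_on DA A) (sA : selfadjoint_op dot DA A).
Variables (l : nat) (E : set H).
Hypotheses (E_dim : has_dim E l) (E_DA : E `<=` DA) (A_E : forall x, E x -> E (A x)).

Lemma eigenbasis :
  (let A1 := fun x => orth_proj dot E (A (orth_proj dot E x)) in
     forall lam : R, eigenvalue_on E A1 lam ->
       has_dim (eigenspace_on E A1 lam) 1 /\ 0 < lam) ->
  exists (v : 'I_l -> H) (lam : 'I_l -> R),
    [/\ onb dot v, E = lin_span (range v), forall i, A (v i) = lam i *: v i,
        forall i, 0 < lam i & injective lam].
Proof.
move=> spec; have [u hu eE] := has_dim_onb hH E_dim.
have [|||v [lam [hv sv Av]]] := @spectral_onb _ _ _ hH A _ u hu.
- by move=> a x y; rewrite -eE => hx hy; apply: (A_lin lA); exact: E_DA.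
- by move=> x; rewrite -eE; exact: A_E.
- by move=> x y; rewrite -eE => hx hy; apply: (A_sym sA); exact: E_DA.
rewrite -eE in sv.
have Ev i : E (v i) by rewrite -sv; exact: span_mem.
have pE x : E x -> orth_proj dot E x = x.
  by rewrite -sv => hx; rewrite orth_projE// (onb_coordsK hv).
have v1 i : dot (v i) (v i) = 1 by rewrite hv eqxx.
have vn0 i : v i <> 0 by move=> h; have := v1 i; rewrite h dot0l => /eqP; rewrite eq_sym
  oner_eq0.
have eig i : eigenspace_on E (fun x => orth_proj dot E (A (orth_proj dot E x))) (lam i) (v i).
  split=> //; rewrite (pE _ (Ev i)) Av pE// -sv.
  by apply: (vsZ (span_subspace v)); exact: span_mem.
have ev_i i : eigenvalue_on E (fun x => orth_proj dot E (A (orth_proj dot E x))) (lam i).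
  by exists (v i).
exists v, lam; split=> //.
  by move=> i; have [] := spec _ (ev_i i).
(* A repeated eigenvalue would put two orthogonal nonzero vectors into a one-dimensional
   eigenspace. *)
move=> i j ij; have [d1 _] := spec _ (ev_i i).
have vi := eig i; have vj := eig j; rewrite -ij in vj.
have [w hw eW] := has_dim_onb hH d1.
move: vi vj; rewrite eW => /spanP[a ea] /spanP[b eb].
have [->//|nij] := eqVneq i j.
have ea1 : v i = a 0 0 *: w 0 by rewrite ea /lincomb big_ord1.
have eb1 : v j = b 0 0 *: w 0 by rewrite eb /lincomb big_ord1.
have := hv i j; rewrite (negPf nij) ea1 eb1 dotZl dotZr hw eqxx mulr1.
move/eqP; rewrite mulf_eq0 => /orP[]/eqP h.
- by have := vn0 i; rewrite ea1 h scale0r.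
- by have := vn0 j; rewrite eb1 h scale0r.
Qed.

Variables (v : 'I_l -> H) (lam : 'I_l -> R).
Hypotheses (hv : onb dot v) (Ev : E = lin_span (range v))
  (Av : forall i, A (v i) = lam i *: v i).

Lemma eigenbasis_DA i : DA (v i).
Proof. by apply: E_DA; rewrite Ev; exact: span_mem. Qed.

(* By its dimension the Kalman space is all of [E], and it is orthogonal to [K]. *)
Lemma kalman_observable (W : set H) (K : set 'rV[R]_l) : kalman_rank dot E A W l ->
  (forall a, K a -> K (a *m diag_mx (\row_i lam i))) ->
  (forall a w, K a -> W w -> dot (lincomb v a) w = 0) -> forall a, K a -> a = 0.
Proof.
rewrite /kalman_rank; set X := [set _ | _ in _ & _ in _] => hdim KA KW a Ka.
have E_vs : vsubspace E by rewrite Ev; exact: span_subspace.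
have pE w : E (orth_proj dot E w) by rewrite Ev orth_projE//; exact: span_lincomb.
have itE j w : E w -> E (iter j A w).
  by move=> hw; elim: j => //= j IH; exact: A_E.
have XE : lin_span X `<=` E.
  by apply: vs_span => // _ [j _ [w _ <-]]; exact: pE.
have Pid x : E x -> orth_proj dot E x = x.
  by rewrite Ev => hx; rewrite orth_projE// (onb_coordsK hv).
have eqE : lin_span X = E by exact: (has_dim_subset hH hdim E_dim XE).
have A_ev_v b : A (lincomb v b) = lincomb v (b *m diag_mx (\row_i lam i)).
  rewrite (A_lincomb lA); last exact: eigenbasis_DA.
  by apply: eq_bigr => i _; rewrite Av scalerA mul_mx_diag !mxE.
have iter_orth j w b : W w -> K b -> dot (lincomb v b) (iter j A (orth_proj dot E w)) = 0.
  move=> hw; elim: j b => [|j IH] b Kb /=.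
    by rewrite Ev orth_projE// onb_dot// -dot_lincomb KW.
  rewrite -(A_sym sA) ?A_ev_v ?IH//; first exact: KA.
  - by apply: E_DA; rewrite Ev; exact: span_lincomb.
  - by apply: E_DA; apply: itE; exact: pE.
have orth x : lin_span X x -> dot (lincomb v a) x = 0.
  move=> [k [e [c [he ->]]]]; rewrite dot_sumr big1 // => i _.
  have [j _ [w hw <-]] := he i.
  by rewrite dotZr Pid ?iter_orth ?mulr0//; exact: itE.
have : dot (lincomb v a) (lincomb v a) = 0 by apply: orth; rewrite eqE Ev; exact: span_lincomb.
by rewrite onb_dot// => /rowdot_eq0.
Qed.

(** If [y0] had no component along [v i], the line through [v i] would be invariant and orthogonal
    to [y0]. The POD estimates divide by these components. *)
Lemma kalman_cyclic y0 : kalman_rank dot E A [set y0] l -> forall i, dot y0 (v i) != 0.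
Proof.
move=> hk i; apply/eqP => h.
pose K := [set a : 'rV[R]_l | exists c, a = c *: delta_mx 0 i].
have KA a : K a -> K (a *m diag_mx (\row_i lam i)).
  move=> [c ->]; exists (c * lam i); apply/rowP => j.
  rewrite mul_mx_diag !mxE eqxx /=.
  by case: eqVneq => [->|_]; rewrite ?(mulr1, mulr0, mul0r).
have KW a w : K a -> [set y0] w -> dot (lincomb v a) w = 0.
  by move=> [c ->] ->; rewrite lincombZ lincomb_delta dotZl (dotC dot) h mulr0.
have : delta_mx 0 i = 0 :> 'rV[R]_l.
  by apply: (kalman_observable hk KA KW); exists 1; rewrite scale1r.
by move/rowP/(_ i)/eqP; rewrite !mxE !eqxx oner_eq0.
Qed.

End Kalman.

Section Gramian.
Context (R : realType) (H U : completeNormedModType R).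
Context (dotH : {dot H for idfun}) (dotU : {dot U for idfun}).
Hypotheses (hH : hilbert_dot dotH) (hU : hilbert_dot dotU).
Variables (DA : set H) (A : H -> H).
Hypotheses (lA : linear_on DA A) (sA : selfadjoint_op dotH DA A).
Variables (l : nat) (E : set H).
Hypotheses (E_dim : has_dim E l) (E_DA : E `<=` DA) (A_E : forall x, E x -> E (A x)).
Variables (v : 'I_l -> H) (lam : 'I_l -> R).
Hypotheses (hv : onb dotH v) (Ev : E = lin_span (range v))
  (Av : forall i, A (v i) = lam i *: v i) (lam0 : forall i, 0 < lam i).
Variables (B : U -> H) (bs : H -> U).
Hypothesis bsP : forall w x, dotH (B w) x = dotU w (bs x).
Hypothesis B_rank : kalman_rank dotH E A (range B) l.

Lemma bs_lin a x y : bs (a *: x + y) = a *: bs x + bs y.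
Proof.
apply/eqP; rewrite -subr_eq0; apply/eqP; apply: (dot_eq0 hU).
set w := _ - _; rewrite {2}/w dotBr dotDr dotZr -!bsP dotDr dotZr; ring.
Qed.

Lemma bs_lincomb d (phi : 'I_d -> H) a : bs (lincomb phi a) = lincomb (fun i => bs (phi i)) a.
Proof.
have bs0 : bs 0 = 0.
  have := bs_lin 1 0 0; rewrite !scale1r addr0 => /eqP.
  by rewrite -subr_eq subrr eq_sym => /eqP.
rewrite /lincomb (big_morph bs (id1 := 0) (op1 := +%R)) //=; last first.
  by move=> x y; have := bs_lin 1 x y; rewrite !scale1r.
by apply: eq_bigr => i _; have := bs_lin (a 0 i) (phi i) 0; rewrite bs0 !addr0.
Qed.

(** Matrix of the quadratic form of [B B^*] on the family [phi]. *)
Definition gram d (phi : 'I_d -> H) : 'M[R]_d :=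
  \matrix_(i, j) dotU (bs (phi i)) (bs (phi j)).

Lemma gram_sym d (phi : 'I_d -> H) : (gram phi)^T = gram phi.
Proof. by apply/matrixP => i j; rewrite !mxE (dotC dotU). Qed.

Lemma gramE d (phi : 'I_d -> H) a b :
  dotU (bs (lincomb phi a)) (bs (lincomb phi b)) = rowdot (a *m gram phi) b.
Proof.
rewrite !bs_lincomb (dotC dotU) dot_lincomb rowdotC; congr (rowdot _ _).
by rewrite coords_lincomb.
Qed.

Let Lam := diag_mx (\row_i lam i).

(* Since [A] is symmetric, the Gramian of the pair [(-A, B)] on the unstable space
   is explicit in an eigenbasis, and its inverse [p] solves the Riccati equation. *)
Lemma riccati_low : exists p : 'M[R]_l, [/\ p^T = p, p \in unitmx &
  p *m Lam + Lam *m p = p *m gram v *m p].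
Proof.
pose X : 'M[R]_l := \matrix_(i, j) (gram v i j / (lam i + lam j)).
have XT : X^T = X.
  by apply/matrixP => i j; rewrite mxE [LHS]mxE [RHS]mxE -{1}gram_sym mxE addrC.
have eigenvalues_diag_sym : Lam^T = Lam by exact: tr_diag_mx.
have XL : X *m Lam + Lam *m X = gram v.
  apply/matrixP => i j; rewrite mxE mul_mx_diag mul_diag_mx !mxE.
  have := lam0 i; have := lam0 j => h1 h2.
  by field; rewrite gt_eqF// addr_gt0.
have uX : X \in unitmx.
  apply: unitmx_ker0.
  (* For [a] in the kernel of [X], the Lyapunov equation gives first that [B^*] kills [lincomb v a],
     then that [a *m Lam] is in the kernel too: an invariant space orthogonal to the range of
     [B]. *)
  pose K := [set a : 'rV[R]_l | a *m X = 0].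
  have KM a : K a -> a *m gram v = a *m Lam *m X.
    by move=> Ka; rewrite -XL mulmxDr !mulmxA Ka mul0mx add0r.
  have KG a : K a -> bs (lincomb v a) = 0.
    move=> Ka; apply: (dot_eq0 hU); rewrite gramE KM// rowdotM_sym// Ka rowdotC rowdot0l//.
  have KG2 a : K a -> a *m gram v = 0.
    move=> Ka; apply/rowP => i; have := gramE v a (delta_mx 0 i).
    have d1 : (delta_mx 0 i : 'rV[R]_l) 0 i = 1 by rewrite mxE !eqxx.
    rewrite KG// dot0l rowdotE (bigD1 i)//= d1 mulr1 big1 => [|j ji].
      by rewrite addr0 => <-; rewrite mxE.
    have -> : (delta_mx 0 i : 'rV[R]_l) 0 j = 0 by rewrite mxE eqxx (negPf ji).
    by rewrite mulr0.
  move=> a Ka; apply: (kalman_observable hH lA sA E_dim E_DA A_E hv Ev Av B_rank _ _ Ka).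
  - by move=> b Kb; have := KG2 b Kb; rewrite KM.
  - by move=> b w Kb [u _ <-]; rewrite (dotC dotH) bsP KG// dot0r.
exists (invmx X); split.
- by rewrite trmx_inv XT.
- by rewrite unitmx_inv.
- rewrite -XL mulmxDr mulmxDl !mulmxA mulVmx// mul1mx.
  by rewrite -!mulmxA mulmxV// mulmx1 addrC.
Qed.

End Gramian.

(** * Lyapunov estimates uniform in the reduced space *)

Section LyapunovEstimates.
Context (R : realType) (H U : completeNormedModType R).
Context (dotH : {dot H for idfun}) (dotU : {dot U for idfun}).
Hypotheses (hH : hilbert_dot dotH) (hU : hilbert_dot dotU).
Variables (DA : set H) (A : H -> H).
Hypotheses (lA : linear_on DA A) (sA : selfadjoint_op dotH DA A).
Variables (l : nat) (v : 'I_l -> H) (lam : 'I_l -> R) (gamma : R).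
Hypotheses (hv : onb dotH v) (vDA : forall i, DA (v i))
  (Av : forall i, A (v i) = lam i *: v i) (lam0 : forall i, 0 < lam i)
  (gamma0 : 0 < gamma)
  (A_high : forall x, DA x -> (forall i, dotH x (v i) = 0) ->
     dotH (A x) x <= - gamma * `|x| ^+ 2).
Variables (B : U -> H) (bs : H -> U) (beta : R).
Hypotheses (bsP : forall w x, dotH (B w) x = dotU w (bs x))
  (bs_bound : forall x, `|bs x| <= beta * `|x|) (beta0 : 0 <= beta).
Variable p : 'M[R]_l.
Let Lam := diag_mx (\row_i lam i).
Hypotheses (pT : p^T = p) (pu : p \in unitmx)
  (pric : p *m Lam + Lam *m p = p *m gram dotU bs v *m p).

(* With [phi = psi = v] this is the operator of matrix [N] in the eigenbasis; replacing [v]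
   by vectors [phi] of the reduced space gives its counterpart there. *)
Definition finrank (N : 'M[R]_l) (phi psi : 'I_l -> H) (Y : H) : H :=
  lincomb psi (coords dotH phi Y *m N).

Lemma finrankE N phi psi Y :
  finrank N phi psi Y = \sum_j \sum_i (dotH Y (phi i) * N i j) *: psi j.
Proof.
apply: eq_bigr => j _; rewrite mxE scaler_suml.
by apply: eq_bigr => i _; rewrite !mxE.
Qed.

Lemma norm_v i : `|v i| = 1.
Proof. by apply/eqP; rewrite -(@eqrXn2 _ 2)// -(dot_normE hH) hv eqxx expr1n. Qed.

Lemma norm_double_sum (f : 'I_l -> 'I_l -> H) (g : 'I_l -> 'I_l -> R) :
  (forall i j, `|f i j| <= g i j) ->
  `|\sum_j \sum_i f i j| <= \sum_j \sum_i g i j.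
Proof.
move=> h; apply: (le_trans (ler_norm_sum _ _ _)); apply: ler_sum => j _.
by apply: (le_trans (ler_norm_sum _ _ _)); apply: ler_sum => i _.
Qed.

Lemma finrank_bound N psi : exists2 C, 0 <= C & forall Y, `|finrank N v psi Y| <= C * `|Y|.
Proof.
exists (\sum_j \sum_i `|N i j| * `|psi j|).
  by apply: sumr_ge0 => j _; apply: sumr_ge0 => i _; rewrite mulr_ge0.
move=> Y; rewrite finrankE mulr_suml; under [leRHS]eq_bigr do rewrite mulr_suml.
apply: norm_double_sum => i j /=; rewrite normrZ normrM.
have := dot_cauchy hH Y (v i); rewrite norm_v mulr1 => h.
by rewrite -mulrA mulrC ler_wpM2l// mulr_ge0.
Qed.

(** The target family [psi0] is free so that one bound covers both the lifted operator, with
    [psi0 = v], and its image under [A], with [psi0 = A v]. *)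
Lemma finrank_close N psi0 : exists2 C, 0 <= C & forall eta phi psi Y, 0 <= eta <= 1 ->
  (forall i, `|phi i - v i| <= eta) -> (forall i, `|psi i - psi0 i| <= eta) ->
  `|finrank N phi psi Y - finrank N v psi0 Y| <= C * eta * `|Y|.
Proof.
exists (\sum_j \sum_i `|N i j| * (2 + `|psi0 j|)).
  by apply: sumr_ge0 => j _; apply: sumr_ge0 => i _; rewrite mulr_ge0// addr_ge0.
move=> eta phi psi Y /andP[e0 e1] hphi hpsi; rewrite !finrankE -sumrB.
under eq_bigr do rewrite -sumrB.
rewrite -mulrA mulr_suml; under [leRHS]eq_bigr do rewrite mulr_suml.
apply: norm_double_sum => i j /=.
have -> : (dotH Y (phi i) * N i j) *: psi j - (dotH Y (v i) * N i j) *: psi0 j =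
    (dotH Y (phi i) * N i j) *: (psi j - psi0 j) +
    (dotH Y (phi i - v i) * N i j) *: psi0 j.
  by rewrite dotBr mulrBl scalerBl scalerBr addrA subrK.
have h1 := dot_cauchy hH Y (phi i).
have h2 := dot_cauchy hH Y (phi i - v i).
have h3 : `|phi i| <= 2.
  rewrite -(subrK (v i) (phi i)); apply: (le_trans (ler_normD _ _)).
  by rewrite norm_v; have := hphi i; lra.
apply: (le_trans (ler_normD _ _)); rewrite !normrZ ?normrM.
have -> : `|N i j| * (2 + `|psi0 j|) * (eta * `|Y|) =
  (`|Y| * 2) * `|N i j| * eta + (`|Y| * eta) * `|N i j| * `|psi0 j| by ring.
apply: lerD.
  apply: ler_pM => //.
  by rewrite ler_wpM2r//; apply: (le_trans h1); rewrite ler_wpM2l.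
by do 2 rewrite ler_wpM2r//; apply: (le_trans h2); rewrite ler_wpM2l.
Qed.

Lemma finrank_sym N phi psi Y Z : N^T = N ->
  dotH (finrank N phi psi Y) Z = dotH Y (finrank N psi phi Z).
Proof. by move=> sN; rewrite (dotC dotH Y) !dot_lincomb rowdotC rowdotM_sym. Qed.

Lemma finrank_DA N phi Y : (forall i, DA (phi i)) -> DA (finrank N phi phi Y).
Proof. by move=> h; exact: (vs_lincomb (DA_subspace lA)). Qed.

Lemma A_finrank N phi Y : (forall i, DA (phi i)) ->
  A (finrank N phi phi Y) = finrank N phi (fun i => A (phi i)) Y.
Proof. by move=> h; rewrite /finrank (A_lincomb lA). Qed.

Definition low_riccati := finrank p v v.

Lemma bs_cauchy x y : `|dotU (bs x) (bs y)| <= beta ^+ 2 * (`|x| * `|y|).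
Proof.
apply: (le_trans (dot_cauchy hU _ _)).
have -> : beta ^+ 2 * (`|x| * `|y|) = (beta * `|x|) * (beta * `|y|) by ring.
by apply: ler_pM.
Qed.

Lemma bsB x y : bs (x - y) = bs x - bs y.
Proof.
have := bs_lin hU bsP (-1) y x; rewrite !scaleN1r => h.
by rewrite addrC h addrC.
Qed.

Lemma A_eigenbasis_finrank N Y Z : dotH Y (finrank N v (fun i => A (v i)) Z) =
  rowdot (coords dotH v Z *m N *m Lam) (coords dotH v Y).
Proof.
rewrite (dotC dotH) dot_lincomb !rowdotE; apply: eq_bigr => j _.
by rewrite [in RHS]mul_mx_diag !mxE Av dotZr; ring.
Qed.

Lemma eigenvalues_diag_sym : Lam^T = Lam. Proof. exact: tr_diag_mx. Qed.

Lemma riccati_form a b : rowdot (a *m p *m gram dotU bs v) (b *m p) =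
  rowdot (a *m p *m Lam) b + rowdot (a *m Lam *m p) b.
Proof.
have := congr1 (fun X => rowdot (a *m X) b) pric.
by rewrite mulmxDr rowdotDl !mulmxA => ->; rewrite (rowdotM_sym _ _ pT).
Qed.

Lemma riccati_swap_form a b : rowdot (a *m Lam *m p) b = rowdot (b *m p *m Lam) a.
Proof. by rewrite (rowdotM_sym _ _ pT) (rowdotM_sym _ _ eigenvalues_diag_sym) rowdotC. Qed.

Lemma ric_low Y : 2 * dotH Y (finrank p v (fun i => A (v i)) Y)
  - dotU (bs (low_riccati Y)) (bs (low_riccati Y)) = 0.
Proof.
by rewrite A_eigenbasis_finrank /low_riccati /finrank (gramE hU bsP) riccati_form
  riccati_swap_form; ring.
Qed.

(** Origin of the square [p *m p]: by the Riccati equation, [p] conjugates the low-dimensional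
    closed loop to [- Lam], so the squared norm of [p a] decays strictly along it. *)
Lemma lyap_low : exists2 c, 0 < c & forall Y,
  dotH Y (finrank (p *m p) v (fun i => A (v i)) Y)
  - dotU (bs (low_riccati Y)) (bs (finrank (p *m p) v v Y)) <= - c * rowdot (coords dotH v
    Y) (coords dotH v Y).
Proof.
pose l0 := (1 + \sum_i (lam i)^-1)^-1.
have s0 : 0 <= \sum_i (lam i)^-1.
  by apply: sumr_ge0 => i _; rewrite invr_ge0 ltW.
have l00 : 0 < l0 by rewrite invr_gt0; lra.
have l0l i : l0 <= lam i.
  rewrite -[leRHS]invrK lef_pV2 ?posrE ?invr_gt0//; last by lra.
  rewrite (bigD1 i)//= addrCA lerDl addr_ge0//.
  by apply: sumr_ge0 => j _; rewrite invr_ge0 ltW.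
have [C C0 hC] := mx_bound (invmx p).
exists (l0 / (C + 1)); first by rewrite divr_gt0//; lra.
move=> Y; rewrite A_eigenbasis_finrank /low_riccati /finrank (gramE hU bsP) mulmxA.
set a := coords dotH v Y.
rewrite riccati_form riccati_swap_form.
have hdiag (b : 'rV[R]_l) : l0 * rowdot b b <= rowdot (b *m Lam) b.
  rewrite !rowdotE mulr_sumr ler_sum// => i _; rewrite mul_mx_diag !mxE.
  by rewrite (mulrC (b 0 i) (lam i)) -mulrA ler_wpM2r// -expr2 sqr_ge0.
have h1 := hdiag (a *m p).
have h2 := hC (a *m p); rewrite mulmxK// in h2.
have h3 := rowdot_ge0 (a *m p).
have h4 : l0 / (C + 1) * rowdot a a <= l0 * rowdot (a *m p) (a *m p).
  rewrite -mulrA ler_wpM2l ?(ltW l00)// mulrC ler_pdivrMr; last by lra.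
  by rewrite mulrDr mulr1 mulrC; lra.
lra.
Qed.

Definition lyapunov_op (K : R) phi Y := Y + K *: finrank (p *m p) phi phi Y.

Let La := \sum_i lam i.

Lemma low_normE Y : `|low_proj dotH v Y| ^+ 2 = rowdot (coords dotH v Y) (coords dotH v Y).
Proof. by rewrite -(dot_normE hH) (onb_dot _ _ hv). Qed.

Lemma A_form Y : DA Y ->
  dotH (A Y) Y <= La * `|low_proj dotH v Y| ^+ 2 - gamma * (`|Y| ^+ 2 - `|low_proj dotH v
    Y| ^+ 2).
Proof.
move=> hY; set x := low_proj dotH v Y.
have [f fE] : {f | f = Y - x} by exists (Y - x).
have xDA : DA x by exact: (vs_lincomb (DA_subspace lA)).
have fDA : DA f by rewrite fE; exact: (vsB (DA_subspace lA)).
have fv i : dotH f (v i) = 0 by rewrite fE; exact: low_proj_orth.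
have fx a : dotH f (lincomb v a) = 0 by exact: orth_lincomb.
have YE : Y = x + f by rewrite fE addrC subrK.
have Ax : A x = lincomb v (coords dotH v Y *m Lam) by rewrite (A_low dotH lA vDA Av).
have -> : dotH (A Y) Y = dotH (A x) x + dotH (A f) f.
  have xf : dotH (A x) f = 0 by rewrite Ax (dotC dotH) fx.
  rewrite {1 2}YE (A_D lA)// dotDl !dotDr (A_sym sA fDA xDA) (dotC dotH f (A x)) xf.
  by ring.
have nY : `|Y| ^+ 2 = `|x| ^+ 2 + `|f| ^+ 2.
  rewrite {1}YE -!(dot_normE hH) dotDl !dotDr (dotC dotH x f) fx; ring.
have h1 := A_high fDA fv.
have h2 : dotH (A x) x <= La * `|x| ^+ 2.
  have hdiag (b : 'rV[R]_l) : rowdot (b *m Lam) b <= La * rowdot b b.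
    rewrite !rowdotE mulr_sumr ler_sum// => i _; rewrite mul_mx_diag !mxE.
    rewrite (mulrC (b 0 i) (lam i)) -mulrA ler_wpM2r// -?expr2 ?sqr_ge0//.
    by rewrite /La (bigD1 i)//= lerDl; apply: sumr_ge0 => j _; exact: ltW.
  by rewrite Ax (onb_dot _ _ hv) low_normE.
rewrite nY; lra.
Qed.

Lemma low_riccati_low Y : low_riccati (low_proj dotH v Y) = low_riccati Y.
Proof. by rewrite /low_riccati /finrank /low_proj onb_coords. Qed.

(** The residual of the lifted solution is compared with that of [low_riccati], which vanishes on
    all of H. After moving [A] to [W Y], only the distances of [phi] to [v] and of [A phi] to [A v]
    enter. *)
Lemma ric_estimate : exists2 C, 0 <= C & forall eta phi Y, 0 <= eta <= 1 ->
  (forall i, DA (phi i)) -> (forall i, `|phi i - v i| <= eta) ->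
  (forall i, `|A (phi i) - A (v i)| <= eta) -> DA Y ->
  `|2 * dotH (A Y) (finrank p phi phi Y) - dotU (bs (finrank p phi phi Y)) (bs (finrank p
    phi phi Y))|
    <= C * eta * `|Y| ^+ 2.
Proof.
have [C1 C10 h1] := finrank_close p v.
have [C2 C20 h2] := finrank_close p (fun i => A (v i)).
have [C3 C30 h3] := finrank_bound p v.
exists (2 * C2 + beta ^+ 2 * (C1 * (C1 + 2 * C3))).
  by rewrite addr_ge0 ?mulr_ge0 ?sqr_ge0 ?addr_ge0 ?mulr_ge0.
move=> eta phi Y he phiDA hphi hAphi YDA; have /andP[e0 e1] := he.
set W := finrank p phi phi Y; set n := `|Y|.
have WDA : DA W by exact: finrank_DA.
have n0 : 0 <= n by exact: normr_ge0.
have b1 := h1 eta phi phi Y he hphi hphi.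
have b2 := h2 eta phi (fun i => A (phi i)) Y he hphi hAphi.
have b3 := h3 Y.
rewrite -/W -/(low_riccati Y) -/n in b1; rewrite -/n -(A_finrank _ _ phiDA) -/W in b2.
rewrite -/(low_riccati Y) -/n in b3.
rewrite (A_sym sA)//.
have e : 2 * dotH Y (A W) - dotU (bs W) (bs W) =
  2 * dotH Y (A W - finrank p v (fun i => A (v i)) Y)
  - (dotU (bs (W - low_riccati Y)) (bs (W - low_riccati Y)) + 2 * dotU (bs (W - low_riccati
    Y)) (bs (low_riccati Y))).
  have := ric_low Y; rewrite !bsB dotBr !(dotBl, dotBr) (dotC dotU (bs (low_riccati Y)) (bs
    W)); lra.
rewrite e.
have t1 := dot_cauchy hH Y (A W - finrank p v (fun i => A (v i)) Y).
have t2 := bs_cauchy (W - low_riccati Y) (W - low_riccati Y).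
have t3 := bs_cauchy (W - low_riccati Y) (low_riccati Y).
set D := `|W - low_riccati Y| in b1 t2 t3 *.
have D0 : 0 <= D by exact: normr_ge0.
have Cn : 0 <= C1 * eta * n by rewrite !mulr_ge0.
have u1 : `|Y| * `|A W - finrank p v (fun i => A (v i)) Y| <= n * (C2 * eta * n).
  by rewrite ler_wpM2l.
have u2 : D * D <= C1 * eta * n * (C1 * n).
  apply: ler_pM => //; apply: (le_trans b1); rewrite ler_wpM2r// ler_piMr//.
have u3 : D * `|low_riccati Y| <= C1 * eta * n * (C3 * n) by apply: ler_pM.
have B0 := sqr_ge0 beta.
have u2' := ler_wpM2l B0 u2; have u3' := ler_wpM2l B0 u3.
move: t1 t2 t3 u1 u2' u3'; rewrite !ler_norml.
set d1 := dotH _ _; set d2 := dotU _ _; set d3 := dotU _ (bs (low_riccati Y)).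
move: (`|Y| * _) (beta ^+ 2 * (D * D)) (beta ^+ 2 * (D * _)) => r1 r2 r3.
have -> : (2 * C2 + beta ^+ 2 * (C1 * (C1 + 2 * C3))) * eta * n ^+ 2 =
  2 * (n * (C2 * eta * n)) + beta ^+ 2 * (C1 * eta * n * (C1 * n))
   + 2 * (beta ^+ 2 * (C1 * eta * n * (C3 * n))) by ring.
move=> /andP[? ?] /andP[? ?] /andP[? ?] ? ? ?; apply/andP; split; lra.
Qed.

(* The term [|Y|^2] of the Lyapunov function controls the stable part, and [K] is chosen so
   that the decay of the low-dimensional loop absorbs the growth of the unstable part. *)
Lemma lyap_estimate : exists K c delta, [/\ 0 <= K, 0 < c, 0 < delta <= 1 &
  forall phi Y TY, (forall i, DA (phi i)) -> (forall i, `|phi i - v i| <= delta) ->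
  (forall i, `|A (phi i) - A (v i)| <= delta) -> DA Y -> `|TY - low_riccati Y| <= delta *
    `|Y| ->
  dotH (A Y) (lyapunov_op K phi Y) - dotU (bs TY) (bs (lyapunov_op K phi Y)) <= - c * `|Y|
    ^+ 2].
Proof.
have [c1 c10 hlow] := lyap_low.
have [Cz Cz0 hCz] := finrank_close (p *m p) v.
have [Ca Ca0 hCa] := finrank_close (p *m p) (fun i => A (v i)).
have [C2 C20 hC2] := finrank_bound (p *m p) v.
have [C3 C30 hC3] := finrank_bound p v.
pose b3 := beta ^+ 2 * C3.
(* [K * c1] pays for every term in the squared unstable norm [X ^+ 2]: [La + gamma] from [A_form],
   and [b3 ^+ 2 / (2 * gamma)] from Young's inequality for the cross term. Of the decay [gamma],
   Young takes one half and the perturbations of size [delta * Q] one quarter, which leaves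
   [gamma / 4]. *)
pose K := (La + gamma + b3 ^+ 2 / (2 * gamma)) / c1.
have La0 : 0 <= La by apply: sumr_ge0 => i _; exact: ltW.
have K0 : 0 <= K.
  by rewrite divr_ge0 ?(ltW c10)// !addr_ge0 ?(ltW gamma0)// divr_ge0 ?sqr_ge0// mulr_ge0// ltW.
have B0 := sqr_ge0 beta.
pose C4 := Ca + beta ^+ 2 * (C2 + Cz + C3 * Cz).
have C40 : 0 <= C4 by rewrite addr_ge0// mulr_ge0// !addr_ge0// mulr_ge0.
pose Q := beta ^+ 2 + K * C4.
have Q0 : 0 <= Q by rewrite addr_ge0// mulr_ge0.
pose delta := Num.min 1 (gamma / (4 * (Q + 1))).
have d0 : 0 < delta by rewrite lt_min ltr01 divr_gt0//; lra.
have d1 : delta <= 1 by rewrite ge_min lexx.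
have dQ : delta * Q <= gamma / 4.
  have : delta <= gamma / (4 * (Q + 1)) by rewrite ge_min lexx orbT.
  rewrite ler_pdivlMr; last by lra.
  move=> h; have := ltW d0; nra.
have he : 0 <= delta <= 1 by rewrite ltW.
exists K, (gamma / 4), delta; split => //; first by rewrite divr_gt0.
  by rewrite d0.
move=> phi Y TY phiDA hphi hAphi YDA hT.
set n := `|Y| in hT *.
have n0 : 0 <= n by exact: normr_ge0.
set X := `|low_proj dotH v Y|.
have X0 : 0 <= X by exact: normr_ge0.
pose ze := finrank (p *m p) phi phi Y; pose ze0 := finrank (p *m p) v v Y.
have zeDA : DA ze by exact: finrank_DA.
have f1 := hCz delta phi phi Y he hphi hphi; rewrite -/ze -/ze0 -/n in f1.
have f2 := hCa delta phi (fun i => A (phi i)) Y he hphi hAphi.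
rewrite -(A_finrank _ _ phiDA) -/ze -/n in f2.
have f3 := hC2 Y; rewrite -/ze0 -/n in f3.
have f4 := hC3 Y; rewrite -/(low_riccati Y) -/n in f4.
have f5 := hC3 (low_proj dotH v Y); rewrite -/(low_riccati _) low_riccati_low -/X in f5.
have f6 := hlow Y; rewrite -low_normE -/X -/ze0 in f6.
have f7 := A_form YDA; rewrite -/X -/n in f7.
set Az0 := finrank _ _ _ _ in f2 f6.
have fz : `|ze| <= (C2 + Cz) * n.
  rewrite -(subrK ze0 ze); apply: (le_trans (ler_normD _ _)).
  have : Cz * delta * n <= Cz * n by rewrite ler_wpM2r// ler_piMr.
  by rewrite mulrDl; lra.
(* [low_riccati] sees only the unstable part, hence [X] instead of [n]; otherwise the cross term
   could not be absorbed through [K]. *)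
have fT : `|TY| <= C3 * X + delta * n.
  by rewrite -(subrK (low_riccati Y) TY); apply: (le_trans (ler_normD _ _)); lra.
have g1 : dotH (A Y) ze <= dotH Y Az0 + n * (Ca * delta * n).
  rewrite (A_sym sA)// -(subrK Az0 (A ze)) dotDr addrC lerD2l.
  by apply: (le_trans (dot_le hH _ _)); rewrite -/n ler_wpM2l.
have g2 : - dotU (bs TY) (bs Y) <= beta ^+ 2 * ((C3 * X + delta * n) * n).
  have := bs_cauchy TY Y; rewrite ler_norml => /andP[h _].
  have : beta ^+ 2 * (`|TY| * `|Y|) <= beta ^+ 2 * ((C3 * X + delta * n) * n).
    by rewrite ler_wpM2l// ler_wpM2r.
  lra.
have g3 : - dotU (bs TY) (bs ze) <= - dotU (bs (low_riccati Y)) (bs ze0)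
    + beta ^+ 2 * (delta * n * ((C2 + Cz) * n)) + beta ^+ 2 * (C3 * n * (Cz * delta * n)).
  have -> : dotU (bs TY) (bs ze) = dotU (bs (low_riccati Y)) (bs ze0)
     + dotU (bs (TY - low_riccati Y)) (bs ze) + dotU (bs (low_riccati Y)) (bs (ze - ze0)).
    by rewrite !bsB !(dotBl, dotBr); ring.
  have := bs_cauchy (TY - low_riccati Y) ze; rewrite ler_norml => /andP[h1 _].
  have := bs_cauchy (low_riccati Y) (ze - ze0); rewrite ler_norml => /andP[h2 _].
  have h3 : beta ^+ 2 * (`|TY - low_riccati Y| * `|ze|) <= beta ^+ 2 * (delta * n * ((C2 +
    Cz) * n)).
    by rewrite ler_wpM2l//; apply: ler_pM.
  have h4 : beta ^+ 2 * (`|low_riccati Y| * `|ze - ze0|) <= beta ^+ 2 * (C3 * n * (Cz *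
    delta * n)).
    by rewrite ler_wpM2l//; apply: ler_pM.
  lra.
have -> : dotH (A Y) (lyapunov_op K phi Y) - dotU (bs TY) (bs (lyapunov_op K phi Y)) =
  dotH (A Y) Y - dotU (bs TY) (bs Y) + K * (dotH (A Y) ze - dotU (bs TY) (bs ze)).
  have -> : bs (lyapunov_op K phi Y) = bs Y + K *: bs ze.
    by rewrite /lyapunov_op addrC (bs_lin hU bsP) addrC.
  by rewrite /lyapunov_op -/ze !dotDr !dotZr; ring.
have g4 : K * (dotH (A Y) ze - dotU (bs TY) (bs ze)) <=
    K * (- c1 * X ^+ 2 + C4 * delta * n ^+ 2).
  rewrite ler_wpM2l//.
  have -> : C4 * delta * n ^+ 2 = n * (Ca * delta * n)
    + beta ^+ 2 * (delta * n * ((C2 + Cz) * n)) + beta ^+ 2 * (C3 * n * (Cz * delta * n)).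
    by rewrite /C4; ring.
  lra.
have Kc : K * c1 = La + gamma + b3 ^+ 2 / (2 * gamma) by rewrite /K divfK// gt_eqF.
have young : b3 * X * n <= gamma / 2 * n ^+ 2 + b3 ^+ 2 / (2 * gamma) * X ^+ 2.
  have -> : gamma / 2 * n ^+ 2 + b3 ^+ 2 / (2 * gamma) * X ^+ 2
    = b3 * X * n + (gamma * n - b3 * X) ^+ 2 / (2 * gamma).
    by field; rewrite gt_eqF.
  by rewrite lerDl divr_ge0 ?sqr_ge0// mulr_ge0// ltW.
have dQn : delta * Q * n ^+ 2 <= gamma / 4 * n ^+ 2 by rewrite ler_wpM2r// sqr_ge0.
have e1 : K * (- c1 * X ^+ 2 + C4 * delta * n ^+ 2) =
  - (La * X ^+ 2 + gamma * X ^+ 2 + b3 ^+ 2 / (2 * gamma) * X ^+ 2)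
  + K * C4 * delta * n ^+ 2.
  have -> : K * (- c1 * X ^+ 2 + C4 * delta * n ^+ 2) =
    - (K * c1) * X ^+ 2 + K * C4 * delta * n ^+ 2 by ring.
  by rewrite Kc; ring.
have e2 : beta ^+ 2 * ((C3 * X + delta * n) * n) = b3 * X * n + beta ^+ 2 * delta * n ^+ 2.
  by rewrite /b3; ring.
have e3 : delta * Q * n ^+ 2 = beta ^+ 2 * delta * n ^+ 2 + K * C4 * delta * n ^+ 2.
  by rewrite /Q; ring.
move: f7 g2 g4 young dQn; rewrite e1 e2 e3.
move: (dotH (A Y) Y) (dotU (bs TY) (bs Y)) (K * _) (b3 * X * n)
  (b3 ^+ 2 / (2 * gamma) * X ^+ 2) (beta ^+ 2 * delta * n ^+ 2) (K * C4 * delta * n ^+ 2).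
move=> *; lra.
Qed.

Lemma lyapunov_op_sym K phi Y Z : dotH (lyapunov_op K phi Y) Z = dotH Y (lyapunov_op K phi Z).
Proof.
rewrite /lyapunov_op dotDl dotDr dotZl dotZr finrank_sym//.
by rewrite trmx_mul pT.
Qed.

Lemma lyapunov_op_ge K phi Y : 0 <= K -> `|Y| ^+ 2 <= dotH (lyapunov_op K phi Y) Y.
Proof.
move=> K0; rewrite /lyapunov_op dotDl dotZl (dot_normE hH) lerDl mulr_ge0// dot_lincomb
  mulmxA rowdotM_sym//.
exact: rowdot_ge0.
Qed.

Lemma lyapunov_op_bound K : 0 <= K -> exists2 C, 0 <= C & forall phi Y,
  (forall i, `|phi i - v i| <= 1) -> `|lyapunov_op K phi Y| <= C * `|Y|.
Proof.
move=> K0; have [C1 C10 h1] := finrank_close (p *m p) v.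
have [C2 C20 h2] := finrank_bound (p *m p) v.
exists (1 + K * (C1 + C2)); first by rewrite addr_ge0// mulr_ge0// addr_ge0.
move=> phi Y hphi; rewrite /lyapunov_op; apply: (le_trans (ler_normD _ _)).
rewrite mulrDl mul1r lerD2l normrZ ger0_norm// -mulrA ler_wpM2l//.
rewrite -(subrK (finrank (p *m p) v v Y) (finrank _ phi phi Y)).
apply: (le_trans (ler_normD _ _)); rewrite mulrDl lerD//.
by have := h1 1 phi phi Y; rewrite ler01 lexx mulr1; exact.
Qed.

End LyapunovEstimates.

(** * The reduced Riccati equation in coordinates *)

(** Polarization at [x + t y] and [x - t y] with [y = x *m N] and [t = r^-1]. It converts the order
    enclosure of the Riccati solution into closeness in norm. *)
Lemma sym_norm_bound (R : realType) d (N : 'M[R]_d) r : N^T = N -> 0 <= r ->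
  (forall x, `|rowdot (x *m N) x| <= r * rowdot x x) ->
  forall x, rowdot (x *m N) (x *m N) <= r ^+ 2 * rowdot x x.
Proof.
move=> sN r0 h x; set y := x *m N.
have key t : 4 * t * rowdot y y <= 2 * r * (rowdot x x + t ^+ 2 * rowdot y y).
  have h1 := h (x + t *: y); have h2 := h (x - t *: y).
  move: h1 h2; rewrite !ler_norml => /andP[_ h1] /andP[h2 _].
  rewrite mulmxDl -scalemxAl -/y in h1; rewrite mulmxBl -scalemxAl -/y in h2.
  move: h1 h2; rewrite !(rowdotDl, rowdotDr, rowdotBl, rowdotBr, rowdotZl, rowdotZr,
    rowdotNl, rowdotNr).
  rewrite (rowdotC y x) (rowdotM_sym y x sN) -/y (rowdotC x y); lra.
have [r1|rn] := eqVneq r 0.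
  by have := key 1; have := rowdot_ge0 x; rewrite r1; lra.
have rp : 0 < r by rewrite lt_neqAle eq_sym rn.
have := key r^-1.
have -> : 4 * r^-1 * rowdot y y = 4 * rowdot y y / r by ring.
have -> : 2 * r * (rowdot x x + r^-1 ^+ 2 * rowdot y y) = (2 * r ^+ 2 * rowdot x x + 2 *
  rowdot y y) / r.
  by field.
rewrite ler_pM2r ?invr_gt0//; lra.
Qed.

Section Transport.
Context (R : realType) (H U : completeNormedModType R).
Context (dotH : {dot H for idfun}) (dotU : {dot U for idfun}).
Hypotheses (hH : hilbert_dot dotH) (hU : hilbert_dot dotU).
Variables (DA : set H) (A : H -> H).
Hypotheses (lA : linear_on DA A) (sA : selfadjoint_op dotH DA A).
Variables (B : U -> H) (bs : H -> U).
Hypothesis bsP : forall w x, dotH (B w) x = dotU w (bs x).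
Variables (d : nat) (u : 'I_d -> H).
Hypotheses (hu : onb dotH u) (uDA : forall i, DA (u i)).

Let D := lin_span (range u).

Definition mx_of_op (T : H -> H) : 'M[R]_d := \matrix_(i, j) dotH (T (u i)) (u j).

(** Vanishes on the orthogonal complement of [D]: the projection of the closed loop is built in. *)
Definition op_of_mx (Q : 'M[R]_d) (x : H) : H := lincomb u (coords dotH u x *m Q).

Lemma range_subspace : vsubspace D. Proof. exact: span_subspace. Qed.

Lemma range_DA x : D x -> DA x.
Proof. by move=> /spanP[a ->]; exact: (vs_lincomb (DA_subspace lA)). Qed.

Lemma linear_lincomb (T : H -> H) a : linear_on D T ->
  T (lincomb u a) = lincomb (fun i => T (u i)) a.
Proof. by move=> lT; rewrite (A_lincomb lT)// => i; exact: span_mem. Qed.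

Lemma op_lincomb_mx (T : H -> H) a : linear_on D T -> (forall x, D x -> D (T x)) ->
  T (lincomb u a) = lincomb u (a *m mx_of_op T).
Proof.
move=> lT TD; rewrite -[LHS](onb_coordsK hu); last by apply: TD; exact: span_lincomb.
by rewrite linear_lincomb// coords_lincomb.
Qed.

Lemma coords_A a : coords dotH u (A (lincomb u a)) = a *m mx_of_op A.
Proof. by rewrite (A_lincomb lA)// coords_lincomb. Qed.

Lemma mx_of_A_sym : (mx_of_op A)^T = mx_of_op A.
Proof. by apply/matrixP => i j; rewrite !mxE (A_sym sA)// (dotC dotH). Qed.

Lemma orth_proj_id x : D x -> orth_proj dotH D x = x.
Proof. by move=> hx; rewrite orth_projE// (onb_coordsK hu). Qed.

Lemma orth_proj_dot x z : D z -> dotH (orth_proj dotH D x) z = dotH x z.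
Proof.
by move=> /spanP[a ->]; rewrite orth_projE// onb_dot// (dotC dotH x) dot_lincomb rowdotC.
Qed.

Lemma orth_proj_mem x : D (orth_proj dotH D x).
Proof. by rewrite orth_projE//; exact: span_lincomb. Qed.

Lemma reduced_AE x : D x -> reduced_A dotH D A x = lincomb u (coords dotH u (A x)).
Proof. by move=> hx; rewrite /reduced_A (orth_proj_id hx) orth_projE. Qed.

Lemma range_ext x y : D x -> D y -> (forall z, D z -> dotH z x = dotH z y) -> x = y.
Proof.
move=> hx hy h; apply/eqP; rewrite -subr_eq0; apply/eqP; apply: (dot_eq0 hH).
have hz : D (x - y) by exact: (vsB range_subspace).
by rewrite dotBr (h _ hz) subrr.
Qed.

Lemma reduced_A_adjE x : D x -> reduced_A_adj dotH D A x = lincomb u (coords dotH u (A x)).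
Proof.
move=> hx; rewrite -reduced_AE//.
have hA : D (reduced_A dotH D A x) by exact: orth_proj_mem.
have good w : D w -> dotH (reduced_A dotH D A w) x = dotH w (reduced_A dotH D A x).
  move=> hw; rewrite /reduced_A (orth_proj_id hw) (orth_proj_id hx) orth_proj_dot// (dotC
    dotH w) orth_proj_dot//.
  by rewrite (A_sym sA) ?(dotC dotH w)//; exact: range_DA.
rewrite /reduced_A_adj /adjoint_on; case: xgetP => [z _ [zD hz]|/(_ _ (conj hA good))//].
by apply: range_ext => // w hw; rewrite -hz// good.
Qed.

(** Against a vector of [D] the projection in [reduced_B] disappears, so the reduced feedback uses
    the full adjoint of [B]. The reduced and the full loop therefore share their feedback terms. *)
Lemma reduced_B_adjE x : D x -> reduced_B_adj dotH dotU D B x = bs x.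
Proof.
move=> hx.
have good w : [set: U] w -> dotH (reduced_B dotH D B w) x = dotU w (bs x).
  by move=> _; rewrite /reduced_B orth_proj_dot// bsP.
rewrite /reduced_B_adj /adjoint_on; case: xgetP => [z _ [_ hz]|/(_ _ (conj I good))//].
apply/eqP; rewrite -subr_eq0; apply/eqP; apply: (dot_eq0 hU).
by rewrite dotBr -hz// -good// subrr.
Qed.

Let M := gram dotU bs u.

Lemma coords_B b : coords dotH u (B (bs (lincomb u b))) = b *m M.
Proof.
apply/rowP => j; rewrite !mxE bsP (bs_lincomb hU bsP) dot_suml.
by apply: eq_bigr => i _; rewrite dotZl mxE.
Qed.

Lemma riccati_matrix (P : H -> H) eps : linear_on D P -> (forall x, D x -> D (P x)) ->
  (forall x, D x -> reduced_A_adj dotH D A (P x) + P (reduced_A dotH D A x)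
    - P (reduced_B dotH D B (reduced_B_adj dotH dotU D B (P x))) + eps *: x = 0) <->
  ric (mx_of_op A) M eps (mx_of_op P) = 0.
Proof.
move=> lP PD.
have eqn a : reduced_A_adj dotH D A (P (lincomb u a)) + P (reduced_A dotH D A (lincomb u a))
    - P (reduced_B dotH D B (reduced_B_adj dotH dotU D B (P (lincomb u a)))) + eps *:
      lincomb u a
    = lincomb u (a *m ric (mx_of_op A) M eps (mx_of_op P)).
  have ea : D (lincomb u a) by exact: span_lincomb.
  rewrite reduced_A_adjE; last exact: PD.
  rewrite reduced_B_adjE; last exact: PD.
  rewrite reduced_AE// /reduced_B orth_projE// !(op_lincomb_mx _ lP PD) !coords_A coords_B.
  rewrite -lincombD -lincombB -lincombZ -lincombD; congr lincomb.
  rewrite /ric !mulmxDr mulmxN !mulmxA mul_mx_scalar; congr (_ - _ + _).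
  by rewrite addrC.
split=> [h|h x /spanP[a ->]]; last by rewrite eqn h mulmx0 lincomb0.
apply/row_matrixP => i; rewrite row0 rowE -[LHS](onb_coords _ hu) -eqn h; last exact:
  span_lincomb.
by apply/rowP => j; rewrite !mxE dot0l.
Qed.

Lemma op_of_mx_linear Q : linear_on D (op_of_mx Q).
Proof.
split; first exact: range_subspace.
by move=> a x y _ _; rewrite /op_of_mx coordsD coordsZ mulmxDl -scalemxAl lincombD lincombZ.
Qed.

Lemma op_of_mx_range Q x : D (op_of_mx Q x). Proof. exact: span_lincomb. Qed.

Lemma op_of_mxK Q : mx_of_op (op_of_mx Q) = Q.
Proof.
apply/matrixP => i j; rewrite mxE /op_of_mx dot_lincomb.
have e k : coords dotH u (u k) = delta_mx 0 k.
  by rewrite -{1}(lincomb_delta u k) onb_coords.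
by rewrite !e rowdot_delta.
Qed.

Lemma dot_mx_of_op (P : H -> H) a b : linear_on D P ->
  dotH (P (lincomb u a)) (lincomb u b) = rowdot (a *m mx_of_op P) b.
Proof. by move=> lP; rewrite (dotC dotH) dot_lincomb linear_lincomb// coords_lincomb
  rowdotC. Qed.

Lemma mx_of_op_sym (P : H -> H) : (forall x y, D x -> D y -> dotH (P x) y = dotH x (P y)) ->
  (mx_of_op P)^T = mx_of_op P.
Proof.
move=> h; apply/matrixP => i j; rewrite !mxE h ?(dotC dotH (u j))//; exact: span_mem.
Qed.

(** Two maximal solutions dominate each other as forms, hence agree on [D] by polarization. This
    transfers the estimates obtained for [Q] to an arbitrary maximal [P]. *)
Lemma reduced_riccati_maximal eps Q : Q^T = Q -> psd Q -> ric (mx_of_op A) M eps Q = 0 ->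
  (forall X, X^T = X -> ric (mx_of_op A) M eps X = 0 -> psd (Q - X)) ->
  maximal_riccati_solution dotH dotU D A B eps (op_of_mx Q) /\
  forall P, maximal_riccati_solution dotH dotU D A B eps P ->
    forall x, D x -> P x = op_of_mx Q x.
Proof.
move=> sQ pQ rQ mQ.
have lQ := op_of_mx_linear Q.
have solQ : riccati_solution dotH dotU D A B eps (op_of_mx Q).
  split; last first.
    by apply/riccati_matrix => //; [move=> x _; exact: op_of_mx_range | rewrite op_of_mxK].
  split => //.
  - by move=> x _; exact: op_of_mx_range.
  - move=> x y /spanP[a ->] /spanP[b ->].
    rewrite dot_mx_of_op// [RHS](dotC dotH) dot_mx_of_op// op_of_mxK rowdotM_sym// rowdotC//.
  - by move=> x /spanP[a ->]; rewrite dot_mx_of_op// op_of_mxK; exact: pQ.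
have cmp P : riccati_solution dotH dotU D A B eps P -> psd (Q - mx_of_op P).
  move=> [[lP PD sP _] eP]; apply: mQ; first exact: mx_of_op_sym.
  exact/riccati_matrix.
split.
  split=> // P hP x /spanP[a ->].
  have lP : linear_on D P by case: hP => -[].
  have := cmp P hP a; rewrite !dot_mx_of_op// op_of_mxK mulmxBr rowdotBl; lra.
move=> P [solP maxP] x /spanP[a ->].
have [[lP PD sP _] eP] := solP.
suff e : mx_of_op P = Q by rewrite op_lincomb_mx// e /op_of_mx onb_coords.
apply/eqP; rewrite eq_sym -subr_eq0; apply/eqP; apply: sym_form_eq0.
  by rewrite linearB /= sQ mx_of_op_sym.
move=> b; have h1 := cmp P solP b.
have := maxP _ solQ (lincomb u b) (span_lincomb _ _).
rewrite !dot_mx_of_op// op_of_mxK => h2.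
by apply/eqP; rewrite eq_le h1 andbT mulmxBr rowdotBl subr_le0.
Qed.

Lemma ric_formE eps Q a : Q^T = Q -> rowdot (a *m ric (mx_of_op A) M eps Q) a =
  2 * dotH (A (lincomb u a)) (lincomb u (a *m Q))
  - dotU (bs (lincomb u (a *m Q))) (bs (lincomb u (a *m Q))) + eps * rowdot a a.
Proof.
move=> sQ; rewrite (gramE hU bsP) -/M.
have -> : dotH (A (lincomb u a)) (lincomb u (a *m Q)) = rowdot (a *m mx_of_op A) (a *m Q).
  by rewrite (dotC dotH) dot_lincomb coords_A rowdotC.
rewrite /ric !mulmxDr mulmxN !mulmxA mul_mx_scalar !(rowdotDl, rowdotNl, rowdotZl).
rewrite (rowdotM_sym (a *m mx_of_op A) _ sQ) (rowdotM_sym (a *m Q *m M) _ sQ).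
by rewrite (rowdotM_sym (a *m Q) _ mx_of_A_sym) (rowdotC (a *m Q) (a *m _)); ring.
Qed.

End Transport.

(** * Mild solutions *)

Section MildSolutions.
Context (R : realType) (H : completeNormedModType R) (dot : {dot H for idfun}).
Hypothesis hH : hilbert_dot dot.

Lemma is_derive1P (V : normedModType R) (f : R -> V) (a : R) (df : V) :
  is_derive a 1 f df <-> (fun h => h^-1 *: (f (h + a) - f a)) @ 0^' --> df.
Proof.
have e : (fun h => h^-1 *: ((f \o shift a) (h *: 1) - f a)) =
    (fun h => h^-1 *: (f (h + a) - f a)).
  by apply/funext => h /=; rewrite /shift /= [h *: 1]mulr1.
split=> [[h1 h2]|h].
  by move: h1 h2; rewrite /derivable /derive e => h1 <-.
split; first by rewrite /derivable e; apply/cvg_ex; exists df.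
by rewrite /derive e; exact/cvg_lim.
Qed.

Lemma derive1_cvg (V : normedModType R) (f : R -> V) (a : R) (df : V) :
  is_derive a 1 f df -> (fun h => f (h + a)) @ 0^' --> f a.
Proof.
move=> /is_derive1P h.
have h2 : (fun h => h *: (h^-1 *: (f (h + a) - f a)) + f a) @ 0^' --> 0 *: df + f a.
  apply: cvgD; last exact: cvg_cst.
  by apply: cvgZ => //; exact: nbhs_dnbhs.
rewrite scale0r add0r in h2; apply: cvg_trans h2; apply: near_eq_cvg.
apply: filterS (nbhs_dnbhs_neq (0 : R)) => x x0.
by rewrite scalerA mulfV// scale1r subrK.
Qed.

(** By symmetry of [V], the difference quotient is a single pairing of [V (f (h + a) + f a)] with
    the quotient of [f]. *)
Lemma quadratic_derive (V : H -> H) (C : R) (f : R -> H) (a : R) (df : H) :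
  (forall x y, V (x + y) = V x + V y) -> (forall x y, V (x - y) = V x - V y) ->
  (forall x, `|V x| <= C * `|x|) -> (forall x y, dot (V x) y = dot x (V y)) ->
  is_derive a 1 f df ->
  is_derive a 1 (fun t => dot (V (f t)) (f t)) (2 * dot (V (f a)) df).
Proof.
move=> VD VB Vb Vs hf; apply/is_derive1P.
have e h : h^-1 *: (dot (V (f (h + a))) (f (h + a)) - dot (V (f a)) (f a)) =
    dot (V (f (h + a) + f a)) (h^-1 *: (f (h + a) - f a)).
  rewrite dotZr; congr (_ * _); rewrite VD dotDl !dotBr (Vs (f a) (f (h + a))) (dotC dot (f a)).
  by ring.
under eq_fun do rewrite e.
have -> : 2 * dot (V (f a)) df = dot (V (f a + f a)) df by rewrite VD dotDl; ring.
apply: (cvg_dot hH); last exact/is_derive1P.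
have h1 : (fun h => f (h + a) + f a) @ 0^' --> f a + f a.
  by apply: cvgD; [exact: derive1_cvg hf | exact: cvg_cst].
by apply: (cvg_lipschitz _ h1) => h; rewrite -VB.
Qed.

Variables (DA : set H) (G V : H -> H) (C c : R).
Hypotheses (lG : linear_on DA G)
  (VD : forall x y, V (x + y) = V x + V y) (VB : forall x y, V (x - y) = V x - V y)
  (Vb : forall x, `|V x| <= C * `|x|) (Vs : forall x y, dot (V x) y = dot x (V y))
  (V1 : forall x, `|x| ^+ 2 <= dot (V x) x)
  (c0 : 0 < c) (C0 : 0 < C) (decr : forall x, DA x -> dot (G x) (V x) <= - c * `|x| ^+ 2).

Let q x := dot (V x) x.
(** The derivative of [q] along a strong solution is at most [- 2 c |x|^2], hence at most [- k]
    times [q]. *)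
Let k := 2 * (c / C).

Lemma rate_gt0 : 0 < k. Proof. by rewrite mulr_gt0// divr_gt0. Qed.

Lemma lyapunov_le_norm x : q x <= C * `|x| ^+ 2.
Proof.
apply: (le_trans (dot_le hH _ _)).
by rewrite expr2 mulrA ler_wpM2r.
Qed.

Lemma strong_decay (w : R -> H) (a b : R) :
  (forall t : R, 0 < t -> DA (w t)) -> (forall t : R, 0 < t -> is_derive t 1 w (G (w t))) ->
  0 < a -> a <= b -> q (w b) * expR (k * b) <= q (w a) * expR (k * a).
Proof.
move=> wD dw a0 ab.
pose f t := q (w t) * expR (k * t).
have df (t : R) : 0 < t -> is_derive t 1 f
    (q (w t) *: (expR (k * t) * k) + expR (k * t) *: (2 * dot (V (w t)) (G (w t)))).
  move=> t0.
  have h1 : is_derive t 1 (fun t => q (w t)) (2 * dot (V (w t)) (G (w t))).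
    exact: (quadratic_derive VD VB Vb Vs (dw t t0)).
  have h2 : is_derive t 1 (fun t => expR (k * t)) (expR (k * t) * k).
    have h3 : is_derive t (1 : R) (fun t => k * t) k.
      have := @is_deriveZ R R R id k t 1 1 (is_derive_id _ _).
      by rewrite /= [k *: 1]mulr1; apply.
    exact: (is_derive1_comp (f := expR) (g := fun t => k * t)).
  exact: (is_deriveM h1 h2).
apply: (@ler0_derive1_le_cc R f a b).
- move=> t; rewrite in_itv /= => /andP[h _].
  by have [] := df t (lt_trans a0 h).
- move=> t; rewrite in_itv /= => /andP[h _]; have t0 := lt_trans a0 h.
  have [_] := df t t0; rewrite derive1E => ->.
  have -> : q (w t) *: (expR (k * t) * k) + expR (k * t) *: (2 * dot (V (w t)) (G (w t)))
    = expR (k * t) * (k * q (w t) + 2 * dot (V (w t)) (G (w t))).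
    by rewrite /GRing.scale /=; ring.
  rewrite pmulr_rle0 ?expR_gt0//.
  have h1 := decr (wD t t0); rewrite (dotC dot) in h1.
  have h2 : k * q (w t) <= 2 * (c * `|w t| ^+ 2).
    rewrite /k -!mulrA ler_wpM2l// ler_wpM2l ?(ltW c0)//.
    by rewrite ler_pdivrMl//; exact: lyapunov_le_norm.
  lra.
- apply: derivable_within_continuous => t; rewrite in_itv /= => /andP[h _].
  by have [] := df t (lt_le_trans a0 h).
- by rewrite in_itv /= lexx ab.
- by rewrite in_itv /= lexx ab.
- exact: ab.
Qed.

Lemma lyapunov_cvg (T : Type) (F : set_system T) {FF : Filter F} (f : T -> H) x :
  f @ F --> x -> (fun t => q (f t)) @ F --> q x.
Proof.
move=> hf; apply: (cvg_dot hH) => //.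
by apply: (cvg_lipschitz _ hf) => t; rewrite -VB.
Qed.

(* The difference quotients of the primitive [Y] of a mild solution are strong solutions,
   to which the Lyapunov function applies; they converge to the mild solution. *)
Theorem lyapunov_stable : exponentially_stable DA G.
Proof.
exists (Num.sqrt C), (k / 2); split; first by rewrite divr_gt0// rate_gt0.
move=> y [ycont [Y [_ _ dY Yeq]]].
have range_subspace := DA_subspace lG.
have mid (a b : R) : 0 < a -> a <= b -> q (y b) * expR (k * b) <= q (y a) * expR (k * a).
  move=> a0 ab.
  have quot (t : R) : 0 < t -> (fun h => h^-1 *: (Y (h + t) - Y t)) @ 0^'+ --> y t.
    by move=> t0; apply: cvg_dnbhs_at_right; apply/is_derive1P; exact: dY.
  have lim (t : R) : 0 < t -> (fun h => q (h^-1 *: (Y (h + t) - Y t)) * expR (k * t)) @ 0^'+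
      --> q (y t) * expR (k * t).
    by move=> t0; apply: cvgM; [apply: lyapunov_cvg; exact: quot | exact: cvg_cst].
  apply: (ler_cvg_to (lim b (lt_le_trans a0 ab)) (lim a a0)).
  apply: filterS (nbhs_right_gt (0 : R)) => h h0.
  have ht (t : R) : 0 < t -> 0 < h + t by move=> t0; rewrite addr_gt0.
  apply: (@strong_decay (fun t => h^-1 *: (Y (h + t) - Y t))) => //.
    move=> t t0; apply: (vsZ range_subspace); apply: (vsB range_subspace).
      by have [] := Yeq _ (ltW (ht t t0)).
    by have [] := Yeq _ (ltW t0).
  move=> t t0.
  have [D1 e1] := Yeq _ (ltW (ht t t0)); have [D2 e2] := Yeq _ (ltW t0).
  have -> : G (h^-1 *: (Y (h + t) - Y t)) = h^-1 *: (y (h + t) - y t).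
    rewrite (A_Z lG); last exact: (vsB range_subspace).
    by rewrite (A_B lG)// e1 e2 opprD addrACA subrr add0r.
  apply/is_derive1P.
  have q1 := (is_derive1P Y (h + t) _).1 (dY _ (ht t t0)).
  have q2 := (is_derive1P Y t _).1 (dY _ t0).
  have : (fun s => h^-1 *: (s^-1 *: (Y (s + (h + t)) - Y (h + t))
      - s^-1 *: (Y (s + t) - Y t))) @ 0^' --> h^-1 *: (y (h + t) - y t).
    by apply: cvgZl_tmp; apply: cvgB.
  apply: cvg_trans; apply: near_eq_cvg; apply: nearW => s.
  rewrite -!scalerBr !scalerA (mulrC h^-1) (addrCA s h t); congr (_ *: _).
  by rewrite !opprB addrACA [RHS]addrACA (addrC (- Y (h + t))).
(* Differentiability is known at positive times only, so time 0 is reached by right continuity. *)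
have start (b : R) : 0 < b -> q (y b) * expR (k * b) <= q (y 0).
  move=> b0.
  have c1 : y x @[x --> 0^'+] --> y 0 by have [] := (continuous_within_itvcyP 0 y).1 ycont.
  have c2 : (fun t => q (y t) * expR (k * t)) @ 0^'+ --> q (y 0) * expR (k * 0).
    apply: cvgM; first exact: lyapunov_cvg.
    apply: continuous_cvg; first exact: continuous_expR.
    by apply: cvgMl_tmp; apply: cvg_at_right_filter; exact: cvg_id.
  rewrite mulr0 expR0 mulr1 in c2.
  apply: (ler_cvg_to (cvg_cst (q (y b) * expR (k * b))) c2).
  near=> t; apply: mid.
    by near: t; exact: nbhs_right_gt.
  by near: t; exact: nbhs_right_le.
have all (t : R) : 0 <= t -> q (y t) * expR (k * t) <= q (y 0).
  rewrite le_eqVlt => /predU1P[<-|]; last exact: start.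
  by rewrite mulr0 expR0 mulr1.
move=> t t0.
have ek : 0 < expR (k * t) by exact: expR_gt0.
have h1 : `|y t| ^+ 2 * expR (k * t) <= C * `|y 0| ^+ 2.
  apply: le_trans (lyapunov_le_norm (y 0)); apply: le_trans (all t t0).
  by rewrite ler_pM2r//; exact: V1.
rewrite -(@ler_pXn2r _ 2)// ?nnegrE ?mulr_ge0 ?sqrtr_ge0 ?expR_ge0//.
rewrite !exprMn sqr_sqrtr ?(ltW C0)// -expRM_natl.
have -> : expR (2%:R * (- (k / 2) * t)) = (expR (k * t))^-1.
  by rewrite -expRN; congr expR; field.
by rewrite mulrAC ler_pdivlMr.
Unshelve. all: by end_near. Qed.

End MildSolutions.

(** * The reduced Riccati solution is close to the low-dimensional one *)

Section RiccatiClose.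
Context (R : realType) (H U : completeNormedModType R).
Context (dotH : {dot H for idfun}) (dotU : {dot U for idfun}).
Hypotheses (hH : hilbert_dot dotH) (hU : hilbert_dot dotU).
Variables (DA : set H) (A : H -> H).
Hypotheses (lA : linear_on DA A) (sA : selfadjoint_op dotH DA A).
Variables (l : nat) (v : 'I_l -> H) (lam : 'I_l -> R).
Hypotheses (hv : onb dotH v) (vDA : forall i, DA (v i))
  (Av : forall i, A (v i) = lam i *: v i).
Variables (B : U -> H) (bs : H -> U) (beta : R).
Hypotheses (bsP : forall w x, dotH (B w) x = dotU w (bs x))
  (bs_bound : forall x, `|bs x| <= beta * `|x|) (beta0 : 0 <= beta).
Variable p : 'M[R]_l.
Let Lam := diag_mx (\row_i lam i).
Hypotheses (pT : p^T = p)
  (pric : p *m Lam + Lam *m p = p *m gram dotU bs v *m p).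
Variables (K c delta : R).
Hypotheses (K0 : 0 <= K) (c0 : 0 < c) (d01 : 0 < delta <= 1).
Hypothesis lyap : forall phi Y TY, (forall i, DA (phi i)) ->
  (forall i, `|phi i - v i| <= delta) ->
  (forall i, `|A (phi i) - A (v i)| <= delta) -> DA Y ->
  `|TY - low_riccati dotH v p Y| <= delta * `|Y| ->
  dotH (A Y) (lyapunov_op dotH p K phi Y) - dotU (bs TY) (bs (lyapunov_op dotH p K phi Y))
    <= - c * `|Y| ^+ 2.

(* With [W] the lifted low-dimensional solution and [V] the Lyapunov function,
   [W - s V] and [W + s V] are a subsolution and a supersolution. *)
Theorem riccati_close : exists eps0 eta0, [/\ 0 < eps0, 0 < eta0 &
  forall d (u : 'I_d -> H) (phi : 'I_l -> H) eps,
  onb dotH u -> (forall i, DA (u i)) -> (forall i, lin_span (range u) (phi i)) ->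
  (forall i, `|phi i - v i| <= eta0) -> (forall i, `|A (phi i) - A (v i)| <= eta0) ->
  0 <= eps <= eps0 ->
  exists Q, [/\ Q^T = Q, psd Q, ric (mx_of_op dotH u A) (gram dotU bs u) eps Q = 0,
    forall X, X^T = X -> ric (mx_of_op dotH u A) (gram dotU bs u) eps X = 0 -> psd (Q - X) &
    forall Y, `|op_of_mx dotH u Q Y - low_riccati dotH v p Y| <= delta * `|Y|]].
Proof.
have /andP[d0 d1] := d01.
have [CV CV0 hCV] := lyapunov_op_bound hH hv p K0.
pose C := CV + 1; have C0 : 0 < C by rewrite ltr_wpDl.
have [Cw Cw0 hCw] := finrank_close hH hv p v.
have [Cr Cr0 hCr] := ric_estimate hH hU lA sA hv Av bsP bs_bound beta0 pT pric.
pose b2 := beta ^+ 2 * C ^+ 2.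
have b20 : 0 <= b2 by rewrite mulr_ge0 ?sqr_ge0.
(* [s * C <= delta / 2] keeps the whole interval near [W], and [s * b2 <= c] absorbs the term
   quadratic in [s] of the subsolution inequality. *)
pose s := Num.min (delta / (2 * C)) (c / (b2 + 1)).
have s0 : 0 < s by rewrite lt_min !divr_gt0// ?mulr_gt0// ltr_wpDl.
have sC : s * C <= delta / 2.
  have : s <= delta / (2 * C) by rewrite ge_min lexx.
  rewrite ler_pdivlMr ?mulr_gt0// => h; lra.
have sb : s * b2 <= c.
  have : s <= c / (b2 + 1) by rewrite ge_min lexx orbT.
  rewrite ler_pdivlMr ?ltr_wpDl// => h; lra.
have sc0 : 0 < s * c by rewrite mulr_gt0.
(* Besides [eta0 <= delta]: [Cw * eta0] is the other half of [delta], for the distance of [W] to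
   [low_riccati], and [Cr * eta0 <= s * c / 2] bounds the Riccati residual of [W]. *)
pose eta0 := Num.min delta (Num.min (delta / (2 * (Cw + 1))) (s * c / (2 * (Cr + 1)))).
have eta00 : 0 < eta0.
  by rewrite !lt_min d0 !divr_gt0// mulr_gt0// ltr_wpDl.
have etad : eta0 <= delta by rewrite ge_min lexx.
have etaw : Cw * eta0 <= delta / 2.
  have : eta0 <= delta / (2 * (Cw + 1)) by rewrite !ge_min lexx ?orbT.
  rewrite ler_pdivlMr ?mulr_gt0 ?ltr_wpDl// => h; lra.
have etar : Cr * eta0 <= s * c / 2.
  have : eta0 <= s * c / (2 * (Cr + 1)) by rewrite !ge_min lexx ?orbT.
  rewrite ler_pdivlMr ?mulr_gt0 ?ltr_wpDl// => h; lra.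
(* The decay of [V] gains [2 * s * c] in both inequalities. The residual of [W] costs [s * c / 2],
   and in the supersolution [eps] may cost as much again. *)
exists (s * c / 2), eta0; split=> //; first by rewrite divr_gt0.
move=> d u phi eps hu uDA phiD hphi hAphi /andP[eps0 epss].
have he : 0 <= eta0 <= 1 by rewrite (ltW eta00) (le_trans etad).
have phiDA i : DA (phi i) by exact: (range_DA lA uDA (phiD i)).
have phid i : `|phi i - v i| <= delta by exact: le_trans (hphi i) etad.
have Aphid i : `|A (phi i) - A (v i)| <= delta by exact: le_trans (hAphi i) etad.
have phi1 i : `|phi i - v i| <= 1 by exact: le_trans (phid i) d1.
pose W := finrank dotH p phi phi; pose V := lyapunov_op dotH p K phi.
set D := lin_span (range u) in phiD.
have Dvs : vsubspace D by exact: span_subspace.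
have frlin N : linear_on D (finrank dotH N phi phi).
  split => // a x y _ _; by rewrite /finrank coordsD coordsZ mulmxDl -scalemxAl lincombD
    lincombZ.
have frD N x : D (finrank dotH N phi phi x) by exact: (vs_lincomb Dvs).
have lW : linear_on D W by exact: frlin.
have WD x : D x -> D (W x) by move=> _; exact: frD.
have lV : linear_on D V.
  split => // a x y hx hy; rewrite /V /lyapunov_op; have [_ ->] := frlin (p *m p) => //.
  by rewrite !scalerDr !scalerA addrACA (mulrC K).
have VD x : D x -> D (V x).
  by move=> hx; apply: (vsD Dvs) => //; exact: (vsZ Dvs).
pose Am := mx_of_op dotH u A; pose M := gram dotU bs u.
pose Wm := mx_of_op dotH u W; pose Vm := mx_of_op dotH u V.
have WmT : Wm^T = Wm.
  by apply: mx_of_op_sym => x y _ _; exact: finrank_sym.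
have VmT : Vm^T = Vm.
  by apply: mx_of_op_sym => x y _ _; exact: lyapunov_op_sym.
have AmT : Am^T = Am by exact: mx_of_A_sym.
have MT : M^T = M by exact: gram_sym.
have nE a : `|lincomb u a| ^+ 2 = rowdot a a by rewrite -(dot_normE hH) onb_dot.
have WE a : lincomb u (a *m Wm) = W (lincomb u a) by rewrite -op_lincomb_mx.
have VE a : lincomb u (a *m Vm) = V (lincomb u a) by rewrite -op_lincomb_mx.
have Vge a : rowdot a a <= rowdot (a *m Vm) a.
  by rewrite -dot_mx_of_op// -nE; exact: lyapunov_op_ge.
have Vle a : rowdot (a *m Vm) a <= C * rowdot a a.
  rewrite -dot_mx_of_op// -nE; apply: (le_trans (dot_le hH _ _)).
  rewrite expr2 mulrA ler_wpM2r//; apply: (le_trans (hCV phi _ phi1)).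
  by rewrite ler_wpM2r// lerDl.
pose Zm := Wm - s *: Vm; pose Zp := Wm + s *: Vm.
have sVT : (s *: Vm)^T = s *: Vm by rewrite linearZ /= VmT.
have ZmT : Zm^T = Zm by rewrite /Zm linearB /= WmT sVT.
have ZpT : Zp^T = Zp by rewrite /Zp linearD /= WmT sVT.
have eZm b : rowdot (b *m Zm) b = rowdot (b *m Wm) b - s * rowdot (b *m Vm) b.
  by rewrite mulmxBr -scalemxAr rowdotBl rowdotZl.
have eZp b : rowdot (b *m Zp) b = rowdot (b *m Wm) b + s * rowdot (b *m Vm) b.
  by rewrite mulmxDr -scalemxAr rowdotDl rowdotZl.
have close Q : between Zm Zp Q -> forall Y,
    `|op_of_mx dotH u Q Y - low_riccati dotH v p Y| <= delta * `|Y|.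
  move=> [QT Q1 Q2] Y; pose a := coords dotH u Y.
  have bnd b : `|rowdot (b *m (Q - Wm)) b| <= s * C * rowdot b b.
    have := Q1 b; have := Q2 b; have := ler_wpM2l (ltW s0) (Vle b).
    rewrite (mulmxBr b Zp Q) (mulmxBr b Q Zm) (mulmxBr b Q Wm) !rowdotBl eZm eZp.
    by rewrite ler_norml => h1 h2 h3; apply/andP; split; lra.
  have QWT : (Q - Wm)^T = Q - Wm by rewrite linearB /= QT WmT.
  have h1 := sym_norm_bound QWT (mulr_ge0 (ltW s0) (ltW C0)) bnd a.
  (* Since the [phi i] lie in [D], [W] ignores the component of [Y] orthogonal to [D], so closeness
     is obtained on all of H and not only on [D]. *)
  have WY : W Y = lincomb u (a *m Wm).
    rewrite WE /W /finrank; congr (lincomb phi (_ *m _)); apply/rowP => i; rewrite !mxE.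
    by have /spanP[b ->] := phiD i; rewrite onb_dot// (dotC dotH Y) dot_lincomb rowdotC.
  have h2 : `|op_of_mx dotH u Q Y - W Y| <= s * C * `|Y|.
    rewrite WY /op_of_mx -/a -lincombB -mulmxBr.
    rewrite -(@ler_pXn2r _ 2)// ?nnegrE ?mulr_ge0 ?(ltW s0) ?(ltW C0)//.
    rewrite nE exprMn; apply: (le_trans h1); rewrite ler_wpM2l ?sqr_ge0//.
    exact: bessel.
  have h3 := hCw eta0 phi phi Y he hphi hphi.
  rewrite -(subrK (W Y) (op_of_mx _ _ _ _)) -addrA; apply: (le_trans (ler_normD _ _)).
  have h4 : Cw * eta0 * `|Y| <= delta / 2 * `|Y| by rewrite ler_wpM2r.
  have h5 : s * C * `|Y| <= delta / 2 * `|Y| by rewrite ler_wpM2r.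
  by move: h2 h3; rewrite -/(low_riccati dotH v p Y) -/(W Y); lra.
have closea Q a : between Zm Zp Q ->
    `|lincomb u (a *m Q) - low_riccati dotH v p (lincomb u a)| <= delta * `|lincomb u a|.
  by move=> bQ; have := close Q bQ (lincomb u a); rewrite /op_of_mx onb_coords.
have DAev a : DA (lincomb u a) by exact: (vs_lincomb (DA_subspace lA)).
(* [V] maps [D] into itself, so pairing with [V Y] does not distinguish [A] from its compression to
   [D]. *)
have cert Q : between Zm Zp Q -> lyap_cert Vm (closed_loop_mx Am M Q) c.
  move=> bQ a; rewrite -nE /closed_loop_mx mulmxBr rowdotBl mulmxA.
  have := lyap phiDA phid Aphid (DAev a) (closea Q a bQ).
  rewrite -/(V _) -VE (gramE hU bsP) -/M.
  by rewrite -[dotH (A _) _](dotC dotH) dot_lincomb (coords_A dotH lA uDA) rowdotC.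
have bW : between Zm Zp Wm.
  split => // a.
    rewrite /Zm opprB addrC subrK -scalemxAr rowdotZl.
    by rewrite mulr_ge0 ?(ltW s0)// (le_trans (rowdot_ge0 a)).
  rewrite /Zp addrC addKr -scalemxAr rowdotZl.
  by rewrite mulr_ge0 ?(ltW s0)// (le_trans (rowdot_ge0 a)).
have est a : [/\ `|2 * dotH (A (lincomb u a)) (W (lincomb u a))
      - dotU (bs (W (lincomb u a))) (bs (W (lincomb u a)))| <= s * c / 2 * rowdot a a,
    dotH (A (lincomb u a)) (V (lincomb u a)) - dotU (bs (W (lincomb u a))) (bs (V (lincomb
      u a)))
      <= - c * rowdot a a,
    dotU (bs (V (lincomb u a))) (bs (V (lincomb u a))) <= b2 * rowdot a a &
    0 <= dotU (bs (V (lincomb u a))) (bs (V (lincomb u a)))].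
  split.
  - apply: (le_trans (hCr eta0 phi (lincomb u a) he phiDA hphi hAphi (DAev a))).
    by rewrite nE ler_wpM2r// rowdot_ge0.
  - rewrite -nE; apply: lyap => //; rewrite -WE; exact: closea.
  - have := bs_cauchy hU bs_bound (V (lincomb u a)) (V (lincomb u a)).
    rewrite ler_norml => /andP[_ h]; apply: (le_trans h).
    rewrite /b2 -mulrA ler_wpM2l ?sqr_ge0// -nE -exprMn -expr2.
    rewrite ler_pXn2r ?nnegrE ?mulr_ge0 ?(ltW C0)//.
    by apply: (le_trans (hCV phi _ phi1)); rewrite ler_wpM2r// lerDl.
  - exact: dot_ge0.
have ricZm : psd (ric Am M eps Zm).
  move=> a; rewrite (ric_formE hU lA sA bsP uDA)//.
  have -> : lincomb u (a *m Zm) = W (lincomb u a) - s *: V (lincomb u a).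
    by rewrite mulmxBr lincombB -scalemxAr lincombZ WE VE.
  have [e1 e2 e3 _] := est a.
  have -> : bs (W (lincomb u a) - s *: V (lincomb u a)) = bs (W (lincomb u a)) - s *: bs (V
    (lincomb u a)).
    by rewrite addrC -scaleNr (bs_lin hU bsP) scaleNr addrC.
  rewrite !(dotBl, dotBr, dotZl, dotZr) (dotC dotU (bs (V _)) (bs (W _))).
  move: e1 e2 e3; rewrite ler_norml => /andP[e1 _] e2 e3.
  have e4 := ler_wpM2l (ltW s0) e2.
  have e5 := ler_wpM2l (ltW s0) (ler_wpM2l (ltW s0) e3).
  have e6 : s * (s * (b2 * rowdot a a)) <= s * c * rowdot a a.
    by rewrite -mulrA ler_wpM2l ?(ltW s0)// mulrA ler_wpM2r ?rowdot_ge0.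
  have e7 : 0 <= eps * rowdot a a by rewrite mulr_ge0 ?rowdot_ge0.
  have e8 : 0 <= s * c * rowdot a a by rewrite mulr_ge0 ?rowdot_ge0// ltW.
  lra.
have ricZp : psd (- ric Am M eps Zp).
  move=> a; rewrite mulmxN rowdotNl (ric_formE hU lA sA bsP uDA)//.
  have -> : lincomb u (a *m Zp) = W (lincomb u a) + s *: V (lincomb u a).
    by rewrite mulmxDr lincombD -scalemxAr lincombZ WE VE.
  have [e1 e2 _ e3] := est a.
  have -> : bs (W (lincomb u a) + s *: V (lincomb u a)) = bs (W (lincomb u a)) + s *: bs (V
    (lincomb u a)).
    by rewrite addrC (bs_lin hU bsP) addrC.
  have dHs x w z : dotH x (w + s *: z) = dotH x w + s * dotH x z by rewrite dotDr dotZr.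
  have dUs w z : dotU (w + s *: z) (w + s *: z) =
      dotU w w + 2 * (s * dotU w z) + s * (s * dotU z z).
    by rewrite !(dotDl, dotDr, dotZl, dotZr) (dotC dotU z w); ring.
  rewrite dHs dUs.
  move: e1 e2; rewrite ler_norml => /andP[_ e1] e2.
  have e4 := ler_wpM2l (ltW s0) e2.
  have e5 := mulr_ge0 (ltW s0) (mulr_ge0 (ltW s0) e3).
  have e7 : eps * rowdot a a <= s * c / 2 * rowdot a a by rewrite ler_wpM2r ?rowdot_ge0.
  have e8 : 0 <= s * c * rowdot a a by rewrite mulr_ge0 ?rowdot_ge0// ltW.
  lra.
have psdM : psd M.
  by move=> a; rewrite -(gramE hU bsP); exact: dot_ge0.
have leZ : psd (Zp - Zm).
  have -> : Zp - Zm = (2 * s) *: Vm.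
    by apply/matrixP => i j; rewrite !mxE; ring.
  move=> a; rewrite -scalemxAr rowdotZl mulr_ge0 ?mulr_ge0 ?(ltW s0)//.
  exact: le_trans (rowdot_ge0 a) (Vge a).
have [Q bQ rQ] := riccati_exists AmT MT psdM VmT Vge c0 ZmT ZpT leZ ricZm ricZp cert.
exists Q; split => //.
- by case: bQ.
- exact: (riccati_psd AmT MT psdM VmT Vge c0 cert eps0 bQ rQ).
- by move=> X XT rX; exact: (riccati_maximal AmT MT psdM VmT Vge c0 cert bQ rQ XT rX).
- exact: close.
Qed.

End RiccatiClose.

(** * Stability of the full closed loop *)

Theorem theorem1 (R : realType) (H U : completeNormedModType R)
  (dotH : {dot H for idfun}) (dotU : {dot U for idfun})
  (hH : hilbert_dot dotH) (hU : hilbert_dot dotU)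
  (DA : set H) (A : H -> H) (alpha : R) (S : R -> H -> H)
  (A_linear : linear_on DA A)
  (A_dense : dense DA)
  (A_closed : closed_op DA A)
  (A_selfadjoint : selfadjoint_op dotH DA A)
  (A_dissipative : dissipative_op dotH DA (fun x => A x - alpha *: x))
  (S_semigroup : c0_semigroup S)
  (S_generated : generated_by S DA A)
  (B : {linear U -> H}) (B_continuous : continuous B)
  (T : R) (T_gt0 : 0 < T) (y0 : H) (y0_DA : DA y0)
  (l : nat) (E F : set H)
  (* (i) *)
  (E_dim : has_dim E l) (E_DA : E `<=` DA)
  (F_subspace : vsubspace F) (F_closed : closed F)
  (F_dense : F `<=` closure (F `&` DA))
  (EF : orthogonal_decomposition dotH E F)
  (A_E : forall x, E x -> E (A x))
  (A_F : forall x, F x -> DA x -> F (A x))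
  (* (ii) *)
  (S_decay : exists2 gamma : R, 0 < gamma &
     forall (t : R) (z : H), 0 <= t ->
       let z' := z - orth_proj dotH E z in
       `|S t z' - orth_proj dotH E (S t z')| <= expR (- gamma * t) * `|z'|)
  (* (iii) *)
  (A_spectrum : let A1 := fun x => orth_proj dotH E (A (orth_proj dotH E x)) in
     forall lam : R, eigenvalue_on E A1 lam ->
       has_dim (eigenspace_on E A1 lam) 1 /\ 0 < lam)
  (* (iv) *)
  (B_rank : kalman_rank dotH E A (range B) l)
  (* (v) *)
  (y0_rank : kalman_rank dotH E A [set y0] l)
  (m : nat) (l_le_m : (l <= m)%N)
  (* [Dbar n] is a choice of POD subspace, for every [n] with [m <= d_n] *)
  (Dbar : nat -> set H)
  (Dbar_pod : forall n : nat, (0 < n)%N ->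
     dim_ge (snapshot_span (snapshot S T y0) n) m ->
     pod_subspace dotH (snapshot S T y0) n m (Dbar n)) :
  exists (eps0 : R) (n0 : nat), 0 < eps0 /\
    forall (eps : R) (n : nat), 0 <= eps <= eps0 -> (0 < n)%N -> (n0 <= n)%N ->
      dim_ge (snapshot_span (snapshot S T y0) n) m ->
      (exists P : H -> H,
         maximal_riccati_solution dotH dotU (Dbar n) A B eps P) /\
      (forall P : H -> H,
         maximal_riccati_solution dotH dotU (Dbar n) A B eps P ->
         exponentially_stable DA
           (closed_loop dotH (Dbar n) A B
              (riccati_feedback dotH dotU (Dbar n) B P))).
Proof.
have [Cb hCb] : exists C, forall x, `|B x| <= C * `|x|.
  have : bounded_near B (nbhs 0) by apply: continuous_linear_bounded; exact: B_continuous.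
  by move=> /linear_boundedP [C [_ hC]]; exists (C + 1); apply: hC; rewrite ltrDl.
pose beta := `|Cb|.
have beta0 : 0 <= beta by exact: normr_ge0.
have B_bound x : `|B x| <= beta * `|x|.
  by apply: (le_trans (hCb x)); rewrite ler_wpM2r// ler_norm.
have [bs bsP] : exists g : H -> U, forall x y, dotH (B x) y = dotU x (g y).
  by apply: (adjoint_exists hU hH) B_bound => a x y; rewrite linearP.
have bs_bound x : `|bs x| <= beta * `|x|.
  have [->|nz] := eqVneq (bs x) 0; first by rewrite normr0 mulr_ge0.
  have bx : 0 < `|bs x| by rewrite normr_gt0.
  rewrite -(ler_pM2l bx) -expr2 -(dot_normE hU) -bsP.
  apply: (le_trans (dot_le hH _ _)).
  by rewrite mulrCA mulrA ler_wpM2r// mulrC.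
have [v [lam [hv Ev Av lam0 lam_inj]]] :=
  eigenbasis hH A_linear A_selfadjoint E_dim E_DA A_E A_spectrum.
have vDA i : DA (v i) by apply: E_DA; rewrite Ev; exact: span_mem.
have [gamma gamma0 S_dec] := S_decay.
have decay t z : 0 <= t -> let z' := z - low_proj dotH v z in
    `|S t z' - low_proj dotH v (S t z')| <= expR (- gamma * t) * `|z'|.
  by move=> t0; have := S_dec t z t0; rewrite /= Ev !orth_projE.
have Ahigh x : DA x -> (forall i, dotH x (v i) = 0) ->
    dotH (A x) x <= - gamma * `|x| ^+ 2.
  exact: (A_high hH S_generated gamma0 decay).
have c0 := kalman_cyclic hH A_linear A_selfadjoint E_dim E_DA A_E hv Ev Av y0_rank.
have [p [pT pu pric]] := riccati_low hH hU A_linear A_selfadjoint E_dim E_DA A_E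
  hv Ev Av lam0 bsP B_rank.
have [K [c [delta [K0 c_gt0 d01 lyap]]]] := lyap_estimate hH hU A_linear A_selfadjoint
  hv vDA Av lam0 gamma0 Ahigh bsP bs_bound pT pu pric.
have [eps0 [eta0 [eps00 eta00 close]]] := riccati_close hH hU A_linear A_selfadjoint
  hv Av bsP bs_bound beta0 pT pric K0 c_gt0 d01 lyap.
pose y := snapshot S T y0; pose mu i := expR (lam i * T); pose q := expR (- gamma * T).
have mu1 i : 1 < mu i by rewrite expR_gt1 mulr_gt0.
have mu_inj : injective mu.
  move=> i j /expR_inj; move/(mulIf (lt0r_neq0 T_gt0)); exact: lam_inj.
have q01 : 0 < q < 1.
  by rewrite expR_gt0 expR_lt1 mulNr oppr_lt0 mulr_gt0.
have kT k : 0 <= k%:R * T by rewrite mulr_ge0// ltW.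
have yDA k : DA (y k) by have [] := S_DA S_semigroup S_generated (kT k) y0_DA.
have qk k : expR (- gamma * (k%:R * T)) = q ^+ k.
  by rewrite /q -expRM_natl; congr expR; ring.
pose C0 := `|y0 - low_proj dotH v y0| + `|A y0 - low_proj dotH v (A y0)|.
have C00 : 0 <= C0 by rewrite addr_ge0.
have ylow k i : dotH (y k) (v i) = mu i ^+ k * dotH y0 (v i).
  rewrite /y /snapshot (S_coord hH A_linear A_selfadjoint S_semigroup S_generated
    hv vDA Av lam0 lam_inj gamma0 decay _ _ (kT k)).
  by rewrite /mu -expRM_natl; congr (expR _ * _); ring.
have q0 k : 0 <= q ^+ k by rewrite exprn_ge0// expR_ge0.
have yhigh k : `|y k - low_proj dotH v (y k)| <= C0 * q ^+ k.
  apply: (le_trans (S_high hH A_linear S_semigroup S_generated hv vDA Av lam0 gamma0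
    decay y0 (kT k))).
  by rewrite qk mulrC ler_wpM2r// lerDl.
have Ayhigh k : `|A (y k - low_proj dotH v (y k))| <= C0 * q ^+ k.
  apply: (le_trans (A_S_high hH A_linear A_selfadjoint S_semigroup S_generated hv vDA Av
    lam0 gamma0 decay (kT k) y0_DA)).
  by rewrite qk mulrC ler_wpM2r// lerDr.
have [n0 hn0] := pod_approximation hH A_linear hv vDA Av mu1 mu_inj c0 q01 C00 yDA ylow
  yhigh Ayhigh l_le_m eta00.
exists eps0, n0; split=> // eps n heps n_gt0 n0n hdim.
have podD := Dbar_pod n n_gt0 hdim.
have [phi hphi] := hn0 n _ n0n podD.
have [[_ Dsub [d dD _]] _] := podD.
have [u hu Du] := has_dim_onb hH dD.
rewrite Du in podD hphi Dsub *.
have uDA i : DA (u i).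
  have : snapshot_span (snapshot S T y0) n (u i) by apply: Dsub; exact: span_mem.
  by apply: (vs_span (DA_subspace A_linear)) => _ [k _ <-]; exact: yDA.
have [Q [QT pQ rQ mQ Qclose]] := close d u phi eps hu uDA
  (fun i => let: And3 h _ _ := hphi i in h) (fun i => let: And3 _ h _ := hphi i in h)
  (fun i => let: And3 _ _ h := hphi i in h) heps.
have [maxQ uniqQ] := reduced_riccati_maximal hH hU A_linear A_selfadjoint bsP hu uDA
  QT pQ rQ mQ.
split; first by exists (op_of_mx dotH u Q).
move=> P maxP; have PQ := uniqQ P maxP.
set D := lin_span (range u) in PQ *.
have loopE x : closed_loop dotH D A B (riccati_feedback dotH dotU D B P) x =
    A x - B (bs (op_of_mx dotH u Q x)).
  have pD : D (orth_proj dotH D x) by exact: orth_proj_mem.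
  rewrite /closed_loop /riccati_feedback PQ//.
  rewrite (reduced_B_adjE hU bsP hu); last exact: op_of_mx_range.
  by rewrite linearN /= /op_of_mx orth_projE// onb_coords.
have -> : closed_loop dotH D A B (riccati_feedback dotH dotU D B P) =
    fun x => A x - B (bs (op_of_mx dotH u Q x)) by apply/funext.
have [CV CV0 hCV] := lyapunov_op_bound hH hv p K0.
have v0 i : `|v i - v i| <= delta.
  by rewrite subrr normr0; case/andP: d01 => /ltW.
have Av0 i : `|A (v i) - A (v i)| <= delta.
  by rewrite subrr normr0; case/andP: d01 => /ltW.
have VB x z : lyapunov_op dotH p K v (x - z) = lyapunov_op dotH p K v x - lyapunov_op dotH
  p K v z.
  rewrite /lyapunov_op /finrank coordsB mulmxBl lincombB scalerBr opprD addrACA; congr (_ + _).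
have VD x z : lyapunov_op dotH p K v (x + z) = lyapunov_op dotH p K v x + lyapunov_op dotH
  p K v z.
  by rewrite /lyapunov_op /finrank coordsD mulmxDl lincombD scalerDr addrACA.
(* On H the Lyapunov function is taken with [phi = v], for which the closeness conditions are
   trivial; the POD subspace enters only through [Qclose]. *)
apply: (lyapunov_stable hH (V := lyapunov_op dotH p K v) (C := CV + 1) (c := c)) => //.
- split; first exact: DA_subspace A_linear.
  move=> a x z hx hz; rewrite (A_lin A_linear)// /op_of_mx coordsD coordsZ mulmxDl
    -scalemxAl lincombD lincombZ.
  by rewrite (bs_lin hU bsP) linearP /= scalerBr opprD addrACA.
- move=> x; apply: (le_trans (hCV v x _)); last by rewrite ler_wpM2r// lerDl.
  by move=> i; rewrite subrr normr0.
- by move=> x z; exact: lyapunov_op_sym.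
- by move=> x; exact: lyapunov_op_ge.
- by rewrite ltr_wpDl.
- move=> x hx; rewrite dotBl bsP; exact: lyap (Qclose x).
Qed.
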